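(* Let $1\le p<\infty$, $p\neq 2$. The relation $E_1$ is Borel reducible to $(\mathrm{Emb}(\ell_p,\ell_p),\sim)$ and to $(\mathrm{Emb}(\ell_p,L_p),\sim)$. Therefore the relation of position of $\ell_p$ in $\ell_p$ (resp. of $\ell_p$ in $L_p$), i.e. the relation $\sim$ on $\mathrm{Emb}(\ell_p,\ell_p)$ (resp. on $\mathrm{Emb}(\ell_p,L_p)$), is not Borel reducible to an orbit equivalence relation induced by the action of a Polish group.
   Context: For infinite dimensional separable Banach spaces $Y,X$, $\mathcal B(Y,X)$ is the set of bounded linear operators from $Y$ to $X$, a standard Borel space for the Borel structure generated by the strong operator topology. $\mathrm{Emb}(Y,X)$ is the Borel subset of $\mathcal B(Y,X)$ of those operators that are isomorphisms onto a closed subspace of infinite codimension in $X$. $GL(X)$ is the group of (linear, bounded, boundedly invertible) automorphisms of $X$. On $\mathrm{Emb}(Y,X)$, $T\sim U$ iff there exists $A\in GL(X)$ with $T=AU$. $L_p$ denotes $L_p[0,1]$. An equivalence relation $R$ on a standard Borel space $E$ is Borel reducible to an equivalence relation $S$ on a standard Borel space $F$ if there is a Borel map $f:E\to F$ with $xRy\Leftrightarrow f(x)Sf(y)$ for all $x,y\in E$. $E_1$ is the relation on $\mathbb R^{\mathbb N}$ given by $xE_1y$ iff there is $n$ with $x_m=y_m$ for all $m\ge n$. The orbit equivalence relation induced by a continuous action of a Polish group $H$ on a Polish space $Z$ is $x E_H y\Leftrightarrow \exists h\in H:\ y=hx$. *)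

(* Defs.v *)
From HB Require Import structures.
From mathcomp Require Import all_boot all_order all_algebra.
From mathcomp Require Import all_classical all_reals all_analysis.
From mathcomp Require Import measurable_realfun ess_sup_inf.

Set Implicit Arguments.
Unset Strict Implicit.
Unset Printing Implicit Defensive.

Import Order.TTheory GRing.Theory Num.Theory.
Import numFieldNormedType.Exports.

Local Open Scope classical_set_scope.
Local Open Scope ring_scope.

(* The library defines [LspaceType mu p1], the p-integrable functions modulo
   almost everywhere equality, as a bare type; it is given here its structure
   of normed space, the norm being the Lp-norm of any representative. *)
Section Lspace_normed.
Context d (T : measurableType d) (R : realType).
Variables (mu : {measure set T -> \bar R}) (p : \bar R) (p1 : (1 <= p)%E).

Local Notation Lp := (LspaceType mu p1).
Local Notation Lf := (LfunType mu p1).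

Definition Lspace_val (f : Lp) : {mfun_ mu, T >-> measurableTypeR R} := f.

Definition Lspace_repr (f : Lp) : {mfun T >-> measurableTypeR R} :=
  repr (Lspace_val f).

Lemma Lspace_repr_Lfun (f : Lp) : (Lspace_repr f : T -> R) \in Lfun mu p.
Proof.
apply/andP; split; rewrite inE/=.
  exact: (@measurable_funPT _ _ _ _ (Lspace_repr f)).
exact: (@Lebesgue_finite _ _ _ _ _ _ f).
Qed.

Definition Lfun_of_Lspace (f : Lp) : Lf := Lfun_Sub p1 (Lspace_repr_Lfun f).

Lemma Lfun_mfun (f : Lf) : (f : T -> measurableTypeR R) \in mfun.
Proof. by rewrite inE/=; exact: (@measurable_funPT _ _ _ _ f). Qed.

Definition Lfun_class (f : Lf) : {mfun_ mu, T >-> measurableTypeR R} :=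
  (\pi_({mfun_ mu, T >-> measurableTypeR R}) (mfun_Sub (Lfun_mfun f)))%qT.

Lemma Lfun_class_ae (f : Lf) : (Lfun_class f : T -> R) = f %[ae mu].
Proof.
have /eqmodP/asboolP := reprK (Lfun_class f).
exact.
Qed.

Lemma ae_eq_Lnorm (f g : T -> R) : measurable_fun setT f ->
  measurable_fun setT g -> f = g %[ae mu] ->
  'N[mu]_p[EFin \o f]%E = 'N[mu]_p[EFin \o g]%E.
Proof.
move=> mf mg fg; rewrite unlock.
case: p p1 => // [r _|_].
  congr (_ `^ _)%E; apply: ae_eq_integral => //.
  - apply/measurable_EFinP/(measurableT_comp (measurable_powR _)).
    exact: measurableT_comp.
  - apply/measurable_EFinP/(measurableT_comp (measurable_powR _)).
    exact: measurableT_comp.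
  - by apply: filterS fg => x /= + _ => /(_ I) ->.
case: ifP => // _; apply: eq_ess_sup.
by apply: filterS fg => x /= /(_ I) ->.
Qed.

Lemma Lfun_class_finite (f : Lf) : finite_norm mu p (Lfun_class f).
Proof.
rewrite /finite_norm (ae_eq_Lnorm _ _ (Lfun_class_ae f)).
- by have /andP[_] := LfunP f; rewrite inE/= /finite_norm.
- exact: (@measurable_funPT _ _ _ _ (repr (Lfun_class f))).
- exact: (@measurable_funPT _ _ _ _ f).
Qed.

Definition Lspace_of_Lfun (f : Lf) : Lp :=
  LebesgueSpace.Pack (LebesgueSpace.Class
   (isFinLebesgue.Build d T R mu p p1 _ (Lfun_class_finite f))).

Lemma Lspace_val_inj : injective Lspace_val.
Proof.
move=> [f [[f1]]] [g [[g1]]]; rewrite /Lspace_val/= => fg.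
by subst g; rewrite (Prop_irrelevance f1 g1).
Qed.

Lemma Lspace_of_LfunP (f g : Lf) :
  f = g %[ae mu] <-> Lspace_of_Lfun f = Lspace_of_Lfun g.
Proof.
split=> [fg|fg].
  by apply: Lspace_val_inj; apply/eqmodP/asboolP.
have /eqmodP/asboolP // : Lfun_class f = Lfun_class g.
by rewrite -[LHS]/(Lspace_val (Lspace_of_Lfun f)) fg.
Qed.

Lemma Lfun_of_LspaceK : cancel Lfun_of_Lspace Lspace_of_Lfun.
Proof.
move=> f; apply: Lspace_val_inj; rewrite -[RHS]reprK.
by apply/eqmodP/asboolP; exact: aeW.
Qed.

Lemma Lspace_of_LfunK (f : Lf) : Lfun_of_Lspace (Lspace_of_Lfun f) = f %[ae mu].
Proof. exact: Lfun_class_ae. Qed.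

HB.instance Definition _ := gen_eqMixin Lp.
HB.instance Definition _ := gen_choiceMixin Lp.

Definition Lspace_add (f g : Lp) : Lp :=
  Lspace_of_Lfun (Lfun_of_Lspace f + Lfun_of_Lspace g).
Definition Lspace_opp (f : Lp) : Lp := Lspace_of_Lfun (- Lfun_of_Lspace f).
Definition Lspace_scale (a : R) (f : Lp) : Lp :=
  Lspace_of_Lfun (a *: Lfun_of_Lspace f).
Definition Lspace_norm (f : Lp) : R := fine 'N[mu]_p[EFin \o Lfun_of_Lspace f].

Lemma Lspace_of_LfunD f g : Lspace_of_Lfun (f + g) =
  Lspace_add (Lspace_of_Lfun f) (Lspace_of_Lfun g).
Proof.
apply/Lspace_of_LfunP.
apply: filterS2 (Lspace_of_LfunK f) (Lspace_of_LfunK g) => x fx gx _.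
exact/esym/(congr2 +%R (fx I) (gx I)).
Qed.

Lemma Lspace_of_LfunN f : Lspace_of_Lfun (- f) = Lspace_opp (Lspace_of_Lfun f).
Proof.
apply/Lspace_of_LfunP; apply: filterS (Lspace_of_LfunK f) => x fx _.
exact/esym/(congr1 -%R (fx I)).
Qed.

Lemma Lspace_of_LfunZ a f :
  Lspace_of_Lfun (a *: f) = Lspace_scale a (Lspace_of_Lfun f).
Proof.
apply/Lspace_of_LfunP; apply: filterS (Lspace_of_LfunK f) => x fx _.
exact/esym/(congr1 ( *%R a) (fx I)).
Qed.

Lemma Lspace_ind (P : Lp -> Prop) :
  (forall f, P (Lspace_of_Lfun f)) -> forall f, P f.
Proof. by move=> Pf f; rewrite -(Lfun_of_LspaceK f). Qed.

Lemma Lspace_addA : associative Lspace_add.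
Proof.
elim/Lspace_ind=> f; elim/Lspace_ind=> g; elim/Lspace_ind=> h.
by rewrite -!Lspace_of_LfunD addrA.
Qed.

Lemma Lspace_addC : commutative Lspace_add.
Proof. by move=> f g; rewrite /Lspace_add addrC. Qed.

Lemma Lspace_add0 : left_id (Lspace_of_Lfun 0) Lspace_add.
Proof. by elim/Lspace_ind=> f; rewrite -!Lspace_of_LfunD add0r. Qed.

Lemma Lspace_addN : left_inverse (Lspace_of_Lfun 0) Lspace_opp Lspace_add.
Proof.
by elim/Lspace_ind=> f; rewrite -Lspace_of_LfunN -Lspace_of_LfunD addNr.
Qed.

HB.instance Definition _ := GRing.isZmodule.Build Lp
  Lspace_addA Lspace_addC Lspace_add0 Lspace_addN.

Let Lspace_of_LfunD' f g :
  Lspace_of_Lfun (f + g) = Lspace_of_Lfun f + Lspace_of_Lfun g.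
Proof. exact: Lspace_of_LfunD. Qed.

Lemma Lspace_scaleA a b f :
  Lspace_scale a (Lspace_scale b f) = Lspace_scale (a * b) f.
Proof.
by elim/Lspace_ind: f => f; rewrite -!Lspace_of_LfunZ scalerA.
Qed.

Lemma Lspace_scale1 : left_id 1 Lspace_scale.
Proof. by elim/Lspace_ind=> f; rewrite -Lspace_of_LfunZ scale1r. Qed.

Lemma Lspace_scaleDr : right_distributive Lspace_scale +%R.
Proof.
move=> a; elim/Lspace_ind=> f; elim/Lspace_ind=> g.
rewrite -Lspace_of_LfunD' -!Lspace_of_LfunZ.
by rewrite -Lspace_of_LfunD' scalerDr.
Qed.

Lemma Lspace_scaleDl f : {morph Lspace_scale^~ f : a b / a + b}.
Proof.
elim/Lspace_ind: f => f a b.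
by rewrite -!Lspace_of_LfunZ scalerDl Lspace_of_LfunD'.
Qed.

HB.instance Definition _ := GRing.Zmodule_isLmodule.Build R Lp
  Lspace_scaleA Lspace_scale1 Lspace_scaleDr Lspace_scaleDl.

Lemma Lspace_norm_of (f : Lf) :
  Lspace_norm (Lspace_of_Lfun f) = fine 'N[mu]_p[EFin \o f].
Proof.
congr fine; apply: ae_eq_Lnorm (Lspace_of_LfunK f).
- exact: (@measurable_funPT _ _ _ _ (Lfun_of_Lspace (Lspace_of_Lfun f))).
- exact: (@measurable_funPT _ _ _ _ f).
Qed.

Lemma Lspace_normD f g : Lspace_norm (f + g) <= Lspace_norm f + Lspace_norm g.
Proof.
elim/Lspace_ind: f => f; elim/Lspace_ind: g => g.
by rewrite -Lspace_of_LfunD' !Lspace_norm_of ler_LnormD.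
Qed.

Lemma Lspace_normZ (a : R) f : Lspace_norm (a *: f) = `|a| * Lspace_norm f.
Proof.
elim/Lspace_ind: f => f.
rewrite -[a *: Lspace_of_Lfun f]Lspace_of_LfunZ !Lspace_norm_of.
by rewrite LnormZ -finite_norm_fine -EFinM.
Qed.

Lemma Lspace_norm_eq0 f : Lspace_norm f = 0 -> f = 0.
Proof.
elim/Lspace_ind: f => f; rewrite Lspace_norm_of => /fine_Lnormr_eq0 f0.
by apply/Lspace_of_LfunP.
Qed.

HB.instance Definition _ := Lmodule_isNormed.Build R Lp
  Lspace_normD Lspace_normZ Lspace_norm_eq0.
End Lspace_normed.

Section operators.
Context {R : realType}.
Implicit Types X Y : normedModType R.

(* The topology that [{ptws Y -> X}] induces on this set is the strong operator
   topology. *)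
Definition bounded_operators Y X : set {ptws Y -> X} :=
  [set T | linear (T : Y -> X) /\
    exists M : R, forall y, `|T y| <= M * `|y|].
Arguments bounded_operators : clear implicits.

Definition finite_codimension X (V : set X) : Prop :=
  exists (n : nat) (e : 'I_n -> X),
    forall x, exists c : 'I_n -> R, V (x - \sum_i c i *: e i).

Definition isomorphism_onto_range Y X (T : Y -> X) : Prop :=
  exists S : X -> Y, cancel T S /\ {within range T, continuous S}.

Definition Emb Y X : set {ptws Y -> X} :=
  [set T | [/\ bounded_operators Y X T,
               isomorphism_onto_range T,
               closed (range T) &
               ~ finite_codimension (range T)]].
Arguments Emb : clear implicits.

Definition GL X : set (X -> X) :=
  [set A | bounded_operators X X A /\
    exists B : X -> X, [/\ bounded_operators X X B, cancel A B & cancel B A]].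
Arguments GL : clear implicits.

Definition position Y X (T U : Emb Y X) : Prop :=
  exists A : X -> X, GL X A /\ set_val T = A \o set_val U.

End operators.
Arguments bounded_operators {R} Y X.
Arguments Emb {R} Y X.
Arguments GL {R} X.
Arguments position {R} Y X.

Section ellp_Lp.
Context {R : realType} (p : R) (p1 : 1 <= p).

Definition ellp := @LspaceType _ nat R (@counting nat R) p%:E p1.
HB.instance Definition _ := NormedModule.on ellp.

(* L_p[0,1] is realized by functions on the real line: the measure vanishes off
   [0,1], so functions that agree a.e. on [0,1] are identified. *)
Definition lebesgue01 :=
  mrestr (@lebesgue_measure R) (measurable_itv `[0%R, 1%R]).
HB.instance Definition _ := Measure.on lebesgue01.

Definition Lp01 := @LspaceType _ _ R lebesgue01 p%:E p1.
HB.instance Definition _ := NormedModule.on Lp01.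

End ellp_Lp.

Definition borel {T : topologicalType} : set (set T) := <<s @open T >>.

Definition borel_map {E F : topologicalType} (f : E -> F) : Prop :=
  forall B : set F, borel B -> borel (f @^-1` B).

(* The sigma-algebra generated by the subspace topology on a Borel subset such
   as [Emb Y X] is the relative Borel structure. *)
Definition borel_reducible {E F : topologicalType}
    (RE : E -> E -> Prop) (RF : F -> F -> Prop) : Prop :=
  exists f : E -> F, borel_map f /\ forall x y, RE x y <-> RF (f x) (f y).

Definition E1 (R : realType) (x y : {ptws nat -> R}) : Prop :=
  exists n, forall m, (n <= m)%N -> x m = y m.

Section polish.
Variable R : realType.

Definition separable_space (T : topologicalType) : Prop :=
  exists D : set T, countable D /\ dense D.

Definition is_distance (T : Type) (d : T -> T -> R) : Prop :=
  [/\ forall x y, 0 <= d x y,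
      forall x y, d x y = 0 <-> x = y,
      forall x y, d x y = d y x &
      forall x y z, d x z <= d x y + d y z].

Definition distance_induces (T : topologicalType) (d : T -> T -> R) : Prop :=
  forall (x : T) (A : set T),
    nbhs x A <-> exists2 e : R, 0 < e & [set y | d x y < e] `<=` A.

Definition complete_distance (T : topologicalType) (d : T -> T -> R) : Prop :=
  forall u : nat -> T,
    (forall e : R, 0 < e ->
       exists N, forall m n, (N <= m)%N -> (N <= n)%N -> d (u m) (u n) < e) ->
    exists l : T, u @ \oo --> l.

Definition polish (T : topologicalType) : Prop :=
  separable_space T /\
  exists d : T -> T -> R,
    [/\ is_distance d, distance_induces d & complete_distance d].

End polish.

HB.mixin Record isTopologicalGroup G of Topological G & Group G := {
  mulg_continuous : continuous (fun xy : G * G => (xy.1 * xy.2)%g) ;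
  invg_continuous : continuous (fun x : G => (x^-1)%g)
}.

#[short(type="topologicalGroupType")]
HB.structure Definition TopologicalGroup :=
  {G of Topological G & Group G & isTopologicalGroup G}.

Definition continuous_action (H : topologicalGroupType) (Z : topologicalType)
    (act : H -> Z -> Z) : Prop :=
  [/\ forall z, act 1%g z = z,
      forall g h z, act (g * h)%g z = act g (act h z) &
      continuous (fun hz : H * Z => act hz.1 hz.2)].

Definition orbit_equivalence (H : topologicalGroupType) (Z : topologicalType)
    (act : H -> Z -> Z) (x y : Z) : Prop :=
  exists h : H, y = act h x.

Definition reducible_to_polish_action (R : realType) {E : topologicalType}
    (RE : E -> E -> Prop) : Prop :=
  exists (H : topologicalGroupType) (Z : topologicalType) (act : H -> Z -> Z),
    [/\ polish R H, polish R Z, continuous_action act &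
        borel_reducible RE (orbit_equivalence act)].

(* Main.v *)
(* Reduction of E1.  For p <> 2 there are, with uniform constants, embeddings of
   l_p^d into l_p^N all of whose left inverses have norm at least K, for every K:
   for p < 2 a family of convolution operators on a Boolean cube that comes
   from a random linear code, for p > 2 a perturbed projection onto the
   span of truncated Rademacher functions (Rosenthal's inequality).  Split l_p
   into blocks indexed by (n, j), and let D_n be an automorphism of a block that
   extends the n-th bad embedding.  A sequence of reals x is sent to the
   embedding that applies D_n on the block (n, j) when the j-th rational is less
   than x n, and nothing otherwise.  Changing finitely many x n composes with an
   automorphism, while an automorphism relating two images yields bounded left
   inverses of the bad embeddings on which they differ, so that these are of
   bounded index.  For L_p the construction is transported through a
   complemented copy of l_p.

   Non-reducibility (Kechris-Louveau).  Suppose f reduces E1 to a Polish action.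
   Then f x = g . f (x with x n replaced by 0) for some g; generically, by a
   category argument along the tree of finite sequences of small balls of the
   group, such a g can be chosen so that nearby points have nearby g'.  By
   Kuratowski-Ulam one then changes the coordinates of a generic x one at a
   time, the corresponding group elements forming a Cauchy sequence: in the
   limit all coordinates have changed but the orbit of f x has not. *)
Require Import Defs.
From mathcomp Require Import all_boot all_order all_algebra.
From mathcomp Require Import all_classical all_reals all_analysis.
From mathcomp Require Import measurable_realfun.
From mathcomp Require Import ring lra zify.

Set Implicit Arguments.
Unset Strict Implicit.
Unset Printing Implicit Defensive.

Import Order.TTheory GRing.Theory Num.Theory.
Import numFieldNormedType.Exports.

Local Open Scope classical_set_scope.
Local Open Scope ring_scope.

(** * Fourier analysis on Boolean cubes *)

Section F2_fourier.
Context {R : realType}.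

(** In a Hilbert space a subspace is always the range of a projection of norm one, so nothing of
    this kind can happen for p = 2. For other p the uniform constants are what permits gluing: the
    bad embeddings for all K must fit into one operator that is bounded and bounded below. The
    automorphisms D_n themselves have no common bound, but a change of finitely many x n involves
    finitely many of them. Changing a single real may flip infinitely many of its bits; as all the
    blocks (n, j) carry the same D_n, one bound serves them all.

    For p < 2 the code has two opposing features. Its characters are balanced, so that the
    convolutions are bounded below in l_p, with constants depending on p only. Its minimum distance
    is large, so that there is a function with value 1 at the origin whose convolutions are tiny; a
    left inverse has to recover that 1 from them. For p > 2 the source is the gap between the two
    terms of the norm of Rosenthal's space X_p, a p-norm and a weighted 2-norm: splitting them into
    two summands keeps the norm, but no bounded operator can put them together again. *)

Definition dotF2 n (b x : 'rV['F_2]_n) : 'F_2 := (b *m x^T) 0 0.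

Definition sgnF2 (z : 'F_2) : R := if z == 0 then 1 else -1.

Definition chiF2 n (b x : 'rV['F_2]_n) : R := sgnF2 (dotF2 b x).

Lemma F2_cases (z : 'F_2) : z = 0 \/ z = 1.
Proof. by case: z => -[|[|//]] i; [left|right]; apply: val_inj. Qed.

Lemma sgnF2D y z : sgnF2 (y + z) = sgnF2 y * sgnF2 z.
Proof.
by case: (F2_cases y) => ->; case: (F2_cases z) => ->; rewrite /sgnF2 /=; lra.
Qed.

Lemma addrv2 n (x : 'rV['F_2]_n) : x + x = 0.
Proof. by apply/rowP => i; rewrite !mxE; case: (F2_cases (x 0 i)) => ->; apply: val_inj. Qed.

Lemma oppv2 n (x : 'rV['F_2]_n) : - x = x.
Proof. by apply/eqP; rewrite eq_sym -subr_eq0 opprK addrv2. Qed.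

Lemma dotF2C n (b x : 'rV['F_2]_n) : dotF2 b x = dotF2 x b.
Proof. by rewrite /dotF2 !mxE; apply: eq_bigr => i _; rewrite !mxE mulrC. Qed.

Lemma dotF2Dr n (b x y : 'rV['F_2]_n) : dotF2 b (x + y) = dotF2 b x + dotF2 b y.
Proof. by rewrite /dotF2 linearD mulmxDr !mxE. Qed.

Lemma dotF2Dl n (b x y : 'rV['F_2]_n) : dotF2 (b + x) y = dotF2 b y + dotF2 x y.
Proof. by rewrite /dotF2 mulmxDl !mxE. Qed.

Lemma dotF2_mul n k (b : 'rV['F_2]_n) (M : 'M['F_2]_(k, n)) h :
  dotF2 b (h *m M) = dotF2 (b *m M^T) h.
Proof. by rewrite /dotF2 trmx_mul mulmxA. Qed.

Lemma chiF2Dr n (b x y : 'rV['F_2]_n) : chiF2 b (x + y) = chiF2 b x * chiF2 b y.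
Proof. by rewrite /chiF2 dotF2Dr sgnF2D. Qed.

Lemma chiF2Dl n (b x y : 'rV['F_2]_n) : chiF2 (b + x) y = chiF2 b y * chiF2 x y.
Proof. by rewrite /chiF2 dotF2Dl sgnF2D. Qed.

Lemma exists_dotF2 n (x : 'rV['F_2]_n) : x != 0 -> exists b, dotF2 b x = 1.
Proof.
move=> /rV0Pn[i xi]; exists (delta_mx 0 i).
rewrite /dotF2 -rowE !mxE.
by case: (F2_cases (x 0 i)) xi => ->; rewrite ?eqxx.
Qed.

(** Orthogonality of characters: shifting b by some b0 with [dotF2 b0 x = 1] changes the sign of the
    sum. *)
Lemma sum_chiF2 n (x : 'rV['F_2]_n) :
  \sum_b chiF2 b x = (2 ^ n)%:R * (x == 0)%:R :> R.
Proof.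
case: eqP => [->|/eqP /exists_dotF2[b0 xb0]]; rewrite ?mulr1 ?mulr0.
  rewrite (eq_bigr (fun=> 1)); last first.
    by move=> b _; rewrite /chiF2 /sgnF2 /dotF2 linear0 mulmx0 mxE eqxx.
  by rewrite sumr_const cardE -cardE card_mx card_Fp// mul1n.
set s := \sum_b _.
have : s = - s.
  rewrite {1}/s (reindex_inj (addIr b0))/= -sumrN; apply: eq_bigr => b _.
  by rewrite chiF2Dl [chiF2 b0 x]/chiF2 xb0 /sgnF2 /= mulrN1.
lra.
Qed.

Lemma sum_chiF2r n (b : 'rV['F_2]_n) :
  \sum_x chiF2 b x = (2 ^ n)%:R * (b == 0)%:R :> R.
Proof.
by rewrite -sum_chiF2; apply: eq_bigr => x _; rewrite /chiF2 dotF2C.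
Qed.

Definition fourierF2 n (u : 'rV['F_2]_n -> R) b := \sum_x u x * chiF2 b x.

(** Expanding both transforms and summing the characters over b leaves only the pairs with z = x +
    y, since -x = x over F_2. *)
Lemma parseval_shift n (u v : 'rV['F_2]_n -> R) y :
  (2 ^ n)%:R * \sum_x u x * v (x + y) =
  \sum_b fourierF2 u b * fourierF2 v b * chiF2 b y.
Proof.
transitivity (\sum_x \sum_z \sum_b u x * v z * chiF2 b (x + z + y)).
  rewrite mulr_sumr; apply: eq_bigr => x _.
  under eq_bigr do rewrite -mulr_sumr sum_chiF2.
  rewrite (bigD1 (x + y))//= big1 ?addr0 => [|z zxy].
    by rewrite (_ : x + (x + y) + y = 0) ?addrA ?addrv2 ?add0r ?addrv2// eqxx mulr1 mulrC.
  case: eqP; rewrite ?mulr0// => xzy.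
  case/eqP: zxy; apply/eqP; rewrite -subr_eq0 (oppv2 (x + y)) addrA.
  by rewrite (addrC z) xzy.
rewrite exchange_big/=.
under eq_bigr do rewrite exchange_big/=.
rewrite exchange_big/=; apply: eq_bigr => b _.
rewrite /fourierF2 mulr_sumr mulr_suml; apply: eq_bigr => z _.
rewrite !mulr_suml; apply: eq_bigr => x _.
by rewrite !chiF2Dr; ring.
Qed.

Lemma parsevalF2 n (u : 'rV['F_2]_n -> R) :
  (2 ^ n)%:R * \sum_x u x ^+ 2 = \sum_b fourierF2 u b ^+ 2.
Proof.
have := parseval_shift u u 0; under eq_bigr do rewrite addr0 -expr2.
move=> ->; apply: eq_bigr => b _.
by rewrite /chiF2 /sgnF2 /dotF2 linear0 mulmx0 mxE eqxx mulr1 expr2.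
Qed.

End F2_fourier.

(** * A random linear code *)

(** From 1 - x <= exp(-x) follows exp x <= 1 / (1 - x), and (1 + x + 2 x^2)(1 - x) = 1 + x^2 (1 - 2
    x) is at least 1. Negative x may be of any size. *)
Lemma expR_le_quad {R : realType} (x : R) : x <= 2^-1 ->
  expR x <= 1 + x + 2 * x ^+ 2.
Proof.
move=> x12; have x1 : 0 < 1 - x by lra.
have e0 := expR_gt0 x.
have : expR x * (1 - x) <= 1.
  have := ler_wpM2l (expR_ge0 x) (expR_ge1Dx (- x)).
  by rewrite expRxMexpNx_1.
rewrite -ler_pdivlMr// => /le_trans; apply.
rewrite div1r -(ler_pM2r x1) mulVf ?gt_eqF//.
have := mulr_ge0 (sqr_ge0 x) (_ : 0 <= 1 - 2 * x); nra.
Qed.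

(** * Fibres of additive maps and a Chernoff bound, by counting *)

Section finite_counting.

Lemma card_fiber (A B : finType) (f : A -> B) b0 :
  (forall b, exists2 t : A -> A, bijective t & forall a, (f (t a) == b) = (f a == b0)) ->
  (#|[pred a | f a == b0]| * #|B| = #|A|)%N.
Proof.
move=> ht.
have fiber b : #|[pred a | f a == b]| = #|[pred a | f a == b0]|.
  have [t bt ft] := ht b; rewrite -[RHS](fintype.card_image (bij_inj bt)).
  apply: eq_card => a; apply/idP/fintype.imageP => [/eqP fa|[a' /eqP fa' ->]].
    have [t' _ tK] := bt; exists (t' a); rewrite ?tK//.
    by rewrite inE -ft tK fa.
  by rewrite inE ft fa'.
rewrite -[RHS]sum1_card (partition_big f xpredT)//=.
under eq_bigr => b _.
  rewrite sum1_card (fiber b); over.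
by rewrite sum_nat_const mulnC.
Qed.

(** The fibres of a surjective additive map are translates of its kernel. The finite types U, V are
    kept apart from the groups A, B and tied to them by bijections, which are identities in the uses
    below. *)
Lemma card_ker_surj (A B : zmodType) (U V : finType) (i : U -> A) (j : A -> U)
    (k : V -> B) (f : A -> B) : cancel i j -> cancel j i -> bijective k ->
  {morph f : x y / x + y} -> (forall b, exists a, f a = b) ->
  (#|[pred u | f (i u) == 0%R]| * #|V| = #|U|)%N.
Proof.
move=> ij ji [l kl lk] fD surj.
rewrite -(@card_fiber U V (l \o f \o i) (l 0)) => [|v].
  by congr (_ * _)%N; apply: eq_card => u; rewrite !inE/= (can_eq lk).
have [a0 fa0] := surj (k v); exists (fun u => j (a0 + i u)).
  by exists (fun u => j (i u - a0)) => u; rewrite ji (addrC a0) (addrK, subrK) ij.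
move=> u /=; rewrite (can_eq lk) ji fD fa0 -{2}(kl v) (can_eq lk).
by rewrite -subr_eq0 addrAC subrr add0r.
Qed.

Context {R : realType}.

(** Moment generating function of the number of hits among L independent uniform draws, each of
    which hits P with probability 1/r; the sum factors over the draws. *)
Lemma sum_expR_count (A : finType) (P : pred A) (r L : nat) (s : R) :
  (0 < r)%N -> (#|P| * r = #|A|)%N ->
  \sum_(f : {ffun 'I_L -> A}) expR (s * #|[pred i | P (f i)]|%:R) <=
  (#|A| ^ L)%:R * expR (L%:R / r%:R * (expR s - 1)).
Proof.
move=> r0 Pr.
rewrite (eq_bigr (fun f : {ffun 'I_L -> A} =>
    \prod_(i < L) expR (s * (P (f i))%:R))); last first.
  move=> f _; rewrite -expR_sum -mulr_sumr; congr (expR (s * _)).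
  rewrite -sum1_card natr_sum big_mkcond/=; apply: eq_bigr => i _.
  by rewrite inE; case: (P _).
rewrite -(bigA_distr_bigA (fun i (a : A) => expR (s * (P a)%:R))).
rewrite prodr_const card_ord natrX -mulrA expRM_natl -exprMn.
have rP : (0 : R) < r%:R by rewrite ltr0n.
have -> : \sum_a expR (s * (P a)%:R) = #|A|%:R * (1 + (expR s - 1) / r%:R) :> R.
  rewrite (bigID P)/= (eq_bigr (fun=> expR s)); last by move=> a ->; rewrite mulr1.
  rewrite [X in _ + X](eq_bigr (fun=> 1)); last first.
    by move=> a /negbTE ->; rewrite mulr0 expR0.
  rewrite !sumr_const.
  have := cardC P => /(congr1 (fun n => n%:R : R)); rewrite natrD => h.
  have PrR : #|P|%:R * r%:R = #|A|%:R :> R by rewrite -natrM Pr.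
  rewrite -[RHS]/(_ * (1 + _ / _)) mulrDr mulr1 mulrCA -PrR mulfK ?gt_eqF// PrR -h.
  rewrite -[expR s *+ _]mulr_natr.
  by rewrite -[#|[predC P]|]/(#|predC P|); ring.
rewrite (mulrC _^-1).
have e1 : 0 <= 1 + (expR s - 1) / r%:R.
  have r1 : (1 : R) <= r%:R by rewrite ler1n.
  have : 0 <= expR s / r%:R by rewrite divr_ge0 ?expR_ge0// ltW.
  have : r%:R^-1 <= 1 :> R by rewrite invf_le1.
  by rewrite mulrBl; lra.
apply: lerXn2r; rewrite ?nnegrE ?mulr_ge0 ?expR_ge0//.
by rewrite ler_wpM2l// expR_ge1Dx.
Qed.

Lemma chernoff_count (A : finType) (P : pred A) (r L : nat) (d : R) :
  (0 < r)%N -> (#|P| * r = #|A|)%N -> 0 < d <= 1 ->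
  (#|[pred f : {ffun 'I_L -> A} |
      d * L%:R < `|r%:R * #|[pred i | P (f i)]|%:R - L%:R|]|)%:R <=
  2 * (#|A| ^ L)%:R * expR (- (d ^+ 2 * L%:R / (8 * r%:R))).
Proof.
move=> r0 Pr /andP[d0 d1].
have rP : (0 : R) < r%:R by rewrite ltr0n.
pose z (f : {ffun 'I_L -> A}) : R := #|[pred i | P (f i)]|%:R.
(* This s minimises 2 s^2 - s d, the exponent that the quadratic bound on the exponential leaves;
   [s] serves the upper tail and [- s] the lower one. *)
pose s := d / 4.
pose c1 := - (s * (1 + d) * L%:R / r%:R).
pose c2 := s * (1 - d) * L%:R / r%:R.
rewrite -sum1_card natr_sum big_mkcond/=.
have -> : 2 * (#|A| ^ L)%:R * expR (- (d ^+ 2 * L%:R / (8 * r%:R))) =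
  (#|A| ^ L)%:R * expR (- (d ^+ 2 * L%:R / (8 * r%:R))) +
  (#|A| ^ L)%:R * expR (- (d ^+ 2 * L%:R / (8 * r%:R))) :> R by ring.
have L0 : (0 : R) <= L%:R / r%:R by rewrite divr_ge0// ltW.
have quad (t : R) : `|t| <= 2^-1 -> expR t - 1 <= t + 2 * t ^+ 2.
  by move=> /ler_normlW /expR_le_quad; lra.
have bnd t c : `|t| <= 2^-1 ->
    c + L%:R / r%:R * (t + 2 * t ^+ 2) = - (d ^+ 2 * L%:R / (8 * r%:R)) ->
    \sum_(f : {ffun 'I_L -> A}) expR (t * z f + c) <=
    (#|A| ^ L)%:R * expR (- (d ^+ 2 * L%:R / (8 * r%:R))).
  move=> ht hc; under eq_bigr do rewrite expRD.
  rewrite -mulr_suml.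
  have /(ler_wpM2r (expR_ge0 c)) : \sum_(f : {ffun 'I_L -> A}) expR (t * z f) <=
    (#|A| ^ L)%:R * expR (L%:R / r%:R * (expR t - 1)) := @sum_expR_count A P r L t r0 Pr.
  move=> /le_trans; apply.
  rewrite -(mulrA (#|A| ^ L)%:R) -expRD ler_wpM2l// ler_expR -hc addrC lerD2l ler_wpM2l//.
  exact: quad.
apply: le_trans (lerD (bnd s c1 _ _) (bnd (- s) c2 _ _)).
- rewrite -big_split/=; apply: ler_sum => f _; rewrite inE.
  have e1 := expR_ge0 (s * z f + c1); have e2 := expR_ge0 (- s * z f + c2).
  case: ifP => [|_]; last by rewrite addr_ge0.
  rewrite -/(z f) lter_normr => /orP[h|h].
    apply: le_trans (_ : expR (s * z f + c1) <= _); last by rewrite lerDl.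
    rewrite -expR0 ler_expR /c1 -mulrA -mulrA -mulrBr mulr_ge0 ?divr_ge0 ?ltW//.
    by rewrite mulrA subr_gt0 ltr_pdivrMr//; lra.
  apply: le_trans (_ : expR (- s * z f + c2) <= _); last by rewrite lerDr.
  rewrite -expR0 ler_expR /c2 mulNr addrC -!mulrA -mulrBr mulr_ge0 ?divr_ge0 ?ltW//.
  by rewrite -mulrBr mulr_gt0// subr_gt0 mulrA ltr_pdivlMr//; lra.
- by rewrite ger0_norm /s; lra.
- by rewrite /c1 /s; field; rewrite gt_eqF.
- by rewrite normrN ger0_norm /s; lra.
- by rewrite /c2 /s; field; rewrite gt_eqF.
Qed.

End finite_counting.

(** * A code with balanced characters and large minimum distance *)

Section random_code.
Context {R : realType}.

Definition wsupp (T : finType) k (w : {ffun T -> 'rV['F_2]_k}) := #|[pred i | w i != 0]|.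

Lemma card_mx_col0 m k (b : 'rV['F_2]_m) : b != 0 ->
  (#|[pred M : 'M['F_2]_(k, m) | b *m M^T == 0%R]| * 2 ^ k = #|'M['F_2]_(k, m)|)%N.
Proof.
move=> b0; rewrite (_ : (2 ^ k = #|'rV['F_2]_k|)%N); last by rewrite card_mx card_Fp// mul1n.
apply: (@card_ker_surj 'M['F_2]_(k, m) 'rV['F_2]_k _ _ id id id (fun M => b *m M^T)) => //.
  by exists id.
  by move=> M N; rewrite linearD mulmxDr.
move=> c; have [i bi] := rV0Pn _ b0.
exists (c^T *m delta_mx 0 i).
rewrite trmx_mul trmxK trmx_delta mulmxA -[LHS]mul1mx.
rewrite (_ : b *m delta_mx i 0 = 1%:M) ?mul1mx// .
apply/matrixP => ? ?; rewrite !ord1 -colE !mxE.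
by case: (F2_cases (b 0 i)) bi => ->.
Qed.

(** A nonzero word w is a codeword for exactly a fraction 2^-m of all codes: a single nonzero block
    of w already makes the syndrome of w range over everything as M varies. *)
Lemma card_code_ker m k L (w : {ffun 'I_L -> 'rV['F_2]_k}) : w != 0%R ->
  (#|[pred M : {ffun 'I_L -> 'M['F_2]_(k, m)} | (\sum_i w i *m M i)%R == 0%R]| * 2 ^ m =
   #|{ffun 'I_L -> 'M['F_2]_(k, m)}|)%N.
Proof.
move=> w0; rewrite (_ : (2 ^ m = #|'rV['F_2]_m|)%N); last by rewrite card_mx card_Fp// mul1n.
apply: (@card_ker_surj {ffun 'I_L -> 'M['F_2]_(k, m)} 'rV['F_2]_m _ _ id id id
  (fun M => (\sum_i w i *m M i)%R)) => //.
  by exists id.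
  move=> M N; rewrite -big_split/=; apply: eq_bigr => i _.
  by rewrite ffunE mulmxDr.
have [i wi] : exists i, w i != 0.
  apply/existsP; rewrite -[[exists _, _]]negbK; apply: contra w0.
  rewrite negb_exists => /forallP w0; apply/eqP/ffunP => i.
  by rewrite ffunE; apply/eqP; rewrite -[_ == _]negbK.
have [j wij] := rV0Pn _ wi.
move=> c; exists [ffun i' => if i' == i then delta_mx j 0 *m c else 0].
rewrite (bigD1 i)//= big1 ?addr0 => [|i' /negbTE i'i]; rewrite ffunE ?i'i ?mulmx0// eqxx.
rewrite mulmxA (_ : w i *m delta_mx j 0 = 1%:M) ?mul1mx//.
apply/matrixP => ? ?; rewrite !ord1 -colE !mxE.
by case: (F2_cases (w i 0 j)) wij => ->.
Qed.

(** Union bound. By the Chernoff bound a given b is unbalanced with probability at most 1 / (4 *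
    2^m), and there are 2^m of them; a given light word is a codeword with probability 2^-m, and
    there are at most 2^m / 4 of these. Each kind of failure thus has probability at most 1/4. *)
Lemma exists_code (m k L W : nat) (d : R) : 0 < d <= 1 ->
  8 * (2 ^ m)%:R <= expR (d ^+ 2 * L%:R / (8 * (2 ^ k)%:R)) ->
  (4 * #|[pred w : {ffun 'I_L -> 'rV['F_2]_k} | (wsupp w <= W)%N]| <= 2 ^ m)%N ->
  exists M : {ffun 'I_L -> 'M['F_2]_(k, m)},
    (forall b : 'rV['F_2]_m, b != 0 ->
       `|(2 ^ k)%:R * #|[pred i | b *m (M i)^T == 0%R]|%:R - L%:R| <= d * L%:R) /\
    (forall w : {ffun 'I_L -> 'rV['F_2]_k}, w != 0 -> (wsupp w <= W)%N ->
       \sum_i w i *m M i != 0).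
Proof.
move=> d01 hexp hW.
pose T := {ffun 'I_L -> 'M['F_2]_(k, m)}.
pose A (b : 'rV['F_2]_m) := [pred M : T | d * L%:R <
  `|(2 ^ k)%:R * #|[pred i | b *m (M i)^T == 0%R]|%:R - L%:R|].
pose B (w : {ffun 'I_L -> 'rV['F_2]_k}) := [pred M : T | (\sum_i w i *m M i)%R == 0%R].
pose S := [pred w : {ffun 'I_L -> 'rV['F_2]_k} | (w != 0%R) && (wsupp w <= W)%N].
suff [M HM] : exists M : T, ~~ [exists b, (b != 0%R) && A b M] && ~~ [exists w, (w \in S) && B w M].
  exists M; move: HM; rewrite !negb_exists => /andP[/forallP hA /forallP hB]; split=> [b b0|w w0 wW].
    by have := hA b; rewrite b0/= -leNgt.
  by have := hB w; rewrite !inE w0 wW.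
apply/existsP; rewrite -[[exists _, _]]negbK negb_exists; apply/negP => /forallP hall.
have T0 : (0 < #|T|)%N by apply/card_gt0P; exists 0%R.
have cardT : #|T| = (#|'M['F_2]_(k, m)| ^ L)%N by rewrite card_ffun card_ord.
have cA b : b != 0 -> 4 * (2 ^ m)%:R * #|A b|%:R <= #|T|%:R :> R.
  move=> b0; have := @chernoff_count R _ _ (2 ^ k)%N L d (expn_gt0 2 k) (card_mx_col0 k b0) d01.
  rewrite -cardT => h.
  have {}h : #|A b|%:R <= 2 * #|T|%:R * expR (- (d ^+ 2 * L%:R / (8 * (2 ^ k)%:R))) := h.
  apply: le_trans (ler_wpM2l _ h) _; first by rewrite mulr_ge0.
  move: hexp; rewrite expRN; set E := expR _ => hexp.
  have E0 : 0 < E by exact: expR_gt0.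
  rewrite mulrA ler_pdivrMr// mulrA.
  by have := ler_wpM2l (ler0n R #|T|) hexp; lra.
have cB w : w != 0 -> (2 ^ m)%:R * #|B w|%:R = #|T|%:R :> R.
  by move=> w0; rewrite -natrM mulnC card_code_ker.
have : #|T|%:R <= \sum_(b : 'rV['F_2]_m | b != 0) #|A b|%:R + \sum_(w in S) #|B w|%:R :> R.
  rewrite -!natr_sum -natrD ler_nat.
  have hb b : #|A b| = (\sum_(M : T) A b M)%N by rewrite -sum1_card big_mkcond; apply: eq_bigr => M _; rewrite unfold_in/=; case: ifP.
  have hw w : #|B w| = (\sum_(M : T) B w M)%N by rewrite -sum1_card big_mkcond; apply: eq_bigr => M _; rewrite unfold_in/=; case: ifP.
  under eq_bigr do rewrite hb; rewrite exchange_big/=.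
  under [X in (_ + X)%N]eq_bigr do rewrite hw; rewrite [X in (_ + X)%N]exchange_big/= -big_split/= -sum1_card.
  apply: leq_sum => M _; have := hall M; rewrite negb_and !negbK => /orP[] /existsP[x /andP[x0 Hx]].
    by rewrite (bigD1 x x0)/=; move: Hx => /= ->; rewrite -addnA addn_gt0.
  by rewrite addnC (bigD1 x x0)/=; move: Hx => /= ->; rewrite -addnA addn_gt0.
have m0 : 0 < (2 ^ m)%:R :> R by rewrite ltr0n expn_gt0.
have sA : (2 ^ m)%:R * \sum_(b : 'rV['F_2]_m | b != 0) #|A b|%:R <= (2 ^ m)%:R * #|T|%:R / 4 :> R.
  rewrite mulr_sumr; apply: le_trans (_ : \sum_(b : 'rV['F_2]_m) (#|T|%:R / 4) <= _).
    rewrite big_mkcond; apply: ler_sum => b _; case: ifP => [b0|_]; last by rewrite divr_ge0.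
    by have := cA b b0; lra.
  have cV : #|'rV['F_2]_m| = (2 ^ m)%N by rewrite card_mx card_Fp// mul1n.
  by rewrite sumr_const [X in _ *+ X]cV -(mulr_natl (_ / _)) mulrA.
have sB : (2 ^ m)%:R * \sum_(w in S) #|B w|%:R <= (2 ^ m)%:R * #|T|%:R / 4 :> R.
  rewrite mulr_sumr (eq_bigr (fun=> #|T|%:R)); last by move=> w /andP[w0 _]; exact: cB.
  rewrite sumr_const -(mulr_natr #|T|%:R) [leLHS]mulrC [leRHS]mulrAC ler_wpM2r//.
  have : (4 * #|S| <= 2 ^ m)%N.
    apply: leq_trans hW; rewrite leq_mul2l/=; apply: subset_leq_card.
    by apply/fintype.subsetP => w; rewrite !inE => /andP[].
  by rewrite -(ler_nat R) natrM; lra.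
move=> /(ler_wpM2l (ltW m0)); rewrite mulrDr => h.
have : 0 < (2 ^ m)%:R * #|T|%:R :> R by rewrite mulr_gt0// ltr0n.
lra.
Qed.

End random_code.

(** * Lower bounds for the code operators *)

Section powR_facts.
Context {R : realType}.
Implicit Types (x y q : R).

Lemma powR_sum_subadd (I : finType) (P : pred I) (a : I -> R) q :
  0 < q <= 1 -> (forall i, P i -> 0 <= a i) ->
  (\sum_(i | P i) a i) `^ q <= \sum_(i | P i) a i `^ q.
Proof.
move=> /andP[q0 q1] a0; set A := \sum_(i | P i) a i.
have A0 : 0 <= A by exact: sumr_ge0.
have [->|An0] := eqVneq A 0; first by rewrite powR0 ?gt_eqF// sumr_ge0// => i _; exact: powR_ge0.
have Ap : 0 < A by rewrite lt_neqAle eq_sym An0.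
have Aq : 0 < A `^ q by exact: powR_gt0.
rewrite -[leLHS]mul1r -ler_pdivlMr// mulr_suml -(divff An0) mulr_suml.
apply: ler_sum => i Pi; have [->|ai0] := eqVneq (a i) 0.
  by rewrite mul0r divr_ge0// ?powR_ge0// ltW.
have aip : 0 < a i by rewrite lt_neqAle eq_sym ai0 a0.
have aiA : a i / A <= 1.
  rewrite ler_pdivrMr// mul1r /A (bigD1 i)//= lerDl.
  by rewrite sumr_ge0// => j /andP[/a0].
have := @ger1_powR _ (a i / A) q _ q1.
rewrite divr_gt0// aiA => /(_ isT) /le_trans; apply.
by rewrite powRM ?invr_ge0 ?a0// -powR_inv1// -powRrM mulN1r powRN.
Qed.

(** Every term is compared with the largest one. The constant is crude, but the bound holds for all
    q > 0, on both sides of 1. *)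
Lemma powR_sum_max (I : finType) (a : I -> R) q :
  0 < q -> `|\sum_i a i| `^ q <= #|I|%:R `^ q * \sum_i `|a i| `^ q.
Proof.
move=> q0; have [i0 _|I0] := pickP (@predT I); last first.
  by rewrite !big_pred0// normr0 mulr0 powR0 ?gt_eqF.
have [i _ imax] := @Order.TotalTheory.arg_maxP _ _ _ i0 xpredT (fun i => `|a i|) isT.
apply: le_trans (_ : (#|I|%:R * `|a i|) `^ q <= _).
  apply: ge0_ler_powR; rewrite ?nnegrE ?mulr_ge0//; first exact: ltW.
  apply: le_trans (ler_norm_sum _ _ _) _.
  apply: le_trans (_ : \sum_(j : I) `|a i| <= _); first by apply: ler_sum => j _; exact: imax.
  by rewrite sumr_const mulr_natl.
by rewrite powRM// ler_wpM2l ?powR_ge0// (bigD1 i)//= lerDl sumr_ge0.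
Qed.

Lemma powR_normD x y q : 0 < q -> `|x + y| `^ q <= 2 `^ q * (`|x| `^ q + `|y| `^ q).
Proof.
move=> q0; have := @powR_sum_max bool (fun b => if b then x else y) q q0.
by rewrite card_bool !big_bool.
Qed.

(** If x^p > 1/4 then x^(2-p) >= 1/4, trivially for x >= 1 and otherwise because x^(2-p) >= x >=
    x^p. The constants do not depend on p. *)
Lemma powR_le_quad x p : 1 <= p < 2 -> 0 <= x -> x `^ p <= 4^-1 + 4 * x ^+ 2.
Proof.
move=> /andP[p1 p2] x0; have x20 := sqr_ge0 x.
have [h|h] := leP (x `^ p) 4^-1; first by lra.
suff : x `^ p <= 4 * x ^+ 2 by lra.
have x_gt0 : 0 < x.
  by rewrite lt_neqAle x0 andbT; apply: contraTneq h => <-; rewrite powR0; lra.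
rewrite -(powR_mulrn 2 x0).
have -> : 2%:R = p + (2 - p) :> R by lra.
rewrite powRD; last by rewrite (gt_eqF x_gt0) implybT.
have [x1|x1] := leP 1 x.
  have : x `^ 0 <= x `^ (2 - p) by apply: ler_powR => //; lra.
  rewrite powRr0.
  have := powR_ge0 x p; nra.
have x01 : 0 < x <= 1 by rewrite x_gt0 ltW.
have xle : x `^ p <= x `^ 1 by exact: ger_powR.
rewrite powRr1// in xle.
have : x `^ 1 <= x `^ (2 - p) by apply: ger_powR => //; lra.
rewrite powRr1// => h2.
nra.
Qed.

Lemma powR_ge_sqr (t D p : R) : p <= 2 -> 0 < p -> 0 <= t <= D -> D `^ (p - 2) * t ^+ 2 <= t `^ p.
Proof.
move=> p2 p0 /andP[t0 tD]; have [->|tn0] := eqVneq t 0.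
  by rewrite expr0n mulr0 powR_ge0.
have tp : 0 < t by rewrite lt_neqAle eq_sym tn0.
rewrite -(powR_mulrn 2 t0) (_ : t `^ p = t `^ (p - 2) * t `^ 2%:R); last first.
  by rewrite -powRD ?tn0 ?implybT//; congr (_ `^ _); lra.
rewrite ler_wpM2r ?powR_ge0//.
have Dp : 0 < D by exact: lt_le_trans tD.
rewrite (_ : p - 2 = - (2 - p)); last by lra.
rewrite !powRN lef_pV2 ?posrE ?powR_gt0//.
by apply: ge0_ler_powR; rewrite ?nnegrE//; [lra|exact: ltW].
Qed.

End powR_facts.

(** * Convolution with the row spaces of the code *)

Section code_operator.
Context {R : realType} (m k L : nat) (M : 'I_L -> 'M['F_2]_(k, m)) (d : R).
Hypothesis d01 : 0 < d <= 2^-1.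
Local Notation V := 'rV['F_2]_m.
Local Notation r := ((2 ^ k)%:R : R).
Local Notation N := ((2 ^ m)%:R : R).
Hypothesis HA : forall b : V, b != 0 ->
  `|r * #|[pred i | b *m (M i)^T == 0%R]|%:R - L%:R| <= d * L%:R.

(** Convolution with the row space of [M i], counted with multiplicity. The operator of interest is
    the direct sum over i of these L convolutions. *)
Definition code_op i (f : V -> R) (x : V) := \sum_(h : 'rV['F_2]_k) f (x + h *m M i).

Local Notation T := code_op.

Let N0 : 0 < N. Proof. by rewrite ltr0n expn_gt0. Qed.
Let r1 : 1 <= r. Proof. by rewrite ler1n expn_gt0. Qed.
Let L0 : 0 <= L%:R :> R. Proof. by []. Qed.

(** The characters diagonalise all convolutions at once: summing the character of b over the row
    space of [M i] gives 2^k if b is orthogonal to it and 0 otherwise. *)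
Lemma spectral_sum (u v : V -> R) :
  N * \sum_i \sum_(h : 'rV['F_2]_k) \sum_x u x * v (x + h *m M i) =
  \sum_b fourierF2 u b * fourierF2 v b * (r * #|[pred i | b *m (M i)^T == 0%R]|%:R).
Proof.
rewrite mulr_sumr; under eq_bigr do rewrite mulr_sumr.
under eq_bigr do under eq_bigr do rewrite parseval_shift.
under eq_bigr do rewrite exchange_big/=.
rewrite exchange_big/=; apply: eq_bigr => b _.
under eq_bigr do rewrite -mulr_sumr.
rewrite -mulr_sumr; congr (_ * _).
rewrite -sum1_card natr_sum mulr_sumr [RHS]big_mkcond/=; apply: eq_bigr => i _.
under eq_bigr do rewrite /chiF2 dotF2_mul.
by rewrite (sum_chiF2r (b *m (M i)^T)) inE; case: ifP => _; rewrite ?mulr1 ?mulr0.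
Qed.

Lemma fourierF2_0 (u : V -> R) : fourierF2 u 0 = \sum_x u x.
Proof.
by apply: eq_bigr => x _; rewrite /chiF2 /sgnF2 /dotF2 mul0mx mxE eqxx mulr1.
Qed.

(** Without h = 0 the eigenvalue is (r - 1) L at the trivial character and at most d L in absolute
    value at the others. There d |a b| <= a^2 / 32 + 8 d^2 b^2 is used: u is charged a small
    constant, v a multiple of d^2, since v will have the larger support. *)
Lemma spectral_offdiag (u v : V -> R) :
  \sum_i \sum_(h : 'rV['F_2]_k | h != 0) \sum_x u x * v (x + h *m M i) <=
  L%:R * ((r - 1) / N * (\sum_x u x) * (\sum_x v x) +
          (\sum_x u x ^+ 2) / 32 + 8 * d ^+ 2 * \sum_x v x ^+ 2).
Proof.
rewrite -(ler_pM2l N0).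
have -> : \sum_i \sum_(h : 'rV['F_2]_k | h != 0) \sum_x u x * v (x + h *m M i) =
  \sum_i \sum_(h : 'rV['F_2]_k) \sum_x u x * v (x + h *m M i) - L%:R * \sum_x u x * v (x + 0).
  have -> c : L%:R * c = \sum_(i < L) c :> R by rewrite sumr_const card_ord mulr_natl.
  rewrite -sumrB; apply: eq_bigr => i _.
  by rewrite [in RHS](bigD1 0)//= mul0mx addrAC subrr add0r.
rewrite [leLHS]mulrBr spectral_sum [X in _ - X]mulrCA parseval_shift [X in _ - X]mulr_sumr -sumrB.
have -> : N * (L%:R * ((r - 1) / N * (\sum_x u x) * (\sum_x v x) +
     (\sum_x u x ^+ 2) / 32 + 8 * d ^+ 2 * \sum_x v x ^+ 2)) =
  L%:R * (r - 1) * (fourierF2 u 0 * fourierF2 v 0) +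
  L%:R * ((N * \sum_x u x ^+ 2) / 32 + 8 * d ^+ 2 * (N * \sum_x v x ^+ 2)).
  by rewrite !fourierF2_0; field; rewrite gt_eqF.
rewrite !parsevalF2 (bigD1 0)//= lerD//.
  rewrite /chiF2 /sgnF2 /dotF2 mul0mx mxE eqxx mulr1.
  rewrite (_ : #|_| = L); last first.
    by rewrite -[RHS]card_ord; apply: eq_card => i; rewrite !inE mul0mx eqxx.
  by rewrite le_eqVlt; apply/orP; left; apply/eqP; ring.
rewrite mulr_suml mulr_sumr -big_split/= mulr_sumr big_mkcond/=.
apply: ler_sum => b _; case: ifP => [b0|_]; last first.
  by rewrite mulr_ge0// addr_ge0 ?divr_ge0 ?sqr_ge0// mulr_ge0 ?sqr_ge0// mulr_ge0 ?sqr_ge0.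
rewrite /chiF2 /sgnF2 /dotF2 linear0 mulmx0 mxE eqxx mulr1.
set x := fourierF2 u b; set y := fourierF2 v b; have := HA b0; set w := r * _ => hw.
have -> : x * y * w - L%:R * (x * y) = (x * y) * (w - L%:R) by ring.
apply: le_trans (ler_norm _) _; rewrite normrM.
apply: le_trans (ler_wpM2l (normr_ge0 _) hw) _.
rewrite mulrA mulrC ler_wpM2l//.
have [d0 _] := andP d01; rewrite -[d]gtr0_norm// -normrM.
have := sqr_ge0 (x / 4 - 2 * (d * y) * 2); have := sqr_ge0 (x / 4 + 2 * (d * y) * 2).
by case: (ler0P (x * y * d)) => _; rewrite (gtr0_norm d0); lra.
Qed.

(** Each convolution is self-adjoint and its square is r times itself, so that the left inverse
    problem in l_2 reduces to the eigenvalues, all at least (1 - d) L. *)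
Lemma spectral_lower (f : V -> R) :
  r * (1 - d) * L%:R * \sum_x f x ^+ 2 <= \sum_i \sum_x T i f x ^+ 2.
Proof.
have -> : \sum_i \sum_x T i f x ^+ 2 =
  r * \sum_i \sum_(h : 'rV['F_2]_k) \sum_x f x * f (x + h *m M i).
  rewrite mulr_sumr; apply: eq_bigr => i _.
  under eq_bigr do rewrite expr2 /T mulr_suml.
  rewrite exchange_big/= [in RHS]mulr_natl.
  have cH : #|'rV['F_2]_k| = (2 ^ k)%N by rewrite card_mx card_Fp// mul1n.
  rewrite -cH -sumr_const; apply: eq_bigr => h _.
  under eq_bigr do rewrite mulr_sumr.
  rewrite exchange_big/= (reindex_inj (addIr h))/=; apply: eq_bigr => h' _.
  rewrite [RHS](reindex_inj (addIr (h *m M i)))/=; apply: eq_bigr => x _.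
  by rewrite mulmxDl (addrC (h' *m _)) addrA.
rewrite -(ler_pM2l N0) [leRHS]mulrCA spectral_sum.
rewrite (_ : N * (r * (1 - d) * L%:R * \sum_x f x ^+ 2) =
  r * (((1 - d) * L%:R) * (N * \sum_x f x ^+ 2))); last by ring.
rewrite ler_wpM2l ?(le_trans _ r1)// parsevalF2 mulr_sumr; apply: ler_sum => b _.
rewrite -expr2 [leRHS]mulrC ler_wpM2r ?sqr_ge0//.
have [d0 d1] := andP d01; have [->|/HA/ler_normlP[h _]] := eqVneq b 0; last by lra.
rewrite (_ : #|_| = L); last first.
  by rewrite -[RHS]card_ord; apply: eq_card => i; rewrite !inE mul0mx eqxx.
by rewrite ler_wpM2r//; apply: le_trans r1; lra.
Qed.

Variable p : R.
Hypothesis p12 : 1 <= p < 2.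

Let p0 : 0 < p. Proof. by case/andP: p12 => + _; apply: lt_le_trans. Qed.

(** Points where |f| exceeds B keep a good part of their mass unless large values of f meet on a
    coset. The total of such encounters is a correlation of |f|^(p/2) above level B with |f|^(p/2)
    above level B', which [spectral_offdiag] bounds; the hypothesis says that lowering the level to
    B' does not gain too much mass. *)
Lemma code_op_heavy (f : V -> R) (B B' : R) :
  \sum_x `|f x| `^ p = N -> (16 * r) ^+ 2 <= B -> B = 4 * r * B' ->
  128 * d ^+ 2 * (\sum_(x | B' < `|f x|) `|f x| `^ p) <= \sum_(x | B < `|f x|) `|f x| `^ p ->
  2 `^ (- p) * L%:R * (\sum_(x | B < `|f x|) `|f x| `^ p) / 4 <=
  \sum_i \sum_x `|T i f x| `^ p.
Proof.
move=> fN B16 BB' hE.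
have [p1 p2] := andP p12.
have r0 : 0 < r by exact: lt_le_trans r1.
have B'0 : 0 <= B'.
  have : 0 <= B by apply: le_trans B16; rewrite sqr_ge0.
  by rewrite BB' pmulr_rge0// mulr_gt0.
pose v x := `|f x| `^ (p / 2).
have v0 x : 0 <= v x by exact: powR_ge0.
have vv x : v x ^+ 2 = `|f x| `^ p.
  by rewrite -powR_mulrn// -powRrM; congr (_ `^ _); rewrite mulfVK.
pose u x := if B < `|f x| then v x else 0.
pose v' x := if B' < `|f x| then v x else 0.
have v'0 x : 0 <= v' x by rewrite /v'; case: ifP.
have pt x i : B < `|f x| -> 2 `^ (- p) * (v x ^+ 2 - 4 * (v x *
    \sum_(h : 'rV['F_2]_k | h != 0) v' (x + h *m M i))) <= `|T i f x| `^ p.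
  move=> Bx; have fx0 : 0 < `|f x| by apply: le_lt_trans Bx; rewrite BB' mulr_ge0// mulr_ge0// ltW.
  pose a h := if B' < `|f (x + h *m M i)| then `|f (x + h *m M i)| else 0.
  have a0 h : 0 <= a h by rewrite /a; case: ifP.
  have s0 : 0 <= \sum_(h : 'rV['F_2]_k | h != 0) a h by exact: sumr_ge0.
  (* Values below B' add at most r B' = B / 4. Either the larger ones stay below |f x| / 4 as well,
     and half of f x survives; or they dominate f x, and subadditivity of the power p/2 <= 1 makes
     the left-hand side nonpositive. *)
  have [hs|hs] := leP (\sum_(h : 'rV['F_2]_k | h != 0) a h) (`|f x| / 4).
    apply: le_trans (_ : 2 `^ (- p) * `|f x| `^ p <= _).
      rewrite -vv ler_wpM2l ?powR_ge0// lerBlDr lerDl mulr_ge0// mulr_ge0//.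
      exact: sumr_ge0.
    rewrite powRN -powR_inv1// -powRrM mulrN1 -mulN1r powRrM powR_inv1// -powRM//.
    apply: ge0_ler_powR; rewrite ?nnegrE ?mulr_ge0//; first exact: ltW.
    rewrite /T (bigD1 0)//= mul0mx addr0.
    set S := \sum_(_ | _) _.
    have : `|S| <= \sum_(h : 'rV['F_2]_k | h != 0) a h + r * B'.
      apply: le_trans (ler_norm_sum _ _ _) _.
      apply: le_trans (_ : \sum_(h : 'rV['F_2]_k | h != 0) (a h + B') <= _).
        apply: ler_sum => h _; rewrite /a; case: ltP => hB; first by rewrite lerDl.
        by rewrite add0r.
      rewrite big_split/= lerD2l big_mkcond/=.
      apply: le_trans (_ : \sum_(h : 'rV['F_2]_k) B' <= _); first by apply: ler_sum => h _; case: ifP.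
      rewrite sumr_const (_ : #|_| = (2 ^ k)%N) ?mulr_natl//.
      by rewrite card_mx card_Fp// mul1n.
    have : `|f x| - `|S| <= `|f x + S| by exact: lerB_normD.
    by rewrite BB' in Bx; nra.
  apply: le_trans (powR_ge0 _ _).
  rewrite pmulr_rle0 ?powR_gt0// expr2 mulrCA -mulrBr mulr_ge0_le0// subr_le0.
  apply: le_trans (_ : 4 * \sum_(h : 'rV['F_2]_k | h != 0) a h `^ (p / 2) <= _); last first.
    rewrite ler_wpM2l//; apply: ler_sum => h _; rewrite /a /v'; case: ifP => // _.
    by rewrite powR0 ?mulf_neq0 ?gt_eqF ?invr_eq0.
  have q01 : 0 < p / 2 <= 1 by apply/andP; split; lra.
  apply: le_trans (ler_wpM2l _ (powR_sum_subadd q01 (fun h _ => a0 h))) => //.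
  apply: le_trans (_ : (4 * \sum_(h : 'rV['F_2]_k | h != 0) a h) `^ (p / 2) <= _).
    apply: ge0_ler_powR; rewrite ?nnegrE ?mulr_ge0//; lra.
  rewrite powRM// ler_wpM2r ?powR_ge0//.
  by apply: ler1_powR; lra.
have sumu : \sum_x u x ^+ 2 = \sum_(x | B < `|f x|) `|f x| `^ p.
  by rewrite [RHS]big_mkcond; apply: eq_bigr => x _; rewrite /u; case: ifP; rewrite ?vv// expr0n.
have sumv' : \sum_x v' x ^+ 2 = \sum_(x | B' < `|f x|) `|f x| `^ p.
  by rewrite [RHS]big_mkcond; apply: eq_bigr => x _; rewrite /v'; case: ifP; rewrite ?vv// expr0n.
set E := \sum_(x | B < _) _ in hE sumu *.
set E' := \sum_(x | B' < _) _ in hE sumv'.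
have E0 : 0 <= E by rewrite -sumu sumr_ge0// => x _; exact: sqr_ge0.
(* Where u is nonzero it is at least B^(1/2) >= 16 r. This makes the contribution of the trivial
   character small. *)
have su : 16 * r * \sum_x u x <= E.
  rewrite -sumu mulr_sumr; apply: ler_sum => x _; rewrite /u; case: ifP => [Bx|_]; last by rewrite mulr0 sqr_ge0.
  rewrite expr2 ler_wpM2r//.
  have h1 : 1 <= 16 * r by move: r1; move: (r : R) => q hq; lra.
  have B1 : 1 <= B by apply: le_trans B16; rewrite expr_ge1// (le_trans _ h1).
  apply: le_trans (_ : B `^ 2^-1 <= _).
    apply: le_trans (_ : ((16 * r) ^+ 2) `^ 2^-1 <= _).
      have h0 : 0 <= 16 * r by exact: le_trans h1.
      by rewrite -(powR_mulrn 2 h0) -powRrM mulfV ?powRr1// pnatr_eq0.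
    by apply: ge0_ler_powR; rewrite ?nnegrE ?sqr_ge0// (le_trans _ B1).
  apply: le_trans (_ : B `^ (p / 2) <= _); first by apply: ler_powR => //; lra.
  by apply: ge0_ler_powR; rewrite ?nnegrE ?(le_trans _ B1) ?(ltW Bx)//; lra.
have sv : \sum_x v' x <= N.
  apply: le_trans (_ : \sum_x ((1 + v x ^+ 2) / 2) <= _).
    apply: ler_sum => x _; apply: le_trans (_ : v x <= _); first by rewrite /v'; case: ifP.
    by have := sqr_ge0 (v x - 1); nra.
  rewrite -mulr_suml big_split/= sumr_const (eq_bigr _ (fun x _ => vv x)) fN.
  rewrite (_ : #|_| = (2 ^ m)%N); last by rewrite card_mx card_Fp// mul1n.
  by move: (N : R) => n; lra.
have s'0 : 0 <= \sum_x v' x by exact: sumr_ge0.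
have u0 : 0 <= \sum_x u x by apply: sumr_ge0 => x _; rewrite /u; case: ifP.
have off := spectral_offdiag u v'; rewrite sumu sumv' in off.
apply: le_trans (_ : \sum_i \sum_x (2 `^ (- p) * (u x ^+ 2 - 4 * (u x *
    \sum_(h : 'rV['F_2]_k | h != 0) v' (x + h *m M i)))) <= _); last first.
  apply: ler_sum => i _; apply: ler_sum => x _; rewrite {1 2}/u; case: ifP => [/pt//|_].
  by rewrite expr0n/= mul0r mulr0 subr0 mulr0 powR_ge0.
under eq_bigr do rewrite -mulr_sumr sumrB sumu -mulr_sumr.
rewrite -mulr_sumr sumrB sumr_const card_ord -[E *+ L]mulr_natl -mulr_sumr -!mulrA.
rewrite ler_wpM2l ?powR_ge0//.
have -> : \sum_(i < L) \sum_x u x * \sum_(h : 'rV['F_2]_k | h != 0) v' (x + h *m M i) =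
  \sum_i \sum_(h : 'rV['F_2]_k | h != 0) \sum_x u x * v' (x + h *m M i).
  apply: eq_bigr => i _; rewrite exchange_big/=; apply: eq_bigr => x _.
  by rewrite mulr_sumr.
have hx : (r - 1) / N * (\sum_x u x) * (\sum_x v' x) <= E / 16.
  rewrite mulrAC -mulrA mulrAC -mulrA.
  apply: le_trans (_ : (r - 1) * (\sum_x u x) <= _).
    rewrite ler_wpM2l ?subr_ge0//.
    by rewrite ler_pdivrMr// [leRHS]mulrC ler_wpM2r.
  by move: r1 su u0; move: (r : R) (\sum_x u x) => q a; nra.
have := ler_wpM2l L0 (_ : (r - 1) / N * (\sum_x u x) * (\sum_x v' x) + E / 32 + 8 * d ^+ 2 * E' <= 3 / 16 * E).
move=> /(_ _)/(le_trans off) h.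
have {}h := h ltac:(lra).
have LE : 0 <= L%:R * E by rewrite mulr_ge0.
lra.
Qed.

(** The part f1 of f below level B has a 2-norm comparable to its p-norm, so the l_2 lower bound
    applies; since T f1 is bounded by r B, the l_2 estimate turns back into an l_p one at the price
    (r B)^(p-2). The part above B is subtracted by the trivial upper bound. *)
Lemma code_op_flat (f : V -> R) (B : R) :
  \sum_x `|f x| `^ p = N -> 0 < B ->
  \sum_(x | B < `|f x|) `|f x| `^ p <= N / 2 ->
  L%:R * (2 `^ (- p) * (r * B) `^ (p - 2) * r / 32 * N -
          r * r `^ p * \sum_(x | B < `|f x|) `|f x| `^ p) <=
  \sum_i \sum_x `|T i f x| `^ p.
Proof.
move=> fN B0 hE; have [p1 p2] := andP p12.
have r0 : 0 < r by exact: lt_le_trans r1.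
set E := \sum_(x | _) _ in hE *.
pose f1 x := if B < `|f x| then 0 else f x.
pose f2 x := if B < `|f x| then f x else 0.
have f12 x : f x = f1 x + f2 x by rewrite /f1 /f2; case: ifP; rewrite ?addr0 ?add0r.
have f1B x : `|f1 x| <= B by rewrite /f1; case: ltP => //; rewrite normr0 ltW.
have Ef2 : \sum_x `|f2 x| `^ p = E.
  rewrite [RHS]big_mkcond; apply: eq_bigr => x _; rewrite /f2; case: ifP => //.
  by rewrite normr0 powR0// gt_eqF.
have Ef1 : \sum_x `|f1 x| `^ p = N - E.
  rewrite -fN -Ef2 -sumrB; apply: eq_bigr => x _; rewrite /f1 /f2.
  by case: ifP; rewrite normr0 powR0 ?gt_eqF// ?subrr ?subr0.
have cV : #|'rV['F_2]_m| = (2 ^ m)%N by rewrite card_mx card_Fp// mul1n.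
have cH : #|'rV['F_2]_k| = (2 ^ k)%N by rewrite card_mx card_Fp// mul1n.
have f1sq : N / 16 <= \sum_x f1 x ^+ 2.
  have : \sum_x `|f1 x| `^ p <= \sum_x (4^-1 + 4 * f1 x ^+ 2).
    by apply: ler_sum => x _; rewrite -(real_normK (num_real (f1 x))); exact: powR_le_quad.
  rewrite big_split/= sumr_const cV -mulr_sumr Ef1 -(mulr_natr 4^-1).
  by move: (N : R) hE => n hE'; lra.
have T12 i x : T i f x = T i f1 x + T i f2 x.
  by rewrite /T -big_split/=; apply: eq_bigr => h _; exact: f12.
have low : 2 `^ (- p) * \sum_i \sum_x `|T i f1 x| `^ p <=
    \sum_i \sum_x `|T i f x| `^ p + \sum_i \sum_x `|T i f2 x| `^ p.
  rewrite -big_split/= mulr_sumr; apply: ler_sum => i _.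
  rewrite -big_split/= mulr_sumr; apply: ler_sum => x _.
  rewrite powRN mulrC ler_pdivrMr ?powR_gt0// mulrC.
  have := powR_normD (T i f x) (- T i f2 x) p0.
  by rewrite normrN T12 addrK.
have up2 : \sum_i \sum_x `|T i f2 x| `^ p <= L%:R * (r * r `^ p * E).
  have -> : L%:R * (r * r `^ p * E) = \sum_(i < L) r * r `^ p * E by rewrite sumr_const card_ord mulr_natl.
  apply: ler_sum => i _.
  apply: le_trans (_ : \sum_x r `^ p * \sum_(h : 'rV['F_2]_k) `|f2 (x + h *m M i)| `^ p <= _).
    by apply: ler_sum => x _; rewrite -cH; exact: powR_sum_max.
  rewrite -mulr_sumr exchange_big/= (eq_bigr (fun=> E)); last first.
    by move=> h _; rewrite -Ef2 [RHS](reindex_inj (addIr (h *m M i))).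
  by rewrite sumr_const cH -[E *+ _]mulr_natl mulrCA mulrA.
have low1 : (r * B) `^ (p - 2) * (r * 2^-1 * L%:R * (N / 16)) <= \sum_i \sum_x `|T i f1 x| `^ p.
  apply: le_trans (_ : (r * B) `^ (p - 2) * \sum_i \sum_x T i f1 x ^+ 2 <= _).
    rewrite ler_wpM2l ?powR_ge0//; apply: le_trans (spectral_lower f1).
    apply: ler_pM; rewrite ?mulr_ge0 ?divr_ge0 ?invr_ge0//; try exact: ltW.
    rewrite ler_wpM2r// ler_wpM2l ?(ltW r0)//.
    by case/andP: d01 => _; lra.
  rewrite mulr_sumr; apply: ler_sum => i _; rewrite mulr_sumr; apply: ler_sum => x _.
  rewrite -(real_normK (num_real (T i f1 x))); apply: powR_ge_sqr; rewrite ?(ltW p2)// normr_ge0/=.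
  apply: le_trans (ler_norm_sum _ _ _) _.
  apply: le_trans (_ : \sum_(h : 'rV['F_2]_k) B <= _); first by apply: ler_sum => h _.
  by rewrite sumr_const cH mulr_natl.
have := ler_wpM2l (powR_ge0 2 (- p)) low1; move: low up2.
by move: (r : R) (N : R) (_ `^ (p - 2)) (_ `^ p) => ? ? ? ?; lra.
Qed.

End code_operator.

Section code_lower_bound.
Context {R : realType} (m k L : nat) (M : 'I_L -> 'M['F_2]_(k, m)) (d : R).
Local Notation V := 'rV['F_2]_m.
Local Notation r := ((2 ^ k)%:R : R).
Local Notation N := ((2 ^ m)%:R : R).

(** Pigeonhole over the levels (16 r)^2 (4 r)^i. If the mass above level j is at most e^j N, the
    flat case applies there. Otherwise take the least i at which the mass exceeds e^i N: i is
    positive because the mass above level 0 is at most N, and from level i - 1 to level i the mass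
    drops by a factor of at most 1/e, which is the heavy case. The inequality on j makes the loss in
    the flat case at most half of the gain. *)
Lemma code_op_lower (p : R) (j : nat) (c : R) (f : V -> R) :
  0 < d <= 2^-1 ->
  (forall b : V, b != 0 ->
    `|r * #|[pred i | b *m (M i)^T == 0%R]|%:R - L%:R| <= d * L%:R) ->
  1 <= p < 2 -> (0 < j)%N -> 128 * d ^+ 2 <= 2^-1 ->
  r * r `^ p * (128 * d ^+ 2) ^+ j <=
    2 `^ (- p) * (r * ((16 * r) ^+ 2 * (4 * r) ^+ j)) `^ (p - 2) * r / 32 / 2 ->
  c <= 2 `^ (- p) * (r * ((16 * r) ^+ 2 * (4 * r) ^+ j)) `^ (p - 2) * r / 32 / 2 ->
  c <= 2 `^ (- p) * (128 * d ^+ 2) ^+ j / 4 ->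
  c * L%:R * \sum_x `|f x| `^ p <= \sum_i \sum_x `|code_op M i f x| `^ p.
Proof.
move=> d01 HA p12 j0 e12 hj hc1 hc2.
have p0 : 0 < p by case/andP: p12 => + _; apply: lt_le_trans.
have N0 : 0 < N by rewrite ltr0n expn_gt0.
have r0 : 0 < r by rewrite ltr0n expn_gt0.
set e := 128 * d ^+ 2 in e12 hj hc2.
have e0 : 0 < e by rewrite mulr_gt0// exprn_gt0//; case/andP: d01.
have e1 : e <= 1 by apply: (le_trans e12); lra.
have normalized g : \sum_x `|g x| `^ p = N ->
    c * L%:R * N <= \sum_i \sum_x `|code_op M i g x| `^ p.
  move=> gN.
  pose B i := (16 * r) ^+ 2 * (4 * r) ^+ i.
  have B0 i : 0 < B i by rewrite mulr_gt0// exprn_gt0// mulr_gt0.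
  pose E i := \sum_(x | B i < `|g x|) `|g x| `^ p.
  have E0 : E 0%N <= N.
    rewrite -gN /E big_mkcond/=; apply: ler_sum => x _.
    by case: ifP => // _; exact: powR_ge0.
  have [Ej|Ej] := leP (E j) (e ^+ j * N).
    have ej2 : e ^+ j <= 2^-1.
      by apply: (le_trans _ e12); rewrite -[leRHS]expr1; apply: ler_wiXn2l => //; exact: ltW.
    have /(@code_op_flat _ _ _ _ _ _ d01 HA _ p12 g (B j) gN (B0 j)) : E j <= N / 2.
      by apply: le_trans Ej _; rewrite mulrC ler_wpM2l// ltW.
    apply: le_trans.
    rewrite mulrAC mulrC ler_wpM2l//.
    have : r * r `^ p * E j <= r * r `^ p * e ^+ j * N.
      by rewrite -[leRHS]mulrA ler_wpM2l// mulr_ge0 ?powR_ge0// ltW.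
    have := ler_wpM2r (ltW N0) hj; have := ler_wpM2r (ltW N0) hc1.
    rewrite -/(B j) -/(E j); set c1 := _ / 32; lra.
  have hex : exists i, e ^+ i * N < E i by exists j.
  case: (ex_minnP hex) => i hi hmin.
  have i0 : (0 < i)%N by rewrite lt0n; apply: contraTneq hi => ->; rewrite expr0 mul1r -leNgt.
  have ij : (i <= j)%N by exact: hmin.
  have hi1 : E i.-1 <= e ^+ i.-1 * N.
    by rewrite leNgt; apply/negP => /hmin; rewrite leqNgt prednK ?leqnn.
  have BB : B i = 4 * r * B i.-1.
    by rewrite /B; case: (i) i0 => // i' _; rewrite (exprS (4 * _)) mulrCA.
  have B16 : (16 * r) ^+ 2 <= B i.
    rewrite /B ler_peMr ?sqr_ge0// expr_ge1//.
    have : 1 <= r by rewrite ler1n expn_gt0.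
    by move: (r : R) => q; lra.
  have hE : 128 * d ^+ 2 * E i.-1 <= E i.
    apply: le_trans (ltW hi); rewrite -/e -(prednK i0) exprS/= -mulrA.
    by rewrite ler_wpM2l// ltW.
  apply: le_trans (@code_op_heavy _ _ _ _ _ _ d01 HA _ p12 g _ _ gN B16 BB hE).
  rewrite -/(E i).
  have : e ^+ j * N <= E i.
    apply: le_trans (ltW hi); rewrite ler_wpM2r ?(ltW N0)//.
    by apply: ler_wiXn2l => //; exact: ltW.
  have L0 : 0 <= L%:R :> R by [].
  have P0 := powR_ge0 2 (- p).
  move=> h; have {}h := ler_wpM2l (mulr_ge0 P0 L0) h.
  have := ler_wpM2r (ltW N0) (ler_wpM2r L0 hc2).
  by move: h; rewrite -[X in _ -> _ -> _ <= X]mulrA; set P := 2 `^ _; lra.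
have S0 : 0 <= \sum_x `|f x| `^ p by apply: sumr_ge0 => x _; exact: powR_ge0.
have [->|Sn0] := eqVneq (\sum_x `|f x| `^ p) 0.
  by rewrite mulr0; do 2 apply: sumr_ge0 => ? _; exact: powR_ge0.
have Sp : 0 < \sum_x `|f x| `^ p by rewrite lt_neqAle eq_sym Sn0.
set S := \sum_x _ in S0 Sn0 Sp *.
pose s := (N / S) `^ p^-1.
have s0 : 0 <= s by exact: powR_ge0.
have sp : s `^ p = N / S by rewrite -powRrM mulVf ?gt_eqF// powRr1// divr_ge0 ?ltW.
have sM x : `|s * x| `^ p = N / S * `|x| `^ p by rewrite normrM powRM// ger0_norm// sp.
have /normalized : \sum_x `|s * f x| `^ p = N.
  by under eq_bigr do rewrite sM; rewrite -mulr_sumr mulfVK.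
have -> : \sum_i \sum_x `|code_op M i (fun x => s * f x) x| `^ p =
    N / S * \sum_i \sum_x `|code_op M i f x| `^ p.
  rewrite mulr_sumr; apply: eq_bigr => i _; rewrite mulr_sumr; apply: eq_bigr => x _.
  by rewrite -sM /code_op mulr_sumr.
move=> h; rewrite -(ler_pM2l (divr_gt0 N0 Sp)); apply: (le_trans _ h).
rewrite le_eqVlt; apply/orP; left; apply/eqP.
by move: (N : R) => n; field.
Qed.

Lemma code_op_upper (p : R) (f : V -> R) : 0 < p ->
  \sum_i \sum_x `|code_op M i f x| `^ p <= r * r `^ p * L%:R * \sum_x `|f x| `^ p.
Proof.
move=> p0; set E := \sum_x `|f x| `^ p.
have cH : #|'rV['F_2]_k| = (2 ^ k)%N by rewrite card_mx card_Fp// mul1n.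
have -> : r * r `^ p * L%:R * E = \sum_(i < L) r * r `^ p * E.
  by rewrite sumr_const card_ord -(mulr_natr (r * r `^ p * E)) mulrAC.
apply: ler_sum => i _.
apply: le_trans (_ : \sum_x r `^ p * \sum_(h : 'rV['F_2]_k) `|f (x + h *m M i)| `^ p <= _).
  by apply: ler_sum => x _; rewrite -cH; exact: powR_sum_max.
rewrite -mulr_sumr exchange_big/= (eq_bigr (fun=> E)); last first.
  by move=> h _; rewrite [RHS](reindex_inj (addIr (h *m M i))).
by rewrite sumr_const cH -[E *+ _]mulr_natl mulrCA mulrA.
Qed.

End code_lower_bound.

(** * Left inverses of the code operators are large *)

Section code_left_inverse.
Context {R : realType} (m k L : nat) (M : 'I_L -> 'M['F_2]_(k, m)).
Local Notation V := 'rV['F_2]_m.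
Local Notation H := 'rV['F_2]_k.
Local Notation Wd := {ffun 'I_L -> 'rV['F_2]_k}.
Local Notation r := ((2 ^ k)%:R : R).

Definition code_syn (w : Wd) : V := \sum_i w i *m M i.

Definition wset (i : 'I_L) (h : H) (w : Wd) : Wd :=
  [ffun j => if j == i then h else w j].

Lemma wsuppE (w : Wd) : wsupp w = (\sum_i (w i != 0%R))%N.
Proof. by rewrite /wsupp -sum1_card big_mkcond; apply: eq_bigr => i _; rewrite inE; case: ifP. Qed.

Lemma wsupp_wset i h (w : Wd) : wsupp (wset i h w) = (wsupp (wset i 0%R w) + (h != 0%R))%N.
Proof.
rewrite !wsuppE (bigD1 i)//= [in RHS](bigD1 i)//= !ffunE !eqxx/= add0n addnC.
by congr (_ + _)%N; apply: eq_bigr => j /negbTE ji; rewrite !ffunE ji.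
Qed.

Lemma wsuppD (v w : Wd) : (wsupp (v + w)%R <= wsupp v + wsupp w)%N.
Proof.
rewrite !wsuppE -big_split/=; apply: leq_sum => i _; rewrite ffunE.
have [->|vi] := eqVneq (v i) 0; first by rewrite add0r.
by case: (_ != _).
Qed.

Lemma code_synD (v w : Wd) : code_syn (v + w) = code_syn v + code_syn w.
Proof. by rewrite /code_syn -big_split/=; apply: eq_bigr => i _; rewrite ffunE mulmxDl. Qed.

Lemma code_syn_wset i h (w : Wd) :
  code_syn (wset i (w i + h) w) = code_syn w + h *m M i.
Proof.
rewrite /code_syn (bigD1 i)//= [in RHS](bigD1 i)//= ffunE eqxx mulmxDl addrAC.
by congr (_ + _ + _); apply: eq_bigr => j /negbTE ji; rewrite ffunE ji.
Qed.

Variables (Rd : nat) (t : R).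
Hypothesis rt : 1 + (r - 1) * t = 0.
Hypothesis HB : forall w : Wd, w != 0 -> (wsupp w <= Rd.*2.+1)%N -> code_syn w != 0.

(* The decaying function of Hamming weight, pushed forward to [V]: its sums
   along the cosets of the [M i] vanish except at the boundary of the ball. *)
Definition ball_fun (g : V) : R :=
  \sum_(w : Wd | code_syn w == g) (if (wsupp w <= Rd)%N then t ^+ wsupp w else 0).

Lemma ball_fun0 : ball_fun 0 = 1.
Proof.
rewrite /ball_fun (bigD1 (0 : Wd))/=; last by rewrite /code_syn big1// => i _; rewrite ffunE mul0mx.
rewrite big1 ?addr0 => [|w /andP[/eqP sw w0]].
  by rewrite wsuppE big1// => i _; rewrite ffunE eqxx.
case: ifP => // wR.
have hw : (wsupp w <= Rd.*2.+1)%N by rewrite (leq_trans wR)// -addnn -addnS leq_addr.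
by have := HB w0 hw; rewrite sw eqxx.
Qed.

Lemma sum_wset i (w : Wd) :
  \sum_(h : H) (if (wsupp (wset i h w) <= Rd)%N then t ^+ wsupp (wset i h w) else 0) =
  if wsupp (wset i 0%R w) == Rd then t ^+ Rd else 0.
Proof.
under eq_bigr do rewrite wsupp_wset; set n := wsupp _.
rewrite (bigD1 0)//= eqxx addn0 (eq_bigr (fun=> if (n < Rd)%N then t ^+ n.+1 else 0)); last first.
  by move=> h ->; rewrite addn1.
rewrite sumr_const; have -> : #|[pred h : H | h != 0%R]| = (2 ^ k - 1)%N.
  have := cardC1 (0 : H); rewrite card_mx card_Fp// mul1n subn1 => <-.
  by apply: eq_card => h; rewrite !inE.
rewrite -mulr_natr natrB ?expn_gt0// leq_eqVlt; case: ltngtP => [nR|nR|->]/=.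
- by rewrite exprS -mulrA -[X in X + _]mulr1 mulrCA -mulrDr mulrC addrC [t * _]mulrC addrC rt mul0r.
- by rewrite mul0r addr0.
- by rewrite mul0r addr0.
Qed.

(** Summing over a coset of the row space of [M i] lets the i-th letter of w run through all values.
    A word of weight n without that letter contributes t^n + (r - 1) t^(n+1) = 0, unless n = Rd,
    where the ball cuts the sum off. At most one word w survives for a given y, since the sum of two
    of them has weight at most 2 Rd + 1 and would be a codeword. *)
Lemma code_op_ball i y : `|code_op M i ball_fun y| <=
  `|t| ^+ Rd * (y \in [seq code_syn w | w in [pred w : Wd | (wsupp w <= Rd.+1)%N]])%:R.
Proof.
have -> : code_op M i ball_fun y =
    \sum_(w : Wd | code_syn w == y) (if wsupp (wset i 0%R w) == Rd then t ^+ Rd else 0).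
  rewrite /code_op /ball_fun.
  transitivity (\sum_(h : H) \sum_(w : Wd | code_syn w == y)
     (if (wsupp (wset i (w i + h) w) <= Rd)%N then t ^+ wsupp (wset i (w i + h) w) else 0)).
    apply: eq_bigr => h _.
    have winj : injective (fun w : Wd => wset i (w i + h) w).
      move=> v w /ffunP vw; apply/ffunP => j; have := vw j; rewrite !ffunE.
      by case: eqP => [->|//]; exact: addIr.
    rewrite (reindex_inj winj)/=; apply: eq_bigl => w; rewrite code_syn_wset.
    by rewrite (inj_eq (addIr _)).
  rewrite exchange_big/=; apply: eq_bigr => w _.
  by rewrite -sum_wset [RHS](reindex_inj (@addrI _ (w i))).
have uniq_w v w : code_syn v = y -> code_syn w = y -> wsupp (wset i 0%R v) = Rd ->
    wsupp (wset i 0%R w) = Rd -> v = w.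
  move=> vy wy vR wR; apply/eqP; rewrite -subr_eq0.
  have -> : v - w = v + w by congr (_ + _); apply/ffunP => j; rewrite !ffunE oppv2.
  have [//|vw0] := eqVneq (v + w) 0.
  suff hw : (wsupp (v + w)%R <= Rd.*2.+1)%N.
    by have := HB vw0 hw; rewrite code_synD vy wy addrv2 eqxx.
  have hw (u : Wd) : u = wset i (u i) u.
    by apply/ffunP => j; rewrite ffunE; case: eqP => [->|].
  have -> : v + w = wset i (v i + w i) (wset i 0 v + wset i 0 w).
    by apply/ffunP => j; rewrite !ffunE; case: eqP => [->|].
  rewrite wsupp_wset; have -> : wset i 0 (wset i 0 v + wset i 0 w) = wset i 0 v + wset i 0 w.
    by apply/ffunP => j; rewrite !ffunE; case: eqP; rewrite ?addr0.
  apply: leq_trans (_ : (Rd + Rd + 1 <= _)%N); last by rewrite addnn addn1.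
  by rewrite leq_add ?leq_b1// (leq_trans (wsuppD _ _))// vR wR.
have [w0 /andP[/eqP wy /eqP wR]|none] := pickP [pred w : Wd | (code_syn w == y) && (wsupp (wset i 0%R w) == Rd)].
  rewrite (bigD1 w0)/= ?wy// wR eqxx big1 ?addr0 => [|w /andP[/eqP wy' ww0]].
    rewrite normrX ler_peMr ?exprn_ge0// ler1n lt0b.
    apply/fintype.imageP; exists w0 => //; rewrite inE.
    have -> : w0 = wset i (w0 i) w0 by apply/ffunP => j; rewrite ffunE; case: eqP => [->|].
    by rewrite wsupp_wset wR (leq_trans (leq_add (leqnn _) (leq_b1 _)))// addn1.
  case: eqP => // wR'; case/eqP: ww0; exact: uniq_w.
rewrite big1 ?normr0 ?mulr_ge0 ?exprn_ge0// => w /eqP wy.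
by have := none w; rewrite /= wy eqxx/= => ->.
Qed.

(* [l + l^(1-p) |a|^p >= |a|] replaces Hoelder's inequality. *)
Lemma code_left_inverse (p l K : R) (s : V -> 'I_L -> V -> R) :
  1 <= p -> 0 < l ->
  (forall (f : V -> R) g, \sum_i \sum_x s g i x * code_op M i f x = f g) ->
  (forall i x, \sum_g `|s g i x| `^ p <= K) ->
  1 <= L%:R * (`|t| ^+ Rd * (#|[pred w : Wd | (wsupp w <= Rd.+1)%N]|%:R * l + l `^ (1 - p) * K)).
Proof.
move=> p1 l0 hs hK.
pose A := [seq code_syn w | w in [pred w : Wd | (wsupp w <= Rd.+1)%N]].
set cA := #|[pred w : Wd | _]|.
have N0 : 0 < (2 ^ m)%:R :> R by rewrite ltr0n expn_gt0.
have cV : #|'rV['F_2]_m| = (2 ^ m)%N by rewrite card_mx card_Fp// mul1n.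
rewrite -(ler_pM2l N0) mulr1.
(* The left inverse is tested on all translates of [ball_fun], each having value 1 at its centre g;
   summing over g brings in the column sums of s, which are what K bounds. *)
have {1}-> : (2 ^ m)%:R = \sum_(g : V) \sum_i \sum_x s g i x * code_op M i ball_fun (x + g) :> R.
  rewrite -cV -sumr_const; apply: eq_bigr => g _.
  have := hs (fun x => ball_fun (x + g)) g; rewrite addrv2 ball_fun0 => <-.
  apply: eq_bigr => i _; apply: eq_bigr => x _; congr (_ * _).
  by apply: eq_bigr => h _; rewrite addrAC.
have pt (a : R) : `|a| <= l + l `^ (1 - p) * `|a| `^ p.
  have [al|al] := leP `|a| l; first by rewrite (le_trans al)// lerDl mulr_ge0 ?powR_ge0.
  apply: le_trans (_ : l `^ (1 - p) * `|a| `^ p <= _); last by rewrite lerDr ltW.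
  have a0 : 0 < `|a| by exact: lt_trans al.
  rewrite -{1}(powRr1 (ltW a0)) (_ : `|a| `^ 1 = `|a| `^ (1 - p) * `|a| `^ p); last first.
    by rewrite -powRD ?(gt_eqF a0) ?implybT//; congr (_ `^ _); lra.
  rewrite ler_wpM2r ?powR_ge0// (_ : 1 - p = - (p - 1)); last by lra.
  rewrite !powRN lef_pV2 ?posrE ?powR_gt0//.
  by apply: ge0_ler_powR; rewrite ?nnegrE ?subr_ge0// ltW.
have -> : (2 ^ m)%:R * (L%:R * (`|t| ^+ Rd * (cA%:R * l + l `^ (1 - p) * K))) =
  \sum_(i < L) \sum_(x : V) (`|t| ^+ Rd * (cA%:R * l + l `^ (1 - p) * K)).
  by rewrite !sumr_const card_ord cV -[RHS]mulr_natr -[X in X * L%:R]mulr_natr; ring.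
rewrite exchange_big/=; apply: ler_sum => i _.
rewrite exchange_big/=; apply: ler_sum => x _.
apply: le_trans (ler_norm _) _; apply: le_trans (ler_norm_sum _ _ _) _.
apply: le_trans (_ : \sum_(g : V) `|t| ^+ Rd * ((x + g \in A)%:R * l + l `^ (1 - p) * `|s g i x| `^ p) <= _).
  apply: ler_sum => g _; rewrite normrM mulrC.
  apply: le_trans (ler_wpM2r (normr_ge0 _) (code_op_ball i (x + g))) _.
  rewrite -mulrA ler_wpM2l ?exprn_ge0// -/A; case: (_ \in A); rewrite ?mul1r ?pt//.
  by rewrite !mul0r add0r mulr_ge0 ?powR_ge0.
rewrite -mulr_sumr ler_wpM2l ?exprn_ge0// big_split/= lerD//; last first.
  by rewrite -mulr_sumr ler_wpM2l ?powR_ge0.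
rewrite -mulr_suml ler_wpM2r ?(ltW l0)// -natr_sum ler_nat.
rewrite (reindex_inj (addrI x))/=.
under eq_bigr do rewrite addrA addrv2 add0r.
rewrite -big_mkcond/= sum1_card; exact: (@leq_image_card _ _ code_syn [pred w : Wd | (wsupp w <= Rd.+1)%N]).
Qed.

End code_left_inverse.

(** * Bad embeddings for p < 2 *)

Section bad_embeddings.
Context {R : realType}.

Definition lp_sum (p : R) (I : finType) (x : I -> R) : R := \sum_i `|x i| `^ p.

Definition mx_app (I J : finType) (T : J -> I -> R) (x : I -> R) (j : J) : R :=
  \sum_i T j i * x i.

(** All comparisons are between p-th powers of norms, so K bounds the p-th power of the norm of a
    left inverse. The constants c and C are chosen before K. *)
Definition bad_embeddings (p : R) : Prop :=
  exists c C : R, [/\ 0 < c, 0 < C & forall K : R,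
    exists (I J : finType) (T : J -> I -> R),
    [/\ forall x, c * lp_sum p x <= lp_sum p (mx_app T x),
        forall x, lp_sum p (mx_app T x) <= C * lp_sum p x &
        forall (S : I -> J -> R) (K' : R), (forall x, mx_app S (mx_app T x) =1 x) ->
          (forall y, lp_sum p (mx_app S y) <= K' * lp_sum p y) -> K <= K']].

End bad_embeddings.

Section bad_embeddings_lt2.
Context {R : realType}.

Lemma exprn_lt_eps (q e : R) : 0 <= q < 1 -> 0 < e -> exists j, (0 < j)%N /\ q ^+ j <= e.
Proof.
move=> /andP[q0 q1] e0.
have : (fun n => q ^+ n : R) @ \oo --> (0 : R) by apply: cvg_expr; rewrite ger0_norm.
move=> /cvgr0Pnorm_le/(_ _ e0)[n _ hn]; exists n.+1; split=> //.
by have := hn n.+1 (leqnSn n); rewrite ger0_norm ?exprn_ge0.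
Qed.

Lemma linear_le_exp (C : nat) : exists a, (C * a.+1 <= 2 ^ a)%N.
Proof.
exists (4 * C)%N; have lt2 n : (n < 2 ^ n)%N by exact: ltn_expl.
have h := lt2 (2 * C)%N; rewrite (_ : (4 * C = 2 * C + 2 * C)%N); last by lia.
rewrite expnD; have : ((2 * C).+1 * (2 * C).+1 <= 2 ^ (2 * C) * 2 ^ (2 * C))%N by exact: leq_mul.
nia.
Qed.

(** The generating function of the weight is (1 + (2^k - 1) s)^L. At s = 2^-(l+k) it is at most (1 +
    2^-l)^L <= exp Rd <= 4^Rd, while every word counted contributes at least s^W. *)
Lemma card_wsupp_le (k l Rd W : nat) :
  (#|[pred w : {ffun 'I_(2 ^ l * Rd) -> 'rV['F_2]_k} | (wsupp w <= W)%N]| <=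
   2 ^ ((l + k) * W + 2 * Rd))%N.
Proof.
set L := (2 ^ l * Rd)%N.
pose s : R := (2 ^ (l + k))%:R^-1.
have s0 : 0 < s by rewrite invr_gt0 ltr0n expn_gt0.
have s1 : s <= 1 by rewrite invf_le1 ?ltr0n ?expn_gt0// ler1n expn_gt0.
have tot : \sum_(w : {ffun 'I_L -> 'rV['F_2]_k}) s ^+ wsupp w <= 4 ^+ Rd.
  rewrite (eq_bigr (fun w : {ffun 'I_L -> 'rV['F_2]_k} => \prod_(i < L) s ^+ (w i != 0%R))); last first.
    by move=> w _; rewrite wsuppE -expr_sum.
  rewrite -(bigA_distr_bigA (fun i (a : 'rV['F_2]_k) => s ^+ (a != 0%R))).
  rewrite prodr_const card_ord /L exprM lerXn2r ?nnegrE ?exprn_ge0//.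
    by rewrite sumr_ge0// => i _; rewrite exprn_ge0// ltW.
  have -> : \sum_(a : 'rV['F_2]_k) s ^+ (a != 0%R) = 1 + ((2 ^ k)%:R - 1) * s.
    rewrite (bigD1 0)//= eqxx expr0; congr (_ + _).
    rewrite (eq_bigr (fun=> s)); last by move=> a ->; rewrite expr1.
    rewrite sumr_const; have -> : #|[pred h : 'rV['F_2]_k | h != 0%R]| = (2 ^ k - 1)%N.
      have := cardC1 (0 : 'rV['F_2]_k); rewrite card_mx card_Fp// mul1n subn1 => <-.
      by apply: eq_card => h; rewrite !inE.
    by rewrite -[LHS]mulr_natl natrB ?expn_gt0.
  apply: le_trans (_ : (1 + (2 ^ l)%:R^-1) ^+ (2 ^ l) <= _).
    have ks : (2 ^ k)%:R * s = (2 ^ l)%:R^-1.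
      by rewrite /s expnD natrM invfM mulrCA mulfV ?mulr1// pnatr_eq0 -lt0n expn_gt0.
    rewrite lerXn2r ?nnegrE//.
    - rewrite addr_ge0// mulr_ge0 ?(ltW s0)// subr_ge0 ler1n expn_gt0//.
    - by rewrite lerD2l mulrBl ks mul1r lerBlDr lerDl ltW.
  apply: le_trans (_ : expR (2 ^ l)%:R^-1 ^+ (2 ^ l) <= _).
    by rewrite lerXn2r ?nnegrE ?expR_ge0 ?addr_ge0 ?invr_ge0// expR_ge1Dx.
  rewrite -expRM_natl mulfV ?pnatr_eq0 -?lt0n ?expn_gt0//.
  have h : expR (2^-1) <= 2 :> R by have := @expR_le_quad R 2^-1 (lexx _); lra.
  have -> : 1 = 2%:R * 2^-1 :> R by rewrite mulfV// pnatr_eq0.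
  rewrite expRM_natl expr2; have := expR_ge0 (2^-1 : R); nra.
have s0W : 0 < s ^+ W by rewrite exprn_gt0.
rewrite -(ler_nat R) -(ler_pM2r s0W).
apply: (@le_trans _ _ (4 ^+ Rd)).
  apply: le_trans tot.
  rewrite -sum1_card natr_sum mulr_suml big_mkcond/=; apply: ler_sum => w _.
  rewrite inE; case: ifP => [wW|_]; last by rewrite exprn_ge0// ltW.
  by rewrite mul1r ler_wiXn2l// ltW.
rewrite expnD natrM [in leRHS]expnM natrX mulrAC -exprMn mulfV ?expr1n ?mul1r; last first.
  by rewrite pnatr_eq0 -lt0n expn_gt0.
by rewrite expnM natrX.
Qed.

(** With d = 2^-dd and r = 2^k, the first inequality makes the pigeonhole over levels close, the
    second provides the growth of the left inverses, the third the Chernoff bound. Taking 2 dd close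
    to k (2 - p), the second quantity is about k (1 - (3 - p)(p - 1)) = k (2 - p)^2, up to terms in
    a and constants; hence k is a multiple of (2 - p)^-2, and a may stay logarithmic in k. *)
Lemma code_parameters (p : R) : 1 <= p < 2 -> exists k dd a : nat,
  [/\ (0 < k)%N, 7 + (k%:R + 2) * (2 - p) < (2 * dd)%:R,
     0 < k%:R - p - ((2 * dd + k + 3 + a)%:R + 2) * (p - 1) &
     (3 * (2 * dd + k + 3 + a + k) + 8 <= 2 ^ a)%N].
Proof.
move=> /andP[p1 p2].
have p20 : 0 < (2 - p) ^+ 2 by rewrite exprn_gt0// subr_gt0.
pose s := (Num.truncn ((2 - p) ^- 2)).+1.
have hs : 1 <= s%:R * (2 - p) ^+ 2.
  by rewrite -ler_pdivrMr// div1r ltW// /s truncnS_gt.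
have [a ha] := linear_le_exp (300 * s).
pose k := ((25 + a) * s)%N.
have k0 : (0 < k)%N by rewrite muln_gt0.
have kp0 : 0 <= k%:R * (2 - p) / 2 by rewrite divr_ge0// mulr_ge0// subr_ge0 ltW.
have [t [t1 t2]] : exists t, t%:R <= k%:R * (2 - p) / 2 /\ k%:R * (2 - p) / 2 < t%:R + 1.
  by have /andP[? ?] := truncn_itv kp0; eexists; split; [eassumption|rewrite natr1].
pose dd := (t + 8)%N.
have dd1 : k%:R * (2 - p) + 14 < (2 * dd)%:R.
  by rewrite natrM natrD; lra.
have dd2 : (2 * dd)%:R <= k%:R * (2 - p) + 16.
  by rewrite natrM natrD; lra.
have dk : (2 * dd <= k + 16)%N.
  rewrite -(ler_nat R) natrD; apply: le_trans dd2 _; rewrite lerD2r ler_piMr//; lra.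
exists k, dd, a; split=> //.
- lra.
- rewrite !natrD; have : (25 + a)%:R <= k%:R * (2 - p) ^+ 2.
    by rewrite /k natrM -mulrA ler_peMr.
  rewrite natrD => hk.
  have := ler_wpM2r (_ : 0 <= p - 1) dd2; rewrite subr_ge0 => /(_ p1).
  have a0 : 0 <= a%:R :> R by [].
  have : a%:R * (p - 1) <= a%:R by rewrite ler_piMr//; lra.
  nra.
- apply: leq_trans ha; rewrite /k in dk *; have : (0 < s)%N by []; nia.
Qed.

Theorem bad_embeddings_lt2 (p : R) : 1 <= p < 2 -> bad_embeddings p.
Proof.
move=> p12; have [p1 p2] := andP p12.
have p0 : 0 < p by exact: lt_le_trans p1.
have [k [dd [a [k0 h1 h2 h3]]]] := code_parameters p12.
set l := (2 * dd + k + 3 + a)%N in h2 h3.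
pose r : R := (2 ^ k)%:R.
have r2 : 2 <= r by rewrite /r -(prednK k0) expnS natrM ler_peMr// ler1n expn_gt0.
have r0 : 0 < r by lra.
pose d : R := (2 ^ dd)%:R^-1.
have pw2 n : (2 ^ n)%:R = 2 `^ n%:R :> R by rewrite powR_mulrn// natrX.
have d2 : d = 2 `^ (- dd%:R) by rewrite powRN -pw2.
pose e := 128 * d ^+ 2.
have eE : e = 2 `^ (7 - (2 * dd)%:R).
  rewrite /e d2 -powR_mulrn ?powR_ge0// -powRrM.
  have -> : 128 = 2 `^ 7%:R :> R by rewrite -pw2.
  rewrite -powRD ?pnatr_eq0 ?implybT//; congr (_ `^ _).
  by rewrite natrM; ring.
have dd4 : (4 <= dd)%N.
  have : 7 < (2 * dd)%:R :> R by apply: le_lt_trans h1; rewrite lerDl mulr_ge0//; lra.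
  by rewrite (ltr_nat R 7); lia.
have e12 : e <= 2^-1.
  rewrite eE -powR_inv1//; apply: ler_powR; first by lra.
  have : (8 : R) <= (2 * dd)%:R by rewrite (ler_nat R 8); lia.
  lra.
have d01 : 0 < d <= 2^-1.
  rewrite invr_gt0 ltr0n expn_gt0/= lef_pV2 ?posrE ?ltr0n ?expn_gt0//.
  by rewrite (ler_nat R 2) -{1}(expn1 2) leq_exp2l//; lia.
have e0 : 0 < e by rewrite eE powR_gt0.
(* The main term of the flat case decays in j like (4 r)^(-(2 - p) j), its error like e^j: this
   inequality lets the error win for large j. *)
have q1 : e * (4 * r) `^ (2 - p) < 1.
  have -> : 4 * r = 2 `^ (k%:R + 2).
    rewrite addrC powRD ?pnatr_eq0 ?implybT// /r pw2; congr (_ * _).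
    by rewrite powR_mulrn//; ring.
  rewrite eE -powRrM -powRD ?pnatr_eq0 ?implybT// /powR gt_eqF// expR_lt1.
  by rewrite pmulr_llt0 ?ln_gt0 ?ltr1n//; lra.
have [j [j0 hj]] : exists j, (0 < j)%N /\ r * r `^ p * e ^+ j <=
    2 `^ (- p) * (r * ((16 * r) ^+ 2 * (4 * r) ^+ j)) `^ (p - 2) * r / 32 / 2.
  pose c0 := 2 `^ (- p) * (r * (16 * r) ^+ 2) `^ (p - 2) * r / 32 / 2.
  have r40 : 0 < 4 * r by rewrite mulr_gt0.
  have c00 : 0 < c0.
    by rewrite !divr_gt0// mulr_gt0// mulr_gt0 ?powR_gt0// mulr_gt0// exprn_gt0// mulr_gt0.
  have rp0 : 0 < r * r `^ p by rewrite mulr_gt0// powR_gt0.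
  have q0 : 0 <= e * (4 * r) `^ (2 - p) by rewrite mulr_ge0 ?powR_ge0// ltW.
  have [|j [j0 hj]] := @exprn_lt_eps _ (c0 / (r * r `^ p)) (introT andP (conj q0 q1)).
    by rewrite divr_gt0.
  exists j; split=> //.
  have -> : 2 `^ (- p) * (r * ((16 * r) ^+ 2 * (4 * r) ^+ j)) `^ (p - 2) * r / 32 / 2 =
      c0 / ((4 * r) `^ (2 - p)) ^+ j.
    rewrite mulrA powRM ?exprn_ge0 ?(ltW r40)//; last first.
      by rewrite mulr_ge0 ?sqr_ge0// ltW.
    rewrite -(powR_mulrn j (ltW r40)) -[in RHS](powR_mulrn j (powR_ge0 _ _)).
    rewrite -!powRrM -powRN -mulNr opprB (mulrC j%:R) /c0; ring.
  rewrite ler_pdivlMr ?exprn_gt0 ?powR_gt0// -[leLHS]mulrA -exprMn.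
  by move: hj; rewrite ler_pdivlMr// mulrC.
set c1 := _ / 32 / 2 in hj.
have c10 : 0 < c1.
  apply: lt_le_trans hj; rewrite mulr_gt0 ?exprn_gt0// mulr_gt0// powR_gt0//.
pose c := Num.min c1 (2 `^ (- p) * e ^+ j / 4).
have c0 : 0 < c by rewrite lt_min c10/= divr_gt0// mulr_gt0 ?powR_gt0// exprn_gt0.
exists c, (r * r `^ p); split=> //; first by rewrite mulr_gt0// powR_gt0.
move=> K.
pose eta := k%:R - p - (l%:R + 2) * (p - 1).
pose B0 := (p - 1) * (1 + 2 * l%:R + k%:R) + 1.
(* Only rho depends on K; k, d, l and hence the constants c, C are already fixed. The radius Rd =
   2^rho enters the exponent with the positive factor eta, whereas the number L = 2^(l + rho) of
   convolutions costs only (p - 1) rho. *)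
have [rho hrho] : exists rho : nat, K <= 2 `^ ((2 ^ rho)%:R * eta - (p - 1) * rho%:R - B0).
  have eta0 : 0 < eta by [].
  have B00 : 0 <= B0 by rewrite addr_ge0// mulr_ge0// ?subr_ge0//; do 2 rewrite addr_ge0//; rewrite mulr_ge0.
  pose Mn := (Num.truncn `|K|).+1.
  have KM : K <= 2 `^ Mn%:R.
    apply: le_trans (ler_norm K) _; apply: le_trans (ltW (truncnS_gt _)) _.
    by rewrite -pw2 ler_nat ltnW// ltn_expl.
  pose Cn := (Num.truncn ((1 + B0 + Mn%:R) / eta)).+1.
  have hC : 1 + B0 + Mn%:R <= Cn%:R * eta.
    by rewrite -ler_pdivrMr// ltW// truncnS_gt.
  have [rho hrho] := linear_le_exp Cn; exists rho.
  apply: le_trans KM _; apply: ler_powR; first by lra.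
  have : Cn%:R * (rho%:R + 1) * eta <= (2 ^ rho)%:R * eta.
    by rewrite ler_wpM2r ?(ltW eta0)// natr1 -natrM ler_nat.
  have M0 : 0 <= Mn%:R :> R by [].
  have r00 : 0 <= rho%:R :> R by [].
  have : (p - 1) * rho%:R <= rho%:R by rewrite ler_piMl//; lra.
  have : (1 + B0 + Mn%:R) * (rho%:R + 1) <= Cn%:R * eta * (rho%:R + 1) by rewrite ler_wpM2r// addr_ge0.
  have : 0 <= (B0 + Mn%:R) * rho%:R by rewrite mulr_ge0// addr_ge0.
  move: ((2 ^ rho)%:R : R) => q; nra.
pose Rd := (2 ^ rho)%N.
have Rd0 : (0 < Rd)%N by rewrite expn_gt0.
pose L := (2 ^ l * Rd)%N.
have LE : L = (2 ^ (l + rho))%N by rewrite /L /Rd expnD.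
have L0 : (0 < L)%N by rewrite LE expn_gt0.
pose m := ((l + k) * (Rd.*2.+1) + 2 * Rd + 2)%N.
have hexp : 8 * (2 ^ m)%:R <= expR (d ^+ 2 * L%:R / (8 * (2 ^ k)%:R)).
  have -> : d ^+ 2 * L%:R / (8 * (2 ^ k)%:R) = (2 ^ a * Rd)%:R.
    have lE : L = (2 ^ dd * 2 ^ dd * (8 * 2 ^ k) * (2 ^ a * Rd))%N.
      rewrite /L /l mul2n -addnn !expnD.
      by move: (2 ^ dd)%N (2 ^ k)%N (2 ^ a)%N => x y z; rewrite (_ : 2 ^ 3 = 8)%N; [ring|].
    rewrite lE !natrM /d; field.
    by rewrite !pnatr_eq0 -!lt0n !expn_gt0.
  have -> : 8 * (2 ^ m)%:R = (2 ^ (m + 3))%:R :> R by rewrite expnD natrM mulrC.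
  apply: le_trans (_ : (2 ^ (2 ^ a * Rd))%:R <= _).
    rewrite ler_nat leq_exp2l// /m -muln2.
    apply: leq_trans (_ : (3 * (l + k) + 8) * Rd <= _)%N; last first.
      by rewrite leq_mul2r h3 orbT.
    have nf x z : (0 < z -> x * (z * 2).+1 + 2 * z + 2 + 3 <= (3 * x + 8) * z)%N by clear; nia.
    exact: nf.
  rewrite -[in leRHS](mulr1 (_%:R)) expRM_natl natrX lerXn2r ?nnegrE ?expR_ge0//.
  by apply: le_trans (expR_ge1Dx 1).
have hW : (4 * #|[pred w : {ffun 'I_L -> 'rV['F_2]_k} | (wsupp w <= Rd.*2.+1)%N]| <= 2 ^ m)%N.
  rewrite /m [X in (_ <= X)%N]expnD mulnC (_ : 4 = 2 ^ 2)%N; last by [].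
  rewrite leq_mul2r/=.
  exact: card_wsupp_le.
have d1 : 0 < d <= 1 by case/andP: d01 => -> /=; lra.
have [M [HA HB]] := exists_code d1 hexp hW.
pose V := 'rV['F_2]_m.
(* The weight L^(-1/p) makes the sum of L convolutions bounded independently of L. *)
pose al : R := (L%:R `^ p^-1)^-1.
have LR0 : 0 < L%:R :> R by rewrite ltr0n.
have al0 : 0 < al by rewrite invr_gt0 powR_gt0.
have alp : al `^ p = L%:R^-1.
  rewrite /al -powR_inv1 ?powR_ge0// -!powRrM mulN1r mulrN mulVf ?gt_eqF// powR_inv1// ltW.
pose T (j : 'I_L * V) (g : V) : R := al * \sum_(h : 'rV['F_2]_k) (j.2 + h *m M j.1 == g)%:R.
have TE f i x : mx_app T f (i, x) = al * code_op M i f x.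
  rewrite /mx_app /T/=; under eq_bigr do rewrite -mulrA; rewrite -mulr_sumr; congr (_ * _).
  under eq_bigr do rewrite mulr_suml.
  rewrite exchange_big/=; apply: eq_bigr => h _.
  rewrite (bigD1 (x + h *m M i))//= eqxx mul1r big1 ?addr0// => g /negbTE.
  by rewrite eq_sym => ->; rewrite mul0r.
have lpT f : lp_sum p (mx_app T f) = L%:R^-1 * \sum_i \sum_x `|code_op M i f x| `^ p.
  rewrite /lp_sum mulr_sumr; under [RHS]eq_bigr do rewrite mulr_sumr.
  rewrite pair_bigA/=; apply: eq_bigr => -[i x] _.
  by rewrite TE normrM powRM// (ger0_norm (ltW al0)) alp.
exists V, ('I_L * V)%type, T; split.
- move=> f; rewrite lpT [leRHS]mulrC ler_pdivlMr// mulrAC.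
  have cc1 : c <= c1 by rewrite ge_min lexx.
  have cc2 : c <= 2 `^ (- p) * e ^+ j / 4 by rewrite ge_min lexx orbT.
  exact: (@code_op_lower R m k L M d p j c f d01 HA p12 j0 e12 hj cc1 cc2).
- move=> f; rewrite lpT [leLHS]mulrC ler_pdivrMr//.
  by apply: le_trans (code_op_upper _ _ p0) _; rewrite -/r mulrAC.
move=> S K' hS hK'.
apply: le_trans hrho _.
pose t : R := - (r - 1)^-1.
have rt : 1 + (r - 1) * t = 0 by rewrite /t mulrN mulfV ?subrr// gt_eqF//; lra.
pose s g i x := al * S g (i, x).
have hs (f : V -> R) g : \sum_i \sum_x s g i x * code_op M i f x = f g.
  rewrite -(hS f g) /mx_app pair_bigA/=; apply: eq_bigr => -[i x] _.
  by rewrite -/(mx_app T f (i, x)) TE /s; ring.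
have hK i x : \sum_g `|s g i x| `^ p <= L%:R^-1 * K'.
  under eq_bigr do rewrite normrM powRM// (ger0_norm (ltW al0)) alp.
  rewrite -mulr_sumr ler_wpM2l ?invr_ge0//.
  have ly : lp_sum p (fun j : 'I_L * V => (j == (i, x))%:R) = 1 :> R.
    rewrite /lp_sum (bigD1 (i, x))//= eqxx normr1 powR1 big1 ?addr0// => j' /negbTE ->.
    by rewrite normr0 powR0// gt_eqF.
  have := hK' (fun j => (j == (i, x))%:R); rewrite ly mulr1; apply: le_trans.
  apply: ler_sum => g _.
  rewrite /mx_app (bigD1 (i, x))//= eqxx mulr1 big1 ?addr0// => j' /negbTE ->.
  by rewrite mulr0.
pose A : R := #|[pred w : {ffun 'I_L -> 'rV['F_2]_k} | (wsupp w <= Rd.+1)%N]|%:R.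
have A0 : 0 < A.
  by rewrite ltr0n; apply/card_gt0P; exists 0; rewrite inE wsuppE big1// => i _; rewrite ffunE eqxx.
pose tR := `|t| ^+ Rd.
have t0 : 0 < `|t| by rewrite normrN normfV invr_gt0 normr_gt0 gt_eqF//; lra.
have tR0 : 0 < tR by rewrite exprn_gt0.
(* With this la the term with the cardinality of the ball is exactly 1/2, and the other one has to
   account for the rest. *)
pose la := (2 * L%:R * A * tR)^-1.
have la0 : 0 < la by rewrite invr_gt0 !mulr_gt0.
have := @code_left_inverse R m k L M Rd t rt HB p la _ s p1 la0 hs hK.
rewrite -/A -/tR => main.
have {}main : 2^-1 <= tR * la `^ (1 - p) * K'.
  have e1 : L%:R * (tR * (A * la)) = 2^-1.
    by rewrite /la; field; rewrite !gt_eqF.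
  have e2 : L%:R * (tR * (la `^ (1 - p) * (L%:R^-1 * K'))) = tR * la `^ (1 - p) * K'.
    by field; rewrite gt_eqF.
  by move: main; rewrite mulrDr mulrDr e1 e2; lra.
have X0 : 0 < tR * la `^ (1 - p) by rewrite mulr_gt0// powR_gt0.
have {}main : (2 * (tR * la `^ (1 - p)))^-1 <= K'.
  by rewrite invfM -(ler_pM2l X0) mulrCA mulfV ?gt_eqF// mulr1.
apply: le_trans main.
have laE : la `^ (1 - p) = (2 * L%:R * A) `^ (p - 1) * tR `^ (p - 1).
  rewrite /la -powR_inv1 ?mulr_ge0 ?(ltW A0) ?(ltW tR0)// -powRrM mulN1r opprB powRM ?mulr_ge0 ?ltW//.
have -> : tR * la `^ (1 - p) = (2 * L%:R * A) `^ (p - 1) * tR `^ p.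
  rewrite laE mulrCA; congr (_ * _).
  by rewrite mulr_powRB1// ltW.
have hA : A <= 2 `^ ((l + k)%:R * Rd.+1%:R + 2 * Rd%:R).
  apply: le_trans (_ : (2 ^ ((l + k) * Rd.+1 + 2 * Rd))%:R <= _); first by rewrite ler_nat; exact: card_wsupp_le.
  by rewrite pw2 natrD !natrM.
have htR : tR `^ p <= 2 `^ (- ((k%:R - 1) * Rd%:R * p)).
  have ht : `|t| <= 2 `^ (- (k%:R - 1)).
    rewrite normrN normfV ger0_norm; last by lra.
    rewrite powRN lef_pV2 ?posrE ?powR_gt0//; last by lra.
    have -> : k%:R - 1 = k.-1%:R :> R by rewrite -{1}(prednK k0) -natr1 addrK.
    rewrite -pw2 /r -{2}(prednK k0) expnS natrM.
    have : (1 : R) <= (2 ^ k.-1)%:R by rewrite ler1n expn_gt0.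
    by move: ((2 ^ k.-1)%:R : R) => q; lra.
  rewrite /tR -powR_mulrn ?normr_ge0// -powRrM.
  apply: le_trans (_ : (2 `^ (- (k%:R - 1))) `^ (Rd%:R * p) <= _).
    apply: ge0_ler_powR; rewrite ?nnegrE ?powR_ge0 ?mulr_ge0//; exact: ltW.
  by rewrite -powRrM mulNr mulrA.
have hL : (2 * L%:R * A) `^ (p - 1) <= 2 `^ ((1 + (l + rho)%:R + (l + k)%:R * Rd.+1%:R + 2 * Rd%:R) * (p - 1)).
  rewrite powRrM; apply: ge0_ler_powR; rewrite ?nnegrE ?subr_ge0 ?powR_ge0 ?mulr_ge0 ?(ltW A0)//.
  rewrite -addrA powRD ?pnatr_eq0 ?implybT// powRD ?pnatr_eq0 ?implybT// powRr1// -pw2 -LE.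
  by rewrite ler_wpM2l ?mulr_ge0.
apply: le_trans (_ : (2 * (2 `^ ((1 + (l + rho)%:R + (l + k)%:R * Rd.+1%:R + 2 * Rd%:R) * (p - 1)) *
   2 `^ (- ((k%:R - 1) * Rd%:R * p))))^-1 <= _); last first.
  rewrite lef_pV2 ?posrE ?mulr_gt0 ?powR_gt0 ?mulr_gt0//.
  rewrite ler_wpM2l// ler_pM ?powR_ge0//.
have merge x y : 2 * (2 `^ x * 2 `^ y) = 2 `^ (1 + (x + y)) :> R.
  by rewrite !powRD ?pnatr_eq0 ?implybT// powRr1.
rewrite merge -powRN.
rewrite le_eqVlt; apply/orP; left; apply/eqP; congr (_ `^ _).
rewrite /eta /B0 !natrD -[Rd.+1%:R]natr1 -/Rd; ring.
Qed.

End bad_embeddings_lt2.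

(** * Rademacher functions and selectors *)

Section rademacher.
Context {R : realType} (n : nat).
Local Notation Sg := {ffun 'I_n -> bool}.
Implicit Types (e : Sg) (a : 'I_n -> R).

Definition radem e (i : 'I_n) : R := if e i then 1 else -1.

Lemma radem_sqr e i : radem e i * radem e i = 1.
Proof. by rewrite /radem; case: ifP; rewrite ?mulr1 ?mulrNN ?mulr1. Qed.

Lemma normr_radem e i : `|radem e i| = 1.
Proof. by rewrite /radem; case: ifP; rewrite ?normrN normr1. Qed.

Lemma sum_radem2 i j : \sum_e radem e i * radem e j = (#|{: Sg}| * (i == j))%:R.
Proof.
have [<-|ij] := eqVneq i j.
  by under eq_bigr do rewrite radem_sqr; rewrite sumr_const muln1.
rewrite muln0; pose fl e : Sg := [ffun l => if l == i then ~~ e l else e l].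
have flK : involutive fl.
  by move=> e; apply/ffunP => l; rewrite !ffunE; case: eqP; rewrite ?negbK.
set s := \sum_e _; have : s = - s.
  rewrite {1}/s (reindex_inj (inv_inj flK))/= -sumrN; apply: eq_bigr => e _.
  rewrite /radem !ffunE eqxx eq_sym (negbTE ij).
  by case: (e i); case: (e j); rewrite /=; lra.
lra.
Qed.

Lemma sum_radem_sqr a : \sum_e (\sum_i a i * radem e i) ^+ 2 = #|{: Sg}|%:R * \sum_i a i ^+ 2.
Proof.
under eq_bigr do rewrite expr2 mulr_suml.
rewrite exchange_big/= mulr_sumr; apply: eq_bigr => i _.
under eq_bigr do rewrite mulr_sumr.
rewrite exchange_big/= (bigD1 i)//= [X in _ + X]big1 => [|j ji].
  rewrite addr0; under eq_bigr do rewrite mulrACA.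
  by rewrite -mulr_sumr sum_radem2 eqxx muln1 expr2 mulrC.
under eq_bigr do rewrite mulrACA.
by rewrite -mulr_sumr sum_radem2 eq_sym (negbTE ji) muln0 mulr0.
Qed.

(** The signs are independent and e^a + e^-a <= 2 exp(2 a^2): by the quadratic bound if |a| <= 1/2,
    and because |a| <= 2 a^2 otherwise. *)
Lemma sum_expR_radem a :
  \sum_e expR (\sum_i a i * radem e i) <= #|{: Sg}|%:R * expR (2 * \sum_i a i ^+ 2).
Proof.
under eq_bigr do rewrite expR_sum.
rewrite -(bigA_distr_bigA (fun i (b : bool) => expR (a i * (if b then 1 else -1)))).
rewrite mulr_sumr expR_sum.
have -> : #|{: Sg}|%:R = \prod_(i < n) 2 :> R.
  by rewrite prodr_const card_ffun card_bool card_ord natrX.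
rewrite -big_split/=; apply: ler_prod => i _; rewrite big_bool/= mulr1 mulrN1.
rewrite addr_ge0 ?expR_ge0//=.
have [h|h] := leP `|a i| 2^-1.
  have /ler_normlP[h1 h2] := h.
  have := expR_le_quad h2; have := expR_le_quad (_ : - a i <= 2^-1) => /(_ h1).
  have := expR_ge1Dx (2 * a i ^+ 2); rewrite sqrrN; lra.
have ha : `|a i| <= 2 * a i ^+ 2 by rewrite -(real_normK (num_real (a i))); nra.
have : expR (a i) <= expR (2 * a i ^+ 2) by rewrite ler_expR (le_trans (ler_norm _)).
have : expR (- a i) <= expR (2 * a i ^+ 2).
  by rewrite ler_expR (le_trans _ ha)// -normrN ler_norm.
lra.
Qed.

(** The term of order q + 1 in the exponential series, q being the integer part of p, dominates
    |x|^p for |x| >= 1; hence the factorial. *)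
Lemma powR_le_expR (p : R) : 0 <= p -> exists2 C : R, 0 < C &
  forall x, `|x| `^ p <= C * (expR x + expR (- x)).
Proof.
move=> p0; pose q := (Num.truncn p); have pq : p <= q.+1%:R by rewrite ltW// truncnS_gt.
exists (q.+1)`!%:R; first by rewrite ltr0n fact_gt0.
move=> x; have f0 : 1 <= (q.+1)`!%:R :> R by rewrite ler1n fact_gt0.
have xq : `|x| `^ p <= 1 + `|x| ^+ q.+1.
  have [x1|x1] := leP `|x| 1.
    apply: le_trans (_ : 1 `^ p <= _); last by rewrite powR1 lerDl exprn_ge0.
    by apply: ge0_ler_powR; rewrite ?nnegrE.
  apply: le_trans (_ : `|x| ^+ q.+1 <= _); last by rewrite lerDr.
  by rewrite -powR_mulrn//; apply: ler_powR => //; exact: ltW.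
have e1 := @expR_ge1Dxn R `|x| q (normr_ge0 _).
apply: le_trans xq _; apply: le_trans (_ : (q.+1)`!%:R * expR `|x| <= _).
  have := ler_wpM2l (ler0n R (q.+1)`!) e1.
  by rewrite mulrDr mulr1 mulrCA mulfV ?mulr1 ?(gt_eqF (lt_le_trans _ f0))//; lra.
rewrite ler_wpM2l//; have := expR_ge0 x; have := expR_ge0 (- x).
by case: (ger0P x) => _; lra.
Qed.

(** By homogeneity the squares of the coefficients may be taken to sum to 1, where the subgaussian
    bound is the constant exp 2. The constant C is a parameter, so that the bound is visibly
    independent of n. *)
Lemma khinchine_upper (p : R) (C : R) : 0 < p -> 0 < C ->
  (forall x, `|x| `^ p <= C * (expR x + expR (- x))) ->
  forall a, \sum_e `|\sum_i a i * radem e i| `^ p <=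
    (2 * C * expR 2) * #|{: Sg}|%:R * (\sum_i a i ^+ 2) `^ (p / 2).
Proof.
move=> p0 C0 hC a.
have unit_case b : \sum_i b i ^+ 2 = 1 ->
    \sum_e `|\sum_i b i * radem e i| `^ p <= (2 * C * expR 2) * #|{: Sg}|%:R.
  move=> b1; apply: le_trans (ler_sum _ (fun e _ => hC (\sum_i b i * radem e i))) _.
  rewrite -mulr_sumr big_split/=.
  have := sum_expR_radem b; rewrite b1 mulr1 => h2.
  have h1 : \sum_(e : Sg) expR (- \sum_i b i * radem e i) <= #|{: Sg}|%:R * expR 2.
    have -> : \sum_(e : Sg) expR (- \sum_i b i * radem e i) =
        \sum_e expR (\sum_i - b i * radem e i).
      by apply: eq_bigr => e _; rewrite -sumrN; under eq_bigr do rewrite -mulNr.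
    apply: le_trans (sum_expR_radem _) _; under eq_bigr do rewrite sqrrN.
    by rewrite b1 mulr1.
  by have := ler_wpM2l (ltW C0) (lerD h1 h2); rewrite addrC; lra.
set S := \sum_i a i ^+ 2.
have S0 : 0 <= S by apply: sumr_ge0 => i _; exact: sqr_ge0.
have [SE|Sn0] := eqVneq S 0.
  rewrite big1 ?mulr_ge0 ?powR_ge0 ?expR_ge0 ?(ltW C0)// => e _.
  have a0 i : a i = 0.
    have /eqP := SE; rewrite psumr_eq0 => [/allP/(_ i)|j _]; last exact: sqr_ge0.
    by rewrite mem_index_enum sqrf_eq0 => /(_ isT)/eqP.
  by rewrite big1 ?normr0 ?powR0 ?gt_eqF// => i _; rewrite a0 mul0r.
have Sp : 0 < S by rewrite lt_neqAle eq_sym Sn0.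
pose c := Num.sqrt S; have c0 : 0 < c by rewrite sqrtr_gt0.
have cS : c ^+ 2 = S by rewrite sqr_sqrtr.
have /unit_case h : \sum_i (a i / c) ^+ 2 = 1.
  by under eq_bigr do rewrite expr_div_n; rewrite -mulr_suml cS mulfV.
have cp : S `^ (p / 2) = c `^ p.
  by rewrite -cS -(powR_mulrn 2 (ltW c0)) -powRrM; congr (_ `^ _); rewrite mulrC mulfVK// pnatr_eq0.
rewrite cp -ler_pdivrMr ?powR_gt0// mulr_suml; apply: le_trans h; apply: ler_sum => e _.
have -> : \sum_i a i / c * radem e i = (\sum_i a i * radem e i) / c.
  by rewrite mulr_suml; apply: eq_bigr => i _; rewrite mulrAC.
rewrite normrM powRM// (ger0_norm (_ : 0 <= c^-1)) ?invr_ge0 ?(ltW c0)//.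
by rewrite -[X in _ <= _ * X `^ _]powR_inv1 ?(ltW c0)// -powRrM mulN1r powRN.
Qed.

End rademacher.

Section power_means.
Context {R : realType}.

Lemma powR_split (s l x : R) : 1 <= s -> 0 < l -> 0 <= x ->
  x <= l + l `^ (1 - s) * x `^ s.
Proof.
move=> s1 l0 x0; have [xl|xl] := leP x l; first by rewrite (le_trans xl)// lerDl mulr_ge0 ?powR_ge0.
apply: le_trans (_ : l `^ (1 - s) * x `^ s <= _); last by rewrite lerDr ltW.
have xp : 0 < x by exact: lt_trans xl.
rewrite -[leLHS](powRr1 x0) (_ : x `^ 1 = x `^ (1 - s) * x `^ s); last first.
  by rewrite -powRD ?(gt_eqF xp) ?implybT//; congr (_ `^ _); lra.
rewrite ler_wpM2r ?powR_ge0// (_ : 1 - s = - (s - 1)); last by lra.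
rewrite !powRN lef_pV2 ?posrE ?powR_gt0//.
by apply: ge0_ler_powR; rewrite ?nnegrE ?subr_ge0// ltW.
Qed.

(* Jensen's inequality, up to the harmless constant [2 ^ s]. *)
Lemma sum_powR_mean (I : finType) (X : I -> R) (s : R) : 1 <= s ->
  (forall i, 0 <= X i) -> (0 < #|I|)%N ->
  #|I|%:R * ((\sum_i X i) / #|I|%:R) `^ s <= 2 `^ s * \sum_i X i `^ s.
Proof.
move=> s1 X0 I0; set N : R := #|I|%:R; have N0 : 0 < N by rewrite ltr0n.
have s0 : 0 < s by exact: lt_le_trans s1.
set m := (\sum_i X i) / N.
have m0 : 0 <= m by rewrite divr_ge0 ?sumr_ge0// ltW.
have [->|mn0] := eqVneq m 0.
  by rewrite powR0 ?gt_eqF// mulr0 mulr_ge0 ?powR_ge0 ?sumr_ge0// => i _; exact: powR_ge0.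
have mp : 0 < m by rewrite lt_neqAle eq_sym mn0.
have m2 : 0 < m / 2 by rewrite divr_gt0.
have : N * m <= N * (m / 2) + (m / 2) `^ (1 - s) * \sum_i X i `^ s.
  have -> : N * m = \sum_i X i by rewrite /m mulrC mulfVK ?gt_eqF.
  have -> : N * (m / 2) = \sum_(i : I) (m / 2) by rewrite sumr_const mulr_natl.
  rewrite mulr_sumr -big_split/=; apply: ler_sum => i _; exact: powR_split.
set Y := \sum_i _ `^ _ => h.
have {}h : N * (m / 2) <= (m / 2) `^ (1 - s) * Y by lra.
have -> : m `^ s = 2 `^ s * ((m / 2) `^ (s - 1) * (m / 2)).
  rewrite [X in _ * X]mulrC mulr_powRB1 ?(ltW m2)// -powRM ?(ltW m2)//.
  by rewrite mulrC mulfVK.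
rewrite mulrCA ler_wpM2l ?powR_ge0// mulrCA.
apply: le_trans (ler_wpM2l (powR_ge0 (m / 2) (s - 1)) h) _.
by rewrite mulrA -powRD ?(gt_eqF m2) ?implybT// (_ : s - 1 + (1 - s) = 0) ?powRr0 ?mul1r//; lra.
Qed.

End power_means.

(** * Rosenthal's inequality for independent selectors *)

Section selectors.
Context {R : realType} (n M : nat).
Local Notation Bt := {ffun 'I_n -> 'I_M.+1}.
Implicit Types (b : Bt).

(** Under a uniformly random b these are independent 0-1 variables of mean 1 / (M + 1). *)
Definition select b (i : 'I_n) : R := (b i == 0%R)%:R.

Lemma select_idem b i : select b i * select b i = select b i.
Proof. by rewrite /select; case: eqP; rewrite ?mulr1 ?mulr0. Qed.

Lemma sum_select i (phi : Bt -> R) :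
  (forall b v, phi [ffun j => if j == i then v else b j] = phi b) ->
  M.+1%:R * \sum_b select b i * phi b = \sum_b phi b.
Proof.
move=> hphi.
transitivity (\sum_(v : 'I_M.+1) \sum_(b : Bt) (b i == v)%:R * phi b).
  rewrite mulr_natl -[X in _ *+ X](card_ord M.+1) -sumr_const; apply: eq_bigr => v _.
  pose sh b : Bt := [ffun j => if j == i then b i + v else b j].
  have sh_inj : injective sh.
    move=> b b' /ffunP e; apply/ffunP => j; have := e j; rewrite !ffunE.
    by case: eqP => [->|//]; exact: addIr.
  rewrite [RHS](reindex_inj sh_inj)/=; apply: eq_bigr => b _; rewrite hphi ffunE eqxx.
  by rewrite /select -[in RHS]subr_eq0 addrK.
rewrite exchange_big/=; apply: eq_bigr => b _.
by rewrite -mulr_suml (bigD1 (b i))//= eqxx big1 ?addr0 ?mul1r// => v /negbTE; rewrite eq_sym => ->.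
Qed.

Lemma sum_select1 i : M.+1%:R * \sum_b select b i = #|{: Bt}|%:R.
Proof.
have := @sum_select i (fun=> 1) (fun _ _ => erefl).
by under eq_bigr do rewrite mulr1; rewrite sumr_const.
Qed.

(** Write U^s as the sum of c i times selector i times U^(s-1). On the event that i is selected, U
    is c i plus a sum independent of that selector, so each selector can be averaged out, leaving
    the moment of order s - 1. That one is bounded by l^(s-1) plus U^s / l, and the last term is
    absorbed on the left. *)
Lemma rosenthal_select (s : R) (c : 'I_n -> R) : 1 < s -> (forall i, 0 <= c i) ->
  \sum_b (\sum_i c i * select b i) `^ s <=
  #|{: Bt}|%:R * (2 `^ s * (\sum_i c i `^ s) / M.+1%:R +
                 (2 `^ s * (\sum_i c i) / M.+1%:R) `^ s).
Proof.
move=> s1 c0; have s0 : 0 < s by exact: lt_trans s1.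
have M0 : 0 < M.+1%:R :> R by [].
pose U b := \sum_i c i * select b i.
have U0 b : 0 <= U b by apply: sumr_ge0 => i _; rewrite mulr_ge0.
set X := \sum_b _; set C := \sum_i c i; set Cs := \sum_i c i `^ s.
have C0 : 0 <= C by exact: sumr_ge0.
have Cs0 : 0 <= Cs by apply: sumr_ge0 => i _; exact: powR_ge0.
have [CE|Cn0] := eqVneq C 0.
  have ci i : c i = 0.
    have /eqP := CE; rewrite psumr_eq0// => /allP/(_ i).
    by rewrite mem_index_enum => /(_ isT)/eqP.
  rewrite /X big1 ?mulr_ge0 ?addr_ge0 ?powR_ge0 ?divr_ge0 ?mulr_ge0 ?powR_ge0// => b _.
  by rewrite big1 ?powR0 ?gt_eqF// => i _; rewrite ci mul0r.
have Cp : 0 < C by rewrite lt_neqAle eq_sym Cn0.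
have XE : X = \sum_i c i * \sum_b select b i * U b `^ (s - 1).
  under eq_bigr do rewrite mulr_sumr.
  rewrite exchange_big/=; apply: eq_bigr => b _.
  rewrite -mulr_powRB1 ?U0// mulr_suml; apply: eq_bigr => i _; by rewrite mulrA.
have s10 : 0 < s - 1 by rewrite subr_gt0.
have step i : M.+1%:R * \sum_b select b i * U b `^ (s - 1) <=
    2 `^ (s - 1) * (#|{: Bt}|%:R * c i `^ (s - 1) + \sum_b U b `^ (s - 1)).
  pose Ui b := \sum_(j | j != i) c j * select b j.
  have Ui0 b : 0 <= Ui b by apply: sumr_ge0 => j _; rewrite mulr_ge0.
  have UiU b : Ui b <= U b by rewrite /U (bigD1 i)//= lerDr mulr_ge0.
  apply: le_trans (_ : M.+1%:R * \sum_b select b i * (2 `^ (s - 1) * (c i `^ (s - 1) + Ui b `^ (s - 1))) <= _).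
    rewrite ler_wpM2l//; apply: ler_sum => b _.
    have [bi|bi] := eqVneq (b i) 0; last by rewrite /select (negbTE bi) !mul0r.
    rewrite ler_wpM2l//; have := @powR_normD R (c i) (Ui b) _ s10.
    rewrite !ger0_norm ?addr_ge0//; congr (_ `^ _ <= _).
    by rewrite /U (bigD1 i)//= /select bi eqxx mulr1.
  rewrite sum_select => [|b v]; last first.
    congr (_ * (_ + _ `^ _)); apply: eq_bigr => j /negbTE ji.
    by rewrite /select ffunE ji.
  rewrite -mulr_sumr ler_wpM2l ?powR_ge0// big_split/= sumr_const [in leRHS]mulr_natl lerD2l.
  by apply: ler_sum => b _; apply: ge0_ler_powR; rewrite ?nnegrE// ltW.
(* The threshold for which the U^s term comes back with the factor 1/2. *)
pose l := 2 `^ s * C / M.+1%:R.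
have l0 : 0 < l by rewrite divr_gt0// mulr_gt0// powR_gt0.
have Us : \sum_b U b `^ (s - 1) <= #|{: Bt}|%:R * l `^ (s - 1) + X / l.
  have -> : #|{: Bt}|%:R * l `^ (s - 1) = \sum_(b : Bt) l `^ (s - 1).
    by rewrite sumr_const mulr_natl.
  rewrite /X mulr_suml -big_split/=; apply: ler_sum => b _.
  have [Ul|Ul] := leP (U b) l.
    apply: le_trans (_ : l `^ (s - 1) <= _); last first.
      by rewrite lerDl; apply: divr_ge0; [exact: powR_ge0|exact: ltW].
    by apply: ge0_ler_powR; rewrite ?nnegrE// ltW.
  apply: le_trans (_ : U b `^ s / l <= _); last by rewrite lerDr powR_ge0.
  rewrite ler_pdivlMr//.
  rewrite -(mulr_powRB1 (U0 b) s0) mulrC ler_wpM2r ?powR_ge0// ltW//.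
have main : M.+1%:R * X <= 2 `^ (s - 1) * (#|{: Bt}|%:R * Cs + C * \sum_b U b `^ (s - 1)).
  rewrite XE mulr_sumr.
  have -> : 2 `^ (s - 1) * (#|{: Bt}|%:R * Cs + C * \sum_b U b `^ (s - 1)) =
    \sum_i c i * (2 `^ (s - 1) * (#|{: Bt}|%:R * c i `^ (s - 1) + \sum_b U b `^ (s - 1))).
    rewrite /Cs /C mulr_sumr mulr_suml -big_split/= mulr_sumr; apply: eq_bigr => i _.
    by rewrite -(mulr_powRB1 (c0 i) s0); ring.
  by apply: ler_sum => i _; rewrite mulrCA ler_wpM2l.
have s2 : 2 `^ s = 2 * 2 `^ (s - 1) :> R by rewrite mulr_powRB1.
have : M.+1%:R * X <= 2 `^ (s - 1) * (#|{: Bt}|%:R * Cs) +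
   2 `^ (s - 1) * C * (#|{: Bt}|%:R * l `^ (s - 1) + X / l).
  apply: le_trans main _; rewrite mulrDr lerD2l mulrA ler_wpM2l// mulr_ge0 ?powR_ge0//.
have lE : 2 `^ (s - 1) * C = M.+1%:R * l / 2.
  by rewrite /l s2; field.
rewrite lE -/l -(mulr_powRB1 (ltW l0) s0).
have -> : M.+1%:R * l / 2 * (#|{: Bt}|%:R * l `^ (s - 1) + X / l) =
   M.+1%:R * (#|{: Bt}|%:R * (l * l `^ (s - 1)) / 2 + X / 2) by field; rewrite gt_eqF.
rewrite -/Cs s2 => h; rewrite -(ler_pM2l M0).
have -> : M.+1%:R * (#|{: Bt}|%:R * (2 * 2 `^ (s - 1) * Cs / M.+1%:R + l * l `^ (s - 1))) =
  2 * (2 `^ (s - 1) * (#|{: Bt}|%:R * Cs)) + M.+1%:R * (#|{: Bt}|%:R * (l * l `^ (s - 1))) :> R.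
  by field.
move: h; rewrite mulrDr; lra.
Qed.

End selectors.

(** * Finite-dimensional Rosenthal spaces X_p *)

Section selector_system.
Context {R : realType} (p : R) (n M : nat).
Hypothesis p2 : 2 < p.
Local Notation Sg := {ffun 'I_n -> bool}.
Local Notation Bt := {ffun 'I_n -> 'I_M.+1}.
Local Notation Om := ({ffun 'I_n -> bool} * {ffun 'I_n -> 'I_M.+1})%type.
Local Notation NS := (#|{: {ffun 'I_n -> bool}}|%:R : R).
Local Notation NB := (#|{: {ffun 'I_n -> 'I_M.+1}}|%:R : R).
Local Notation m := (M.+1%:R : R).

Let p0 : 0 < p. Proof. by apply: lt_trans p2. Qed.
Let NS0 : 0 < NS. Proof. by rewrite ltr0n; apply/card_gt0P; exists [ffun=> true]. Qed.
Let NB0 : 0 < NB. Proof. by rewrite ltr0n; apply/card_gt0P; exists [ffun=> ord0]. Qed.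
Let m0 : 0 < m. Proof. by []. Qed.

Definition radsel i (o : Om) : R := radem o.1 i * select o.2 i.

Lemma sum_radsel2 i j : \sum_o radsel i o * radsel j o = NS * NB / m * (i == j)%:R.
Proof.
rewrite -(pair_bigA _ (fun e b => radsel i (e, b) * radsel j (e, b)))/=.
rewrite exchange_big/=.
rewrite (eq_bigr (fun b : Bt => NS * (i == j)%:R * select b i)).
  rewrite -mulr_sumr -(sum_select1 (R := R) M i); field.
  by rewrite addrC natr1 pnatr_eq0.
move=> b _; rewrite /radsel/=; under eq_bigr do rewrite mulrACA.
rewrite -mulr_suml sum_radem2 natrM -!mulrA; congr (_ * _).
by case: eqP => [<-|]; rewrite ?mul0r// select_idem.
Qed.

Local Notation q := (m / (NS * NB)).
Let q0 : 0 < q. Proof. by rewrite divr_gt0// mulr_gt0. Qed.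

(** The powers of q normalise the truncated Rademacher functions: [sel_f] has norm 1 in l_p, [sel_h]
    has norm 1 for the conjugate exponent, and the two systems are biorthogonal. *)
Definition sel_f i (o : Om) : R := q `^ p^-1 * radsel i o.
Definition sel_h i (o : Om) : R := q `^ (1 - p^-1) * radsel i o.
Definition sel_coef (z : Om -> R) i : R := \sum_o z o * sel_h i o.
(** The weight of Rosenthal's space X_p: a combination of the [sel_f] has p-th power norm comparable
    to the p-sum of its coefficients plus w^p times the p-th power of their 2-norm. It tends to 0 as
    M grows, since p > 2. *)
Definition sel_w : R := m `^ (p^-1 - 2^-1).

Lemma sel_coef_f j i : sel_coef (sel_f j) i = (i == j)%:R.
Proof.
rewrite /sel_coef /sel_f /sel_h; under eq_bigr do rewrite mulrACA.
rewrite -mulr_sumr -powRD ?(gt_eqF q0) ?implybT// addrC subrK powRr1 ?(ltW q0)//.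
rewrite sum_radsel2 eq_sym; field.
by rewrite addrC natr1 pnatr_eq0 (gt_eqF NS0) (gt_eqF NB0).
Qed.

Local Notation eta := (q `^ (1 - 2 / p)).

Lemma sum_sel_h2 i j : \sum_o sel_h i o * sel_h j o = eta * (i == j)%:R.
Proof.
under eq_bigr do rewrite /sel_h mulrACA.
rewrite -mulr_sumr sum_radsel2 -powRD ?(gt_eqF q0) ?implybT//.
rewrite (_ : NS * NB / m = q `^ (-1)); last first.
  by rewrite powR_inv1 ?(ltW q0)// invfM invrK mulrC.
rewrite mulrA -powRD ?(gt_eqF q0) ?implybT//; congr (_ `^ _ * _).
by field; rewrite gt_eqF.
Qed.

Lemma sel_bessel z : \sum_i sel_coef z i ^+ 2 <= eta * \sum_o z o ^+ 2.
Proof.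
have e0 : 0 < eta by rewrite powR_gt0.
set X := \sum_i _.
pose H o := \sum_i sel_coef z i * sel_h i o.
have XE : X = \sum_o z o * H o.
  rewrite /X; under eq_bigr do rewrite expr2 {2}/sel_coef mulr_sumr.
  rewrite exchange_big/=; apply: eq_bigr => o _; rewrite mulr_sumr; apply: eq_bigr => i _.
  by rewrite mulrCA.
have HE : \sum_o H o ^+ 2 = eta * X.
  under eq_bigr do rewrite expr2 {1}/H mulr_suml.
  rewrite exchange_big/= mulr_sumr; apply: eq_bigr => i _.
  under eq_bigr do rewrite /H mulr_sumr.
  rewrite exchange_big/= (bigD1 i)//= [X in _ + X]big1 => [|j ji].
    rewrite addr0; under eq_bigr do rewrite mulrACA.
    by rewrite -mulr_sumr sum_sel_h2 eqxx mulr1 expr2 mulrC.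
  under eq_bigr do rewrite mulrACA.
  by rewrite -mulr_sumr sum_sel_h2 eq_sym (negbTE ji) !mulr0.
have : X <= \sum_o (eta * z o ^+ 2 + eta^-1 * H o ^+ 2) / 2.
  rewrite XE; apply: ler_sum => o _.
  have : 0 <= eta^-1 * (eta * z o - H o) ^+ 2 by rewrite mulr_ge0 ?sqr_ge0// invr_ge0 ltW.
  rewrite (_ : eta^-1 * (eta * z o - H o) ^+ 2 = eta * z o ^+ 2 + eta^-1 * H o ^+ 2 - 2 * (z o * H o)); first by lra.
  by field; rewrite gt_eqF.
rewrite -mulr_suml big_split/= -!mulr_sumr HE mulKf ?gt_eqF//; lra.
Qed.

(** Bessel's inequality for the orthogonal system [sel_h], followed by comparison of the 2-norm with
    the p-norm on a finite set; the normalising powers of q combine into the weight. *)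
Lemma sel_coef_l2 z :
  sel_w `^ p * (\sum_i sel_coef z i ^+ 2) `^ (p / 2) <= 2 `^ (p / 2) * lp_sum p z.
Proof.
have hp : 1 <= p / 2 by rewrite ler_pdivlMr// mul1r ltW.
have Nc : #|{: Om}|%:R = NS * NB by rewrite card_prod natrM.
have N0 : 0 < NS * NB by rewrite mulr_gt0.
have := @sum_powR_mean _ {: Om} (fun o => z o ^+ 2) (p / 2) hp (fun o => sqr_ge0 _).
rewrite -(ltr0n R) Nc => /(_ N0) h.
have zE o : (z o ^+ 2) `^ (p / 2) = `|z o| `^ p.
  rewrite -(real_normK (num_real (z o))) -(powR_mulrn 2 (normr_ge0 _)) -powRrM.
  by congr (_ `^ _); rewrite mulrC mulfVK// pnatr_eq0.
rewrite (eq_bigr _ (fun o _ => zE o)) in h.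
apply: le_trans h.
set Z := \sum_o z o ^+ 2.
have Z0 : 0 <= Z by apply: sumr_ge0 => o _; exact: sqr_ge0.
apply: le_trans (_ : sel_w `^ p * (eta * Z) `^ (p / 2) <= _).
  rewrite ler_wpM2l ?powR_ge0//; apply: ge0_ler_powR; rewrite ?nnegrE.
  - exact: (le_trans ler01 hp).
  - by apply: sumr_ge0 => i _; exact: sqr_ge0.
  - by rewrite mulr_ge0 ?powR_ge0.
  - exact: sel_bessel.
rewrite le_eqVlt; apply/orP; left; apply/eqP.
rewrite (powRM _ (powR_ge0 _ _) Z0) -powRrM; set x := (1 - 2 / p) * (p / 2).
have NNi : 0 <= (NS * NB)^-1 by rewrite invr_ge0 ltW.
rewrite (powRM _ Z0 NNi) (powRM x (ltW m0) NNi) -(powR_inv1 (ltW N0)) -!powRrM !mulN1r.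
have -> : (p^-1 - 2^-1) * p = - x by rewrite /x; field; rewrite gt_eqF.
have mx : m `^ (- x) * m `^ x = 1.
  by rewrite -powRD ?(gt_eqF m0) ?implybT// addNr powRr0.
have nx : (NS * NB) `^ (- x) = NS * NB * (NS * NB) `^ (- (p / 2)).
  rewrite -[X in _ = X * _](powRr1 (ltW N0)) -powRD ?(gt_eqF N0) ?implybT//.
  by congr (_ `^ _); rewrite /x; field; rewrite gt_eqF.
by rewrite mulrA mulrA mx mul1r nx mulrCA mulrA mulrC mulrA mulrA.
Qed.

(** For s <= 2 the second moment is enough: |x|^s <= Y^s + Y^(s-2) x^2 for every Y > 0, used with Y
    the square root of the sum of squares. *)
Lemma khinchine_upper_le2 (s : R) (a : 'I_n -> R) : 0 < s <= 2 ->
  \sum_(e : Sg) `|\sum_i a i * radem e i| `^ s <= 2 * NS * (\sum_i a i ^+ 2) `^ (s / 2).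
Proof.
move=> /andP[s0 s2]; set S := \sum_i a i ^+ 2.
have S0 : 0 <= S by apply: sumr_ge0 => i _; exact: sqr_ge0.
have [SE|Sn0] := eqVneq S 0.
  rewrite big1 ?mulr_ge0 ?powR_ge0// => e _.
  have a0 i : a i = 0.
    have /eqP := SE; rewrite psumr_eq0 => [/allP/(_ i)|j _]; last exact: sqr_ge0.
    by rewrite mem_index_enum sqrf_eq0 => /(_ isT)/eqP.
  by rewrite big1 ?normr0 ?powR0 ?gt_eqF// => i _; rewrite a0 mul0r.
have Sp : 0 < S by rewrite lt_neqAle eq_sym Sn0.
pose Y := S `^ 2^-1; have Y0 : 0 < Y by exact: powR_gt0.
have YS : Y `^ s = S `^ (s / 2) by rewrite /Y -powRrM mulrC.
have Y2 : Y `^ (s - 2) * S = S `^ (s / 2).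
  rewrite -[X in _ * X](powRr1 S0) /Y -powRrM -powRD ?(gt_eqF Sp) ?implybT//.
  by congr (_ `^ _); field.
apply: le_trans (_ : \sum_(e : Sg) (Y `^ s + Y `^ (s - 2) * (\sum_i a i * radem e i) ^+ 2) <= _).
  apply: ler_sum => e _; set x := \sum_i _.
  have [xY|xY] := leP `|x| Y.
    apply: le_trans (_ : Y `^ s <= _); last by rewrite lerDl mulr_ge0 ?powR_ge0 ?sqr_ge0.
    by apply: ge0_ler_powR; rewrite ?nnegrE// ltW.
  have x0 : 0 < `|x| by exact: lt_trans xY.
  apply: le_trans (_ : Y `^ (s - 2) * x ^+ 2 <= _); last by rewrite lerDr powR_ge0.
  rewrite -(real_normK (num_real x)) -(powR_mulrn 2 (normr_ge0 _)).
  rewrite (_ : `|x| `^ s = `|x| `^ (s - 2) * `|x| `^ 2%:R); last first.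
    by rewrite -powRD ?(gt_eqF x0) ?implybT//; congr (_ `^ _); lra.
  rewrite ler_wpM2r ?powR_ge0// (_ : s - 2 = - (2 - s)); last by lra.
  rewrite !powRN lef_pV2 ?posrE ?powR_gt0//.
  by apply: ge0_ler_powR; rewrite ?nnegrE ?subr_ge0// ltW.
rewrite big_split/= sumr_const -mulr_sumr sum_radem_sqr -/S mulrCA Y2 YS -mulr_natl; lra.
Qed.

(** Duality. Testing with a = sgn(Q z) |Q z|^(p-1) gives X as the pairing of z with a combination H
    of the [sel_h]. For the conjugate exponent s <= 2, Khinchine and subadditivity of the power s/2
    bound the s-sum of H by 2 X. Young's inequality with l^s = 4 then leaves X / 2 to be
    absorbed. *)
Lemma sel_coef_lp z : lp_sum p (sel_coef z) <= 2 * 4 `^ (p - 1) * lp_sum p z.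
Proof.
have h2 := p2; have p10 : 0 < p - 1 by lra.
pose s := p / (p - 1).
have s0 : 0 < s by rewrite divr_gt0.
have s2 : s <= 2 by rewrite /s ler_pdivrMr//; lra.
have ps : p^-1 + s^-1 = 1 by rewrite /s; field; rewrite !gt_eqF.
pose a i := Num.sg (sel_coef z i) * `|sel_coef z i| `^ (p - 1).
have aQ i : a i * sel_coef z i = `|sel_coef z i| `^ p.
  by rewrite /a mulrAC -normrEsg mulr_powRB1.
have aS i : `|a i| `^ s = `|sel_coef z i| `^ p.
  have -> : `|a i| = `|sel_coef z i| `^ (p - 1).
    rewrite /a normrM normr_sg; have [->|_] := eqVneq (sel_coef z i) 0.
      by rewrite mul0r normr0 powR0// gt_eqF.
    by rewrite mul1r ger0_norm// powR_ge0.
  by rewrite -powRrM; congr (_ `^ _); rewrite /s mulrC mulfVK// gt_eqF.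
set X := lp_sum p (sel_coef z); set Z := lp_sum p z.
pose H o := \sum_i a i * sel_h i o.
have XE : X = \sum_o z o * H o.
  rewrite /X /lp_sum; under eq_bigr do rewrite -aQ /sel_coef mulr_sumr.
  rewrite exchange_big/=; apply: eq_bigr => o _; rewrite mulr_sumr; apply: eq_bigr => i _.
  by rewrite mulrCA.
have HE : \sum_o `|H o| `^ s <= 2 * X.
  rewrite -(pair_bigA _ (fun e b => `|H (e, b)| `^ s))/= exchange_big/=.
  apply: le_trans (_ : \sum_(b : Bt) q * (2 * NS * \sum_i `|a i| `^ s * select b i) <= _).
    apply: ler_sum => b _.
    rewrite (eq_bigr (fun e : Sg => q * `|\sum_i (a i * select b i) * radem e i| `^ s)); last first.
      move=> e _; have -> : H (e, b) = q `^ (1 - p^-1) * \sum_i (a i * select b i) * radem e i.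
        rewrite mulr_sumr; apply: eq_bigr => i _; rewrite /sel_h /radsel/=; ring.
      rewrite normrM (powRM s (normr_ge0 _) (normr_ge0 _)) (ger0_norm (powR_ge0 _ _)) -powRrM; congr (_ * _).
      rewrite -[RHS](powRr1 (ltW q0)); congr (_ `^ _).
      by rewrite (_ : 1 - p^-1 = s^-1) ?mulVf ?gt_eqF//; lra.
    rewrite -mulr_sumr ler_wpM2l ?(ltW q0)//.
    apply: le_trans (khinchine_upper_le2 _ (introT andP (conj s0 s2))) _.
    rewrite ler_wpM2l ?mulr_ge0//.
    apply: le_trans (powR_sum_subadd _ _) _.
    - by apply/andP; split; lra.
    - by move=> i _; exact: sqr_ge0.
    apply: ler_sum => i _; rewrite /select; case: eqP => _.
      rewrite !mulr1 -(real_normK (num_real (a i))) -(powR_mulrn 2 (normr_ge0 _)) -powRrM.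
      by rewrite (mulrC 2%:R) mulfVK// pnatr_eq0.
    by rewrite !mulr0 expr0n powR0// mulf_neq0 ?gt_eqF ?invr_gt0.
  rewrite -mulr_sumr -mulr_sumr exchange_big/=.
  rewrite (eq_bigr (fun i => `|sel_coef z i| `^ p * (NB / m))); last first.
    move=> i _; rewrite -mulr_sumr aS; congr (_ * _).
    by rewrite -(sum_select1 (R := R) M i) mulrC mulKf// gt_eqF.
  rewrite -mulr_suml -/(lp_sum p (sel_coef z)) -/X le_eqVlt; apply/orP; left; apply/eqP; field.
  by rewrite addrC natr1 pnatr_eq0 (gt_eqF NS0) (gt_eqF NB0).
pose l := (4 : R) `^ s^-1.
have l0 : 0 < l by exact: powR_gt0.
have ls : l `^ s = 4 by rewrite /l -powRrM mulVf ?gt_eqF// powRr1.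
have lp : l `^ p = 4 `^ (p - 1).
  by rewrite /l -powRrM; congr (_ `^ _); rewrite /s; field; rewrite !gt_eqF.
have : X <= \sum_o (l `^ p * `|z o| `^ p + `|H o| `^ s / 4).
  rewrite XE; apply: ler_sum => o _; apply: le_trans (ler_norm _) _; rewrite normrM.
  have -> : `|z o| * `|H o| = (l * `|z o|) * (`|H o| / l) by field; rewrite gt_eqF.
  have lz0 : 0 <= l * `|z o| by rewrite mulr_ge0// ltW.
  have Hl0 : 0 <= `|H o| / l by rewrite divr_ge0// ltW.
  apply: le_trans (conjugate_powR lz0 Hl0 p0 s0 ps) _.
  apply: lerD.
    by rewrite powRM ?(ltW l0)// ler_pdivrMr// ler_peMr ?mulr_ge0 ?powR_ge0//; lra.
  rewrite powRM ?invr_ge0 ?(ltW l0)// -(powR_inv1 (ltW l0)) -powRrM mulN1r powRN ls.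
  rewrite ler_pdivrMr// ler_peMr ?divr_ge0 ?powR_ge0//.
  have : s^-1 <= 1 by have : 0 < p^-1 by [rewrite invr_gt0]; lra.
  by rewrite invf_le1.
rewrite big_split/= -mulr_sumr -mulr_suml lp -[\sum_o `|z o| `^ p]/Z; set Y := _ `^ (p - 1); lra.
Qed.

(** For fixed selectors Khinchine's inequality turns the signs into a power p/2 of a sum of selected
    squares; averaging over the selectors is Rosenthal's inequality with exponent p/2 > 1. *)
Lemma sum_sel_f (C : R) (a : 'I_n -> R) : 0 < C ->
  (forall x, `|x| `^ p <= C * (expR x + expR (- x))) ->
  lp_sum p (fun o => \sum_i a i * sel_f i o) <=
  2 * C * expR 2 * (2 `^ (p / 2) + (2 `^ (p / 2)) `^ (p / 2)) *
    (lp_sum p a + sel_w `^ p * (\sum_i a i ^+ 2) `^ (p / 2)).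
Proof.
move=> C0 hC; have h2 := p2; have s1 : 1 < p / 2 by lra.
set s := p / 2 in s1 *; have s0 : 0 < s by lra.
pose D := 2 * C * expR 2; have D0 : 0 < D by rewrite mulr_gt0 ?expR_gt0// mulr_gt0.
have aE i : (a i ^+ 2) `^ s = `|a i| `^ p.
  rewrite -(real_normK (num_real (a i))) -(powR_mulrn 2 (normr_ge0 _)) -powRrM.
  by congr (_ `^ _); rewrite /s mulrC mulfVK// pnatr_eq0.
have A0 : 0 <= \sum_i a i ^+ 2 by apply: sumr_ge0 => i _; exact: sqr_ge0.
have P0 : 0 <= lp_sum p a by apply: sumr_ge0 => i _; exact: powR_ge0.
have -> : lp_sum p (fun o => \sum_i a i * sel_f i o) =
    q * \sum_(b : Bt) \sum_(e : Sg) `|\sum_i (a i * select b i) * radem e i| `^ p.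
  rewrite /lp_sum -(pair_bigA _ (fun e b => `|\sum_i a i * sel_f i (e, b)| `^ p))/= exchange_big/=.
  rewrite mulr_sumr; apply: eq_bigr => b _; rewrite mulr_sumr; apply: eq_bigr => e _.
  have -> : \sum_i a i * sel_f i (e, b) = q `^ p^-1 * \sum_i (a i * select b i) * radem e i.
    rewrite mulr_sumr; apply: eq_bigr => i _; rewrite /sel_f /radsel/=; ring.
  by rewrite normrM (powRM p (normr_ge0 _) (normr_ge0 _)) (ger0_norm (powR_ge0 _ _)) -powRrM mulVf ?gt_eqF// powRr1// ltW.
apply: le_trans (_ : q * \sum_(b : Bt) D * NS * (\sum_i a i ^+ 2 * select b i) `^ s <= _).
  rewrite ler_wpM2l ?(ltW q0)//; apply: ler_sum => b _.
  apply: le_trans (khinchine_upper p0 C0 hC _) _; rewrite -/D -/s.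
  rewrite (eq_bigr (fun i => a i ^+ 2 * select b i))// => i _.
  by rewrite exprMn; congr (_ * _); rewrite expr2 select_idem.
rewrite -mulr_sumr.
apply: le_trans (_ : q * (D * NS * (NB * (2 `^ s * lp_sum p a / m + (2 `^ s * (\sum_i a i ^+ 2) / m) `^ s))) <= _).
  rewrite ler_wpM2l ?(ltW q0)// ler_wpM2l ?(mulr_ge0 (ltW D0) (ltW NS0))//.
  apply: le_trans (rosenthal_select M s1 (fun i => sqr_ge0 (a i))) _.
  by under eq_bigr do rewrite aE.
have wE : sel_w `^ p = m * m `^ (- s).
  rewrite /sel_w -powRrM.
  have -> : m * m `^ (- s) = m `^ (1 - s).
    by rewrite powRD ?(gt_eqF m0) ?implybT// powRr1// ltW.
  by congr (_ `^ _); rewrite /s; field; rewrite gt_eqF.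
rewrite (_ : (2 `^ s * (\sum_i a i ^+ 2) / m) `^ s = (2 `^ s) `^ s * (\sum_i a i ^+ 2) `^ s * m `^ (- s)); last first.
  rewrite powRM ?invr_ge0 ?mulr_ge0 ?powR_ge0 ?(ltW m0)// powRM ?powR_ge0//.
  by congr (_ * _); rewrite -(powR_inv1 (ltW m0)) -powRrM mulN1r.
rewrite wE; set a2 := (\sum_i a i ^+ 2) `^ s; set b2 := (2 `^ s) `^ s; set P := lp_sum p a; set t2 := 2 `^ s.
have a20 : 0 <= a2 by exact: powR_ge0.
have b20 : 0 <= b2 by exact: powR_ge0.
have t20 : 0 <= t2 by exact: powR_ge0.
have ms0 : 0 <= m * m `^ (- s) by rewrite mulr_ge0 ?powR_ge0.
rewrite (_ : q * _ = D * (t2 * P + b2 * (m * m `^ (- s) * a2))); last first.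
  field.
  by rewrite addrC natr1 pnatr_eq0 (gt_eqF NS0) (gt_eqF NB0).
rewrite -[leRHS]mulrA ler_wpM2l ?(ltW D0)//.
have := mulr_ge0 t20 (mulr_ge0 ms0 a20); have := mulr_ge0 b20 P0.
by rewrite -/P; lra.
Qed.

Lemma sum_radem_lower (a : 'I_n -> R) :
  NS * (\sum_i a i ^+ 2) `^ (p / 2) <= 2 `^ (p / 2) * \sum_(e : Sg) `|\sum_i a i * radem e i| `^ p.
Proof.
have h2 := p2; have hp : 1 <= p / 2 by lra.
have NSn : (0 < #|{: Sg}|)%N by rewrite -(ltr0n R).
have := @sum_powR_mean _ {: Sg} (fun e => (\sum_i a i * radem e i) ^+ 2) (p / 2) hp (fun e => sqr_ge0 _) NSn.
rewrite sum_radem_sqr [X in X `^ _]mulrC mulKf ?gt_eqF//.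
move=> /le_trans; apply; rewrite ler_wpM2l ?powR_ge0//; apply: ler_sum => e _.
rewrite -(real_normK (num_real (\sum_i _))) -(powR_mulrn 2 (normr_ge0 _)) -powRrM.
by rewrite (mulrC 2%:R) mulfVK// pnatr_eq0.
Qed.

End selector_system.

(** * Bad embeddings for p > 2 *)

Section bad_embeddings_gt2.
Context {R : realType}.

Lemma mx_app_lin (I J : finType) (T : J -> I -> R) (K : finType) (a : K -> R) (x : K -> I -> R) j :
  mx_app T (fun i => \sum_l a l * x l i) j = \sum_l a l * mx_app T (x l) j.
Proof.
rewrite /mx_app; under eq_bigr do rewrite mulr_sumr.
rewrite exchange_big/=; apply: eq_bigr => l _; rewrite mulr_sumr; apply: eq_bigr => i _.
by rewrite mulrCA.
Qed.

Lemma sqr_sum_le (I : finType) (x : I -> R) :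
  (\sum_i x i) ^+ 2 <= #|I|%:R * \sum_i x i ^+ 2.
Proof.
have [I0|I0] := posnP #|I|.
  by rewrite big_pred0 ?expr0n/= ?I0 ?mul0r// => i; have := card0_eq I0 i; rewrite !inE.
have N0 : 0 < #|I|%:R :> R by rewrite ltr0n.
set N : R := #|I|%:R; set S := \sum_i x i; set Q := \sum_i x i ^+ 2.
have : 0 <= \sum_i (x i - S / N) ^+ 2 by apply: sumr_ge0 => i _; exact: sqr_ge0.
rewrite (eq_bigr (fun i => x i ^+ 2 + - (2 * (S / N)) * x i + (S / N) ^+ 2)); last by move=> i _; ring.
rewrite !big_split/= -mulr_sumr sumr_const -/S -/Q -(mulr_natr ((S / N) ^+ 2)) -/N.
rewrite (_ : Q + - (2 * (S / N)) * S + (S / N) ^+ 2 * N = (N * Q - S ^+ 2) / N); last first.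
  by field; rewrite gt_eqF.
by rewrite pmulr_lge0 ?invr_gt0// subr_ge0.
Qed.

Variable (p : R).
Hypothesis p2 : 2 < p.
Variables (n M : nat).
Local Notation Sg := {ffun 'I_n -> bool}.
Local Notation Bt := {ffun 'I_n -> 'I_M.+1}.
Local Notation Om := ({ffun 'I_n -> bool} * {ffun 'I_n -> 'I_M.+1})%type.
Local Notation NS := (#|{: {ffun 'I_n -> bool}}|%:R : R).
Local Notation Q := (@sel_coef R p n M).
Local Notation w := (@sel_w R p M).

Let p0 : 0 < p. Proof. by apply: lt_trans p2. Qed.
Let NS0 : 0 < NS. Proof. by rewrite ltr0n; apply/card_gt0P; exists [ffun=> true]. Qed.

Definition sel_proj (z : Om -> R) (o : Om) := \sum_i Q z i * sel_f p i o.

(* [z |-> (z - P z, Q z, w (Q z . r))]: the projection onto the span of the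
   [sel_f] is replaced by the diagonal map into l_p^n + l_2^n, the second
   summand being spanned by Rademacher functions. *)
Definition sel_op (j : Om + ('I_n + {ffun 'I_n -> bool})) (o : Om) : R :=
  match j with
  | inl o' => (o' == o)%:R - \sum_i sel_f p i o' * sel_h p i o
  | inr (inl i) => sel_h p i o
  | inr (inr e) => w * NS `^ (- p^-1) * \sum_i radem e i * sel_h p i o
  end.

Lemma sel_op_inl z o : mx_app sel_op z (inl o) = z o - sel_proj z o.
Proof.
rewrite /mx_app /=; under eq_bigr do rewrite mulrBl.
rewrite sumrB; congr (_ - _).
  by rewrite (bigD1 o)//= eqxx mul1r big1 ?addr0// => o' /negbTE; rewrite eq_sym => ->; rewrite mul0r.
under eq_bigr do rewrite mulr_suml.
rewrite exchange_big/=; apply: eq_bigr => i _; rewrite mulr_suml; apply: eq_bigr => o' _.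
by ring.
Qed.

Lemma sel_op_inrl z i : mx_app sel_op z (inr (inl i)) = Q z i.
Proof. by apply: eq_bigr => o _; rewrite mulrC. Qed.

Lemma sel_op_inrr z e :
  mx_app sel_op z (inr (inr e)) = w * NS `^ (- p^-1) * \sum_i Q z i * radem e i.
Proof.
rewrite /mx_app /=; under eq_bigr do rewrite -mulrA mulr_suml.
rewrite -mulr_sumr exchange_big/=; congr (_ * _); apply: eq_bigr => i _.
by rewrite mulr_suml; apply: eq_bigr => o _; ring.
Qed.

Lemma lp_sum_sel_op z : lp_sum p (mx_app sel_op z) =
  lp_sum p (fun o => z o - sel_proj z o) + lp_sum p (Q z) +
  w `^ p * (NS^-1 * \sum_(e : Sg) `|\sum_i Q z i * radem e i| `^ p).
Proof.
rewrite /lp_sum !big_sumType/= -addrA; congr (_ + (_ + _)).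
- by apply: eq_bigr => o _; rewrite sel_op_inl.
- by apply: eq_bigr => o _; rewrite sel_op_inrl.
rewrite mulrA mulr_sumr; apply: eq_bigr => e _; rewrite sel_op_inrr normrM.
have h : 0 <= w * NS `^ (- p^-1) by rewrite mulr_ge0 ?powR_ge0.
rewrite (powRM p (normr_ge0 _) (normr_ge0 _)) (ger0_norm h) (powRM p (powR_ge0 _ _) (powR_ge0 _ _)).
by rewrite -[X in _ * X * _]powRrM mulNr mulVf ?gt_eqF// powR_inv1 ?(ltW NS0).
Qed.

Lemma lp_sum_ge0 (I : finType) (x : I -> R) : 0 <= lp_sum p x.
Proof. by apply: sumr_ge0 => i _; exact: powR_ge0. Qed.

Lemma lp_sum_add (I : finType) (x y : I -> R) :
  lp_sum p (fun i => x i + y i) <= 2 `^ p * (lp_sum p x + lp_sum p y).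
Proof.
by rewrite /lp_sum -big_split/= mulr_sumr; apply: ler_sum => i _; exact: powR_normD.
Qed.

Variable C : R.
Hypothesis C0 : 0 < C.
Hypothesis hC : forall x, `|x| `^ p <= C * (expR x + expR (- x)).
Local Notation t := (2 `^ (p / 2) : R).
Local Notation Ca := (2 * 4 `^ (p - 1) : R).
Local Notation Cf := (2 * C * expR 2 * (t + t `^ (p / 2))).

Let Cf0 : 0 < Cf.
Proof. by rewrite mulr_gt0 ?addr_gt0 ?powR_gt0// ?mulr_gt0 ?expR_gt0 ?powR_gt0//. Qed.

Lemma sel_op_upper z : lp_sum p (mx_app sel_op z) <=
  (2 `^ p * (1 + Cf * (Ca + t)) + Ca + 2 * C * expR 2 * t) * lp_sum p z.
Proof.
rewrite lp_sum_sel_op.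
have hQ := @sel_coef_lp R p n M p2 z; have hl := @sel_coef_l2 R p n M p2 z.
have hP := @sum_sel_f R p n M p2 C (Q z) C0 hC.
have hk := @khinchine_upper R n p C p0 C0 hC (Q z).
set Z := lp_sum p z in hQ hl *; set q := lp_sum p (Q z) in hQ hP *.
set A := _ `^ (p / 2) in hl hP hk; set W := w `^ p in hl hP *.
have W0 : 0 <= W by exact: powR_ge0.
have h1 : lp_sum p (fun o => z o - sel_proj z o) <= 2 `^ p * (Z + Cf * (Ca * Z + t * Z)).
  apply: le_trans (lp_sum_add z (fun o => - sel_proj z o)) _.
  rewrite ler_wpM2l ?powR_ge0// lerD2l.
  have -> : lp_sum p (fun o => - sel_proj z o) = lp_sum p (sel_proj z).
    by apply: eq_bigr => o _; rewrite normrN.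
  by apply: le_trans hP _; rewrite ler_wpM2l ?(ltW Cf0)// lerD.
have h3 : W * (NS^-1 * \sum_(e : Sg) `|\sum_i Q z i * radem e i| `^ p) <= 2 * C * expR 2 * (t * Z).
  apply: le_trans (_ : W * (2 * C * expR 2 * A) <= _).
    rewrite ler_wpM2l// mulrC ler_pdivrMr//; apply: le_trans hk _.
    by rewrite le_eqVlt; apply/orP; left; apply/eqP; ring.
  by rewrite mulrCA ler_wpM2l// !mulr_ge0 ?expR_ge0// ltW.
move: h1 hQ h3; set X1 := lp_sum p _; set X3 := W * _ => h1 hQ h3.
apply: le_trans (lerD (lerD h1 hQ) h3) _.
by rewrite le_eqVlt; apply/orP; left; apply/eqP; ring.
Qed.

(** z is recovered as (z - P z) + P z, and P z is controlled by its coefficients: their p-sum is a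
    summand of the image, their weighted 2-norm is dominated by the Rademacher summand through
    [sum_radem_lower]. *)
Lemma sel_op_lower z : lp_sum p z <=
  2 `^ p * (1 + Cf * (1 + t)) * lp_sum p (mx_app sel_op z).
Proof.
rewrite lp_sum_sel_op.
have hP := @sum_sel_f R p n M p2 C (Q z) C0 hC.
have hl := @sum_radem_lower R p n p2 (Q z).
have t0 : 0 < t by exact: powR_gt0.
set q := lp_sum p (Q z) in hP *.
set A := _ `^ (p / 2) in hl hP; set W := w `^ p in hP *.
set X1 := lp_sum p (fun o => z o - sel_proj z o); set X3 := W * _.
have W0 : 0 <= W by exact: powR_ge0.
have X10 : 0 <= X1 by exact: lp_sum_ge0.
have q0 : 0 <= q by exact: lp_sum_ge0.
have h3 : W * A <= t * X3.
  rewrite /X3 mulrCA ler_wpM2l// mulrCA mulrC ler_pdivlMr// mulrC.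
  exact: hl.
have X30 : 0 <= X3 by rewrite -(pmulr_rge0 _ t0); apply: le_trans h3; rewrite mulr_ge0// powR_ge0.
have -> : lp_sum p z = lp_sum p (fun o => (z o - sel_proj z o) + sel_proj z o).
  by apply: eq_bigr => o _; rewrite subrK.
apply: le_trans (lp_sum_add _ _) _; rewrite -mulrA ler_wpM2l ?powR_ge0// -/X1.
have {}hP : lp_sum p (sel_proj z) <= Cf * (q + t * X3).
  by apply: le_trans hP _; rewrite ler_wpM2l ?(ltW Cf0)// lerD2l.
have hh : 0 <= Cf * (t * (X1 + q) + X1 + X3).
  by rewrite mulr_ge0 ?(ltW Cf0)// !addr_ge0// mulr_ge0 ?addr_ge0// ltW.
apply: le_trans (lerD (lexx _) hP) _.
have -> : (1 + Cf * (1 + t)) * (X1 + q + X3) = X1 + Cf * (q + t * X3) + (q + X3 + Cf * (t * (X1 + q) + X1 + X3)) by ring.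
by rewrite lerDl !addr_ge0.
Qed.

(** [sel_op] splits each [sel_f] into a unit vector of l_p^n and a weighted Rademacher function, so
    the coefficient 1 that S has to return is the sum of two parts. The Rademacher part is at most w
    times the norm of S, up to a constant. The other part is small on average over l: after random
    signs, S acts on a vector of p-sum n, and Cauchy-Schwarz with [sel_coef_l2] bounds the trace by
    n^(1/2 + 1/p) / w times the norm of S, up to the factor 2. For n = (M + 1)^2 one has n^(1/p -
    1/2) = w^2, so this is n w. Both parts together force the norm of S to be of order at least 1 /
    w. *)
Lemma sel_op_left_inverse (S : Om -> (Om + ('I_n + {ffun 'I_n -> bool})) -> R) (K : R) :
  n = (M.+1 ^ 2)%N -> 
  (forall x, mx_app S (mx_app sel_op x) =1 x) ->
  (forall y, lp_sum p (mx_app S y) <= K * lp_sum p y) ->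
  (w * (2 + Ca)) `^ (- p) <= K.
Proof.
clear Cf0 hC C0 C; have h2 := p2; have hp2 : 0 < p / 2 by lra.
have hp1 : 1 <= p by lra.
have hpp : p / 2 <= p by lra.
move=> nM hS hK.
have m0 : 0 < M.+1%:R :> R by [].
have w0 : 0 < w by exact: powR_gt0.
have n0 : 0 < n%:R :> R by rewrite nM ltr0n expn_gt0.
pose J := (Om + ('I_n + {ffun 'I_n -> bool}))%type.
pose y1 (l : 'I_n) (j : J) : R := if j is inr (inl i) then (i == l)%:R else 0.
pose y2 (l : 'I_n) (j : J) : R := if j is inr (inr e) then radem e l else 0.
have lp0 : 0 `^ p = 0 by rewrite powR0// gt_eqF.
have ly2 l : lp_sum p (y2 l) = NS.
  rewrite /lp_sum !big_sumType/= big1 ?add0r => [|o _]; last by rewrite normr0.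
  rewrite big1 ?add0r => [|o _]; last by rewrite normr0.
  by under eq_bigr do rewrite normr_radem powR1; rewrite sumr_const.
have K0 : 0 <= K.
  have n1 : (0 < n)%N by rewrite -(ltr0n R).
  have := hK (y2 (Ordinal n1)); rewrite ly2 => h.
  by rewrite -(pmulr_lge0 _ NS0); apply: le_trans h; exact: lp_sum_ge0.
pose k := K `^ p^-1.
have kp : k `^ p = K by rewrite /k -powRrM mulVf ?gt_eqF// powRr1.
have k0 : 0 <= k by exact: powR_ge0.
have Ca1 : 1 <= Ca.
  have : 4 `^ 0 <= 4 `^ (p - 1) :> R by apply: ler_powR; lra.
  by rewrite powRr0; lra.
pose u l := mx_app S (y1 l); pose v l := mx_app S (y2 l).
have w'E : (w * NS `^ (- p^-1)) `^ p * NS = w `^ p.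
  rewrite (powRM p (powR_ge0 _ _) (powR_ge0 _ _)) -[X in _ * X * _]powRrM mulNr mulVf ?gt_eqF//.
  by rewrite powR_inv1 ?(ltW NS0)// mulfVK// gt_eqF.
have one l : 1 = Q (u l) l + w * NS `^ (- p^-1) * Q (v l) l.
  have -> : w * NS `^ (- p^-1) * Q (v l) l = Q (fun o => w * NS `^ (- p^-1) * v l o) l.
    by rewrite /sel_coef mulr_sumr; apply: eq_bigr => o _; rewrite mulrA.
  transitivity (Q (sel_f p l) l); first by rewrite sel_coef_f eqxx.
  rewrite /sel_coef -big_split/=.
  apply: eq_bigr => o _; rewrite -mulrDl; congr (_ * _).
  rewrite -(hS (sel_f p l) o) /u /v /mx_app mulr_sumr -big_split/=.
  apply: eq_bigr => j _; rewrite mulrCA -mulrDr; congr (_ * _).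
  rewrite -/(mx_app sel_op (sel_f p l) j); move: j; case; last case.
  - move=> o1; rewrite sel_op_inl /y1 /y2 mulr0 addr0 /sel_proj (bigD1 l)//= sel_coef_f// eqxx mul1r big1 ?addr0 ?subrr// => i il.
    by rewrite sel_coef_f// (negbTE il) mul0r.
  - by move=> i; rewrite sel_op_inrl /y1 /y2 mulr0 addr0 sel_coef_f.
  - move=> e; rewrite sel_op_inrr /y1 /y2 add0r; congr (_ * _); rewrite (bigD1 l)//= sel_coef_f// eqxx mul1r big1 ?addr0// => i il.
    by rewrite sel_coef_f// (negbTE il) mul0r.
have hv l : w * NS `^ (- p^-1) * Q (v l) l <= w * (Ca * k).
  apply: le_trans (ler_norm _) _; rewrite leNgt; apply/negP => hlt.
  have wk0 : 0 <= w * (Ca * k) by rewrite !mulr_ge0 ?powR_ge0.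
  have := gt0_ltr_powR p0 _ _ hlt; rewrite !nnegrE => /(_ wk0 (normr_ge0 _)); apply/negP; rewrite -leNgt.
  have wn0 : 0 <= w * NS `^ (- p^-1) by rewrite mulr_ge0 ?powR_ge0.
  rewrite normrM (ger0_norm wn0) (powRM p wn0 (normr_ge0 _)).
  have Cak0 : 0 <= Ca * k by rewrite !mulr_ge0 ?powR_ge0.
  rewrite (powRM p (ltW w0) Cak0) -w'E -mulrA ler_wpM2l ?powR_ge0//.
  have Ca0 : 0 <= Ca by rewrite mulr_ge0 ?powR_ge0.
  rewrite (powRM p Ca0 k0) kp.
  apply: le_trans (_ : lp_sum p (Q (v l)) <= _).
    by rewrite /lp_sum (bigD1 l)//= lerDl sumr_ge0// => i _; exact: powR_ge0.
  apply: le_trans (sel_coef_lp p2 _) _.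
  apply: le_trans (ler_wpM2l Ca0 (hK (y2 l))) _; rewrite ly2.
  rewrite [leLHS]mulrA [leLHS]mulrC ler_wpM2l ?(ltW NS0)// ler_wpM2r//.
  by rewrite -[leLHS](powRr1 Ca0); apply: ler_powR.
have hu : \sum_l Q (u l) l <= n%:R * (2 * w * k).
  rewrite -(ler_pM2l NS0).
  pose Y (e : Sg) (j : J) := \sum_l radem e l * y1 l j.
  have lY e : lp_sum p (Y e) = n%:R.
    rewrite /lp_sum !big_sumType/= big1 ?add0r => [|o _]; last first.
      by rewrite /Y big1 ?normr0// => l _; rewrite mulr0.
    rewrite [X in _ + X]big1 ?addr0 => [|o _]; last first.
      by rewrite /Y big1 ?normr0// => l _; rewrite mulr0.
    rewrite (eq_bigr (fun=> 1)); first by rewrite sumr_const card_ord.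
    move=> i _; rewrite /Y (bigD1 i)//= eqxx mulr1 big1 ?addr0 ?normr_radem ?powR1// => l li.
    by rewrite eq_sym (negbTE li) mulr0.
  have -> : NS * \sum_l Q (u l) l = \sum_(e : Sg) \sum_i radem e i * Q (mx_app S (Y e)) i.
    have QY e i : Q (mx_app S (Y e)) i = \sum_l radem e l * Q (u l) i.
      rewrite /sel_coef; under eq_bigr do rewrite (mx_app_lin S (radem e) y1) mulr_suml.
      rewrite exchange_big/=; apply: eq_bigr => l _; rewrite mulr_sumr; apply: eq_bigr => o _.
      by rewrite mulrA.
    under [RHS]eq_bigr do under eq_bigr do rewrite QY mulr_sumr.
    rewrite [RHS]exchange_big/= mulr_sumr; apply: eq_bigr => l _.
    rewrite [RHS]exchange_big/= (bigD1 l)//= [X in _ + X]big1 => [|i il].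
      rewrite addr0; under eq_bigr do rewrite mulrA.
      by rewrite -mulr_suml sum_radem2 eqxx muln1.
    under eq_bigr do rewrite mulrA.
    by rewrite -mulr_suml sum_radem2 eq_sym (negbTE il) muln0 mul0r.
  have -> : NS * (n%:R * (2 * w * k)) = \sum_(e : Sg) n%:R * (2 * w * k) by rewrite sumr_const mulr_natl.
  apply: ler_sum => e _.
  have B0 : 0 <= n%:R * (2 * w * k) by rewrite !mulr_ge0// ltW.
  set X := \sum_i _; apply: le_trans (ler_norm X) _.
  rewrite -[leRHS]ger0_norm// -ler_sqr ?nnegrE// !real_normK ?num_real//.
  set z := mx_app S (Y e) in X *.
  apply: le_trans (sqr_sum_le _) _; rewrite card_ord.
  rewrite (eq_bigr (fun i => Q z i ^+ 2)); last first.
    by move=> i _; rewrite exprMn [radem e i ^+ 2]expr2 radem_sqr mul1r.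
  rewrite exprMn [n%:R ^+ 2]expr2 -mulrA ler_wpM2l ?(ltW n0)//.
  set q := \sum_i _; rewrite leNgt; apply/negP => hlt.
  have q0 : 0 <= q by apply: sumr_ge0 => i _; exact: sqr_ge0.
  have nB0 : 0 <= n%:R * (2 * w * k) ^+ 2 by rewrite mulr_ge0 ?sqr_ge0// ltW.
  have := gt0_ltr_powR hp2 _ _ hlt; rewrite !nnegrE => /(_ nB0 q0); apply/negP; rewrite -leNgt.
  have wp0 : 0 < w `^ p by exact: powR_gt0.
  rewrite -(ler_pM2l wp0); apply: le_trans (sel_coef_l2 p2 z) _.
  apply: le_trans (ler_wpM2l (powR_ge0 _ _) (hK (Y e))) _; rewrite lY.
  have wk0 : 0 <= 2 * w * k by rewrite !mulr_ge0// ltW.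
  rewrite (powRM _ (ltW n0) (sqr_ge0 _)) -(powR_mulrn 2 wk0) -(powRrM (2 * w * k) 2%:R (p / 2)) (_ : 2%:R * (p / 2) = p); last by field.
  have w20 : 0 <= 2 * w by rewrite mulr_ge0// ltW.
  rewrite (powRM p w20 k0) (powRM p (ler0n R 2) (ltW w0)) kp.
  have nw : w `^ p * n%:R `^ (p / 2) * w `^ p = n%:R.
    have -> : n%:R = M.+1%:R `^ 2%:R :> R by rewrite powR_mulrn// nM natrX.
    rewrite /sel_w -!powRrM mulrAC -!powRD ?(gt_eqF m0) ?implybT//.
    by congr (_ `^ _); field; rewrite gt_eqF.
  have -> : w `^ p * (n%:R `^ (p / 2) * (2 `^ p * w `^ p * K)) =
    (w `^ p * n%:R `^ (p / 2) * w `^ p) * (2 `^ p * K) by ring.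
  rewrite nw mulrCA mulrC mulrA ler_wpM2r//.
  by rewrite mulrC ler_wpM2l ?(ltW n0)//; apply: ler_powR; rewrite ?ler1n.
have main : 1 <= w * (2 + Ca) * k.
  have : n%:R <= n%:R * (2 * w * k) + n%:R * (w * (Ca * k)).
    have {1}-> : n%:R = \sum_(l < n) 1 :> R by rewrite sumr_const card_ord.
    rewrite (eq_bigr _ (fun l _ => one l)) big_split/= lerD//.
    have -> : n%:R * (w * (Ca * k)) = \sum_(l < n) (w * (Ca * k)) by rewrite sumr_const card_ord mulr_natl.
    by apply: ler_sum => l _; exact: hv.
  rewrite -mulrDr -[leLHS]mulr1 ler_pM2l// (_ : _ + _ = w * (2 + Ca) * k)//; ring.
have wC0 : 0 < w * (2 + Ca) by rewrite mulr_gt0//; lra.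
rewrite powRN -div1r ler_pdivrMr ?powR_gt0// -kp -(powRM p k0 (ltW wC0)).
apply: le_trans (_ : 1 `^ p <= _); first by rewrite powR1.
by apply: ge0_ler_powR; rewrite ?nnegrE ?(ltW p0) ?(mulr_ge0 k0 (ltW wC0))// mulrC.
Qed.

End bad_embeddings_gt2.

Theorem bad_embeddings_gt2 {R : realType} (p : R) : 2 < p -> bad_embeddings p.
Proof.
move=> p2; have p0 : 0 < p by apply: lt_trans p2.
have [C C0 hC] := powR_le_expR (ltW p0).
pose t : R := 2 `^ (p / 2); pose Ca : R := 2 * 4 `^ (p - 1).
pose Cf := 2 * C * expR 2 * (t + t `^ (p / 2)).
have Cf0 : 0 < Cf by rewrite mulr_gt0 ?addr_gt0 ?powR_gt0// ?mulr_gt0 ?expR_gt0 ?powR_gt0//.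
have t0 : 0 < t by exact: powR_gt0.
have Ca0 : 0 < Ca by rewrite mulr_gt0 ?powR_gt0.
have D0 : 0 < 2 `^ p * (1 + Cf * (1 + t)) by rewrite mulr_gt0 ?powR_gt0// addr_gt0// mulr_gt0// addr_gt0.
exists (2 `^ p * (1 + Cf * (1 + t)))^-1, (2 `^ p * (1 + Cf * (Ca + t)) + Ca + 2 * C * expR 2 * t).
split; first by rewrite invr_gt0.
  rewrite !addr_gt0// ?mulr_gt0 ?expR_gt0 ?powR_gt0// addr_gt0// mulr_gt0// addr_gt0//.
move=> K.
have q0 : 0 < p / 2 - 1 by lra.
(* Since w^-p is (M + 1)^(p/2 - 1), M is taken large enough for that power to exceed |K| (2 +
   Ca)^p. *)
pose X := (`|K| * (2 + Ca) `^ p) `^ (p / 2 - 1)^-1.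
pose M := Num.truncn X.
have XM : X <= M.+1%:R by rewrite ltW// truncnS_gt.
pose n := (M.+1 ^ 2)%N.
exists ({ffun 'I_n -> bool} * {ffun 'I_n -> 'I_M.+1})%type,
  (({ffun 'I_n -> bool} * {ffun 'I_n -> 'I_M.+1}) + ('I_n + {ffun 'I_n -> bool}))%type,
  (@sel_op R p n M).
split.
- by move=> x; rewrite mulrC ler_pdivrMr// mulrC; exact: sel_op_lower.
- by move=> x; exact: sel_op_upper.
move=> S K' hS hK; apply: (@le_trans _ _ ((sel_w p M * (2 + Ca)) `^ (- p))); last first.
  exact: (@sel_op_left_inverse R p p2 n M S K' erefl hS hK).
apply: le_trans (ler_norm K) _.
have Ca2 : 0 < 2 + Ca by lra.
rewrite (powRM _ (powR_ge0 _ _) (ltW Ca2)) [X in _ <= _ * X]powRN ler_pdivlMr ?powR_gt0//.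
rewrite /sel_w -powRrM (_ : (p^-1 - 2^-1) * - p = p / 2 - 1); last by field; rewrite gt_eqF.
have -> : `|K| * (2 + Ca) `^ p = X `^ (p / 2 - 1).
  by rewrite /X -powRrM mulVf ?gt_eqF// powRr1// mulr_ge0 ?powR_ge0.
by apply: ge0_ler_powR; rewrite ?nnegrE ?powR_ge0 ?(ltW q0).
Qed.

(** * Sequence spaces and block operators *)

Section lps.
Context {R : realType} (p : R).
Hypothesis p0 : 0 < p.

(** The p-th power of the l_p norm, infinite off l_p. The index type is arbitrary so that blocks can
    be addressed by sums and products. *)
Definition lps (T : choiceType) (x : T -> R) : \bar R :=
  (\esum_(i in [set: T]) (`|x i| `^ p)%:E)%E.

Lemma lps_ge0 (T : choiceType) (x : T -> R) : (0 <= lps x)%E.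
Proof. by apply: esum_ge0 => i _; rewrite lee_fin powR_ge0. Qed.

Lemma lps_coord (T : choiceType) (x : T -> R) i : ((`|x i| `^ p)%:E <= lps x)%E.
Proof.
apply: esum_ge; exists [set i]; first by split.
by rewrite fsbig_set1.
Qed.

Lemma eq_lps (T : choiceType) (x y : T -> R) : x =1 y -> lps x = lps y.
Proof. by move=> xy; apply: eq_esum => i _; rewrite xy. Qed.

Lemma lps0 (T : choiceType) : lps (fun _ : T => 0) = 0%E.
Proof. by apply: esum1 => i _; rewrite normr0 powR0// gt_eqF. Qed.

Lemma le_esumZ (T : choiceType) (a b : T -> \bar R) (K : R) : 0 <= K ->
  (forall i, 0 <= b i)%E -> (forall i, a i <= K%:E * b i)%E ->
  (\esum_(i in [set: T]) a i <= K%:E * \esum_(i in [set: T]) b i)%E.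
Proof.
move=> K0 b0 ab; apply: ge_ereal_sup => _ [X [fX _]] <-.
apply: le_trans (_ : (\sum_(i \in X) K%:E * b i <= _)%E).
  by apply: lee_fsum => // i _.
rewrite -ge0_mule_fsumr// lee_wpmul2l// ?lee_fin//.
by apply: ereal_sup_ubound; exists X.
Qed.

Lemma lps_add (T : choiceType) (x y : T -> R) :
  (lps (fun i => (x i + y i)%R) <= (2 `^ p)%:E * (lps x + lps y))%E.
Proof.
rewrite /lps -esumD => [| i _|i _]; rewrite ?lee_fin ?powR_ge0//.
apply: le_esumZ; rewrite ?powR_ge0// => i; first by rewrite -EFinD lee_fin addr_ge0 ?powR_ge0.
by rewrite -EFinD -EFinM lee_fin; exact: powR_normD.
Qed.

Lemma lps_reindex (T T' : choiceType) (e : T -> T') (x : T' -> R) :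
  bijective e -> lps (fun i => x (e i)) = lps x.
Proof.
move=> [e' eK e'K]; rewrite /lps (reindex_esum [set: T] _ e)//; split=> //.
  by move=> a b _ _ /(can_inj eK).
by move=> a _; exists (e' a).
Qed.

Lemma lps_inj (T T' : choiceType) (e : T -> T') (x : T' -> R) : injective e ->
  lps x = (lps (fun i => x (e i)) + \esum_(i in ~` range e) (`|x i| `^ p)%:E)%E.
Proof.
move=> ei; rewrite /lps (esumID (range e)) => [|i _]; last by rewrite lee_fin powR_ge0.
rewrite !setTI; by congr (_ + _)%E; rewrite esum_image// => a b _ _ /ei.
Qed.

Lemma lps_inj_le (T T' : choiceType) (e : T -> T') (x : T' -> R) : injective e ->
  (lps (fun i => x (e i)) <= lps x)%E.
Proof.
move=> ei; rewrite (lps_inj x ei) leeDl//; apply: esum_ge0 => i _.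
by rewrite lee_fin powR_ge0.
Qed.

Lemma lps_sumType (A B : choiceType) (x : A + B -> R) :
  lps x = (lps (fun a => x (inl a)) + lps (fun b => x (inr b)))%E.
Proof.
rewrite (@lps_inj _ _ inl x); last by move=> a b [].
congr (_ + _)%E; rewrite (_ : ~` range inl = range inr); last first.
  apply/seteqP; split=> [[a|b]|_ [b _ <-]]; [|by exists b|].
    by move=> /= []; exists a.
  by move=> [a _].
by rewrite esum_image// => a b _ _ [].
Qed.

Lemma lps_prod (A B : choiceType) (x : A * B -> R) :
  lps x = (\esum_(a in [set: A]) lps (fun b => x (a, b)))%E.
Proof.
rewrite /lps (@esum_esum _ _ _ _ (fun=> setT) (fun a b => (`|x (a, b)| `^ p)%:E)); last first.
  by move=> i j _ _; rewrite lee_fin powR_ge0.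
rewrite (_ : setT `*`` _ = setT); first by apply: eq_esum => -[].
by apply/seteqP; split.
Qed.

Lemma le_lps_prod (A B B' : choiceType) (x : A * B -> R) (y : A * B' -> R) (K : R) :
  0 <= K -> (forall a, lps (fun b => x (a, b)) <= K%:E * lps (fun b => y (a, b)))%E ->
  (lps x <= K%:E * lps y)%E.
Proof.
move=> K0 xy; rewrite !lps_prod; apply: le_esumZ => // a; exact: lps_ge0.
Qed.

Lemma lps_fin (I : finType) (x : I -> R) : lps x = (lp_sum p x)%:E.
Proof.
rewrite /lps -(set_mem_set [set: I]) esum_fset; last 2 first.
- exact: finite_finset.
- by move=> i _; rewrite lee_fin powR_ge0.
rewrite set_mem_set (@fsbigTE _ _ _ _ (finmap.seq_fset tt (enum I))) => [|i]; last first.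
  by rewrite finmap.seq_fsetE mem_enum.
rewrite big_uniq ?finmap.fset_uniq//= /lp_sum -sumEFin; apply: eq_bigl => i.
by have := finmap.seq_fsetE tt (enum I) i; rewrite mem_enum.
Qed.

End lps.

Section block_ops.
Context {R : realType} (p : R).
Hypothesis p0 : 0 < p.

Definition finext (I : finType) (x : I -> R) (k : nat) : R :=
  if @pickle_inv I k is Some i then x i else 0.

Lemma finext_pickle (I : finType) (x : I -> R) i : finext x (pickle i) = x i.
Proof. by rewrite /finext pickleK_inv. Qed.

Lemma lps_split (I : finType) (x : nat -> R) :
  lps p x = ((lp_sum p (fun i : I => x (pickle i)))%:E +
             lps p (fun k => if @pickle_inv I k is Some _ then 0%R else x k))%E.
Proof.
rewrite (@lps_inj _ _ _ _ (@pickle I) x); last exact: pcan_inj (@pickleK I).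
rewrite lps_fin; congr (_ + _)%E; rewrite esum_mkcond; apply: eq_esum => k _.
case: ifPn => [|]; rewrite ?inE ?notin_setE/=.
  case E : (@pickle_inv I k) => [i|//] []; exists i => //.
  by have := @pickle_invK I k; rewrite E.
rewrite not_notE => -[i _ <-]; by rewrite pickleK_inv normr0 powR0// gt_eqF.
Qed.

Lemma lps_finext (I : finType) (x : I -> R) : lps p (finext x) = (lp_sum p x)%:E.
Proof.
rewrite (lps_split I); under eq_lps => k.
  rewrite (_ : (if _ is Some _ then 0 else _) = 0 :> R); last first.
    by rewrite /finext; case: pickle_inv.
  over.
rewrite lps0// adde0; congr (_%:E); apply: eq_bigr => i _; by rewrite finext_pickle.
Qed.

Lemma lp_sum_res_le (I : finType) (x : nat -> R) :
  ((lp_sum p (fun i : I => x (pickle i)))%:E <= lps p x)%E.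
Proof.
rewrite -(lps_fin p (fun i : I => x (pickle i))).
by apply: (@lps_inj_le _ _ _ _ (@pickle I) x); exact: pcan_inj (@pickleK I).
Qed.

Lemma mx_app_bound (I J : finType) (T : J -> I -> R) (x : I -> R) :
  lp_sum p (mx_app T x) <= (\sum_j (\sum_i `|T j i|) `^ p) * lp_sum p x.
Proof.
have L0 : 0 <= lp_sum p x by apply: sumr_ge0 => i _; exact: powR_ge0.
rewrite mulr_suml; apply: ler_sum => j _.
have -> : lp_sum p x = (lp_sum p x `^ p^-1) `^ p by rewrite -powRrM mulVf ?gt_eqF// powRr1.
rewrite -powRM ?powR_ge0 ?sumr_ge0//.
apply: ge0_ler_powR; rewrite ?nnegrE ?(ltW p0) ?mulr_ge0 ?powR_ge0 ?sumr_ge0//.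
apply: le_trans (ler_norm_sum _ _ _) _; rewrite mulr_suml; apply: ler_sum => i _.
rewrite normrM ler_wpM2l//.
have -> : `|x i| = (`|x i| `^ p) `^ p^-1 by rewrite -powRrM mulfV ?gt_eqF// powRr1.
apply: ge0_ler_powR; rewrite ?nnegrE ?powR_ge0 ?invr_ge0 ?(ltW p0)//.
by rewrite /lp_sum (bigD1 i)//= lerDl sumr_ge0// => k _; exact: powR_ge0.
Qed.

Definition fun_linear (S T : Type) (G : (S -> R) -> (T -> R)) :=
  forall a x y t, G (fun s => a * x s + y s) t = a * G x t + G y t.

(** Unipotent maps of the direct sum of two copies of l_p: one half, read through T on finitely many
    coordinates, is added to the other. Negating T inverts them, so products of such maps are
    automorphisms without any choice of a complement. *)
Definition shear_dn (I J : finType) (T : J -> I -> R) (x : nat + nat -> R) (k : nat + nat) : R :=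
  match k with
  | inl k => x (inl k)
  | inr k => x (inr k) + finext (mx_app T (fun i => x (inl (pickle i)))) k
  end.

Definition shear_up (I J : finType) (L : I -> J -> R) (x : nat + nat -> R) (k : nat + nat) : R :=
  match k with
  | inl k => x (inl k) + finext (mx_app L (fun i => x (inr (pickle i)))) k
  | inr k => x (inr k)
  end.

Lemma mx_app_linear (I J : finType) (T : J -> I -> R) : fun_linear (mx_app T).
Proof.
move=> a x y j; rewrite /mx_app mulr_sumr -big_split/=; apply: eq_bigr => i _.
by rewrite mulrDr mulrCA.
Qed.

Lemma mx_appN (I J : finType) (T : J -> I -> R) x j :
  mx_app (fun j i => - T j i) x j = - mx_app T x j.
Proof. by rewrite /mx_app -sumrN; apply: eq_bigr => i _; rewrite mulNr. Qed.

Lemma finextD (I : finType) (x y : I -> R) a k :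
  finext (fun i => a * x i + y i) k = a * finext x k + finext y k.
Proof. by rewrite /finext; case: pickle_inv; rewrite // mulr0 addr0. Qed.

Lemma eq_finext (I : finType) (x y : I -> R) : x =1 y -> finext x = finext y.
Proof. by move=> xy; apply/funext => k; rewrite /finext; case: pickle_inv. Qed.

Lemma shear_dn_linear (I J : finType) (T : J -> I -> R) : fun_linear (shear_dn T).
Proof.
move=> a x y [k|k]//=; rewrite (eq_finext (mx_app_linear T _ _ _)) finextD.
by rewrite mulrDr addrACA.
Qed.

Lemma shear_up_linear (I J : finType) (L : I -> J -> R) : fun_linear (shear_up L).
Proof.
move=> a x y [k|k]//=; rewrite (eq_finext (mx_app_linear L _ _ _)) finextD.
by rewrite mulrDr addrACA.
Qed.

Lemma finextN (I : finType) (x : I -> R) k : finext (fun i => - x i) k = - finext x k.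
Proof. by rewrite /finext; case: pickle_inv; rewrite // oppr0. Qed.

Lemma shear_dnK (I J : finType) (T : J -> I -> R) x :
  shear_dn (fun j i => - T j i) (shear_dn T x) = x.
Proof.
apply/funext => -[k|k]//=; rewrite (eq_finext (mx_appN T _)) finextN.
by rewrite addrK.
Qed.

Lemma shear_dnNK (I J : finType) (T : J -> I -> R) x :
  shear_dn T (shear_dn (fun j i => - T j i) x) = x.
Proof.
apply/funext => -[k|k]//=; rewrite (eq_finext (mx_appN T _)) finextN.
by rewrite subrK.
Qed.

Lemma shear_upK (I J : finType) (L : I -> J -> R) x :
  shear_up (fun j i => - L j i) (shear_up L x) = x.
Proof.
apply/funext => -[k|k]//=; rewrite (eq_finext (mx_appN L _)) finextN.
by rewrite addrK.
Qed.

Lemma shear_upNK (I J : finType) (L : I -> J -> R) x :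
  shear_up L (shear_up (fun j i => - L j i) x) = x.
Proof.
apply/funext => -[k|k]//=; rewrite (eq_finext (mx_appN L _)) finextN.
by rewrite subrK.
Qed.

Definition lps_bounded (S T : choiceType) (G : (S -> R) -> (T -> R)) : Prop :=
  exists2 K : R, 0 <= K & forall x, (lps p (G x) <= K%:E * lps p x)%E.

Lemma lps_bounded_comp (S T U : choiceType) (G : (S -> R) -> (T -> R)) (H : (T -> R) -> (U -> R)) :
  lps_bounded G -> lps_bounded H -> lps_bounded (H \o G).
Proof.
move=> [K K0 hK] [L L0 hL]; exists (L * K); first exact: mulr_ge0.
move=> x; apply: le_trans (hL _) _; rewrite EFinM -muleA.
by apply: lee_wpmul2l => //; rewrite lee_fin.
Qed.

Lemma shear_aux (I J : finType) (T : J -> I -> R) (x y : nat -> R) : exists2 K : R, 0 <= K &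
  forall x y : nat -> R,
  (lps p x + lps p (fun k => (y k + finext (mx_app T (fun i => x (pickle i))) k)%R)
   <= K%:E * (lps p x + lps p y))%E.
Proof.
set B := \sum_j (\sum_i `|T j i|) `^ p.
have B0 : 0 <= B by apply: sumr_ge0 => j _; exact: powR_ge0.
have h2 : 0 <= 2 `^ p :> R by exact: powR_ge0.
exists (1 + 2 `^ p * (1 + B)).
  by rewrite addr_ge0// mulr_ge0// addr_ge0.
move=> u v; set X := lps p u; set Y := lps p v.
have X0 : (0 <= X)%E by exact: lps_ge0.
have Y0 : (0 <= Y)%E by exact: lps_ge0.
rewrite EFinD ge0_muleDl ?mul1e ?lee_fin ?mulr_ge0 ?addr_ge0//.
apply: leeD; first by rewrite leeDl.
apply: le_trans (lps_add p0 _ _) _.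
rewrite EFinM -muleA; apply: lee_wpmul2l => //.
rewrite lps_finext EFinD ge0_muleDl ?lee_fin// mul1e.
rewrite -/Y -addeA [leLHS]addeC [leLHS]addeC.
rewrite [leRHS]addeCA; apply: leeD => //.
apply: le_trans (_ : (B%:E * X)%E <= _)%E; last first.
  rewrite ge0_muleDr// addeA; apply: le_trans (_ : (X + B%:E * X <= _)%E).
    by rewrite leeDr.
  by rewrite leeDl// mule_ge0.
apply: le_trans (_ : ((B * lp_sum p (fun i : I => u (pickle i)))%:E <= _)%E).
  by rewrite lee_fin; exact: mx_app_bound.
by rewrite EFinM; apply: lee_wpmul2l; rewrite ?lee_fin//; exact: lp_sum_res_le.
Qed.

Lemma shear_dn_bounded (I J : finType) (T : J -> I -> R) : lps_bounded (shear_dn T).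
Proof.
have [K K0 hK] := shear_aux T (fun=> 0) (fun=> 0); exists K => // x.
rewrite !lps_sumType; exact: (hK (x \o inl) (x \o inr)).
Qed.

Lemma shear_up_bounded (I J : finType) (L : I -> J -> R) : lps_bounded (shear_up L).
Proof.
have [K K0 hK] := shear_aux L (fun=> 0) (fun=> 0); exists K => // x.
rewrite !lps_sumType addeC [(lps p (fun a => x (inl a)) + _)%E]addeC; exact: (hK (x \o inr) (x \o inl)).
Qed.

End block_ops.

(** * Extending the bad embeddings to automorphisms of blocks *)

Section block_family.
Context {R : realType} (p : R).
Hypothesis p0 : 0 < p.

Definition sinl (x : nat -> R) (k : nat + nat) : R := if k is inl i then x i else 0.

(** The bounds of D and D' may depend on the block; only c and C, for the restriction to the left
    half, are uniform. In [block_bad] the map S is defined on all sequences, but linear and bounded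
    only where p-sums are finite. *)
Record block_pair (c C K : R) (D D' : (nat + nat -> R) -> (nat + nat -> R)) : Prop := {
  block_lin : fun_linear D;
  block_lin' : fun_linear D';
  block_bnd : lps_bounded p D;
  block_bnd' : lps_bounded p D';
  blockK : cancel D D';
  blockK' : cancel D' D;
  block_lower : forall x, (c%:E * lps p x <= lps p (D (sinl x)))%E;
  block_upper : forall x, (lps p (D (sinl x)) <= C%:E * lps p x)%E;
  block_bad : forall (S : (nat + nat -> R) -> (nat -> R)) (K' : R),
    (forall a x y, lps p x < +oo -> lps p y < +oo -> forall i,
      S (fun k => a * x k + y k)%R i = (a * S x i + S y i)%R)%E ->
    (forall x, lps p x < +oo -> S (D (sinl x)) =1 x)%E ->
    (forall y, lps p y < +oo -> lps p (S y) <= K'%:E * lps p y)%E -> K <= K' }.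

Lemma mx_app_left_inverse (I J : finType) (T : J -> I -> R) :
  (forall x, mx_app T x =1 (fun=> 0) -> x =1 (fun=> 0)) ->
  exists L : I -> J -> R, forall x, mx_app L (mx_app T x) =1 x.
Proof.
move=> Tinj.
pose M := \matrix_(i < #|I|, j < #|J|) T (enum_val j) (enum_val i).
have Mfree : row_free M.
  apply: inj_row_free => v vM.
  have v0 : (fun i => v ord0 (enum_rank i)) =1 (fun=> 0).
    apply: Tinj => j; move/rowP/(_ (enum_rank j)): vM; rewrite !mxE => vM.
    rewrite -[RHS]vM /mx_app (reindex (@enum_val I predT))/=; last first.
      by exists (@enum_rank I) => i _; [exact: enum_valK|exact: enum_rankK].
    by apply: eq_bigr => i _; rewrite mxE !enum_rankK enum_valK mulrC.
  by apply/rowP => i; have := v0 (enum_val i); rewrite enum_valK mxE.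
exists (fun i j => pinvmx M (enum_rank j) (enum_rank i)) => x i.
pose v : 'rV_#|I| := \row_k x (enum_val k).
have /rowP/(_ (enum_rank i)) : v *m M *m pinvmx M = v by rewrite -mulmxA mulmxVp// mulmx1.
rewrite [X in _ = X]mxE enum_rankK => <-; rewrite mxE.
rewrite /mx_app (reindex (@enum_val J predT))/=; last first.
  by exists (@enum_rank J) => j _; [exact: enum_valK|exact: enum_rankK].
apply: eq_bigr => j _; rewrite enum_valK mulrC; congr (_ * _); rewrite mxE.
rewrite (reindex (@enum_val I predT))/=; last first.
  by exists (@enum_rank I) => k _; [exact: enum_valK|exact: enum_rankK].
by apply: eq_bigr => k _; rewrite !mxE mulrC.
Qed.

Lemma finext_res (I : finType) (x : nat -> R) k :
  finext (fun i : I => x (pickle i)) k = if @pickle_inv I k is Some _ then x k else 0.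
Proof.
rewrite /finext; case E : (@pickle_inv I k) => [i|//].
by have := @pickle_invK I k; rewrite E/= => ->.
Qed.

Lemma sinr_sum (J : finType) (S : (nat + nat -> R) -> (nat -> R)) (y : J -> R) i :
  (forall a x y, lps p x < +oo -> lps p y < +oo -> forall i,
      S (fun k => a * x k + y k)%R i = (a * S x i + S y i)%R)%E ->
  S (fun k => if k is inr k then finext y k else 0) i =
  \sum_j S (fun k => if k is inr k then finext (fun l => (j == l)%:R) k else 0) i * y j.
Proof.
move=> Slin.
have fin (z : J -> R) : (lps p (fun k => if k is inr k then finext z k else 0)%R < +oo)%E.
  rewrite lps_sumType/= lps0//= add0e lps_finext//; exact: ltry.
suff H (r : seq J) : S (fun k => if k is inr k then finext (fun l => \sum_(j <- r) y j * (j == l)%:R) k else 0) i =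
    \sum_(j <- r) S (fun k => if k is inr k then finext (fun l => (j == l)%:R) k else 0) i * y j.
  rewrite -H; congr (S _ i); apply/funext => -[//|k].
  congr (_ k); apply: eq_finext => l; rewrite (bigD1 l)//= eqxx mulr1 big1 ?addr0// => j /negbTE ->.
  by rewrite mulr0.
elim: r => [|j r IH].
  rewrite big_nil.
  have f0 : (lps p (fun _ : nat + nat => 0%R) < +oo)%E by rewrite lps0.
  (* Linearity at a = -1 on the zero sequence gives that S vanishes there. *)
  transitivity (-1 * S (fun=> 0) i + S (fun=> 0) i); last by rewrite mulN1r addNr.
  rewrite -Slin//; congr (S _ i); apply/funext => -[k|k]; rewrite mulr0 addr0//.
  by rewrite /finext; case: pickle_inv => // a; rewrite big_nil.
rewrite big_cons -IH mulrC -Slin//; congr (S _ i); apply/funext => -[k|k]; first by rewrite mulr0 addr0.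
by rewrite -finextD; congr (_ k); apply: eq_finext => l; rewrite big_cons.
Qed.

(** On the coordinates indexed by I the restriction to the left half acts as T, on the others as the
    identity, whence the minimum and maximum with 1. A left inverse S of this restriction, read on
    finitely supported sequences, is a matrix that is a left inverse of T with the same bound. *)
Lemma bad_block_pair (c C K : R) (I J : finType) (T : J -> I -> R) : 0 < c -> 0 < C ->
  (forall x, c * lp_sum p x <= lp_sum p (mx_app T x)) ->
  (forall x, lp_sum p (mx_app T x) <= C * lp_sum p x) ->
  (forall (S : I -> J -> R) (K' : R), (forall x, mx_app S (mx_app T x) =1 x) ->
     (forall y, lp_sum p (mx_app S y) <= K' * lp_sum p y) -> K <= K') ->
  exists D D', block_pair (Num.min c 1) (Num.max C 1) K D D'.
Proof.
move=> c0 C0 lowT upT badT.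
have [L LT] : exists L : I -> J -> R, forall x, mx_app L (mx_app T x) =1 x.
  apply: mx_app_left_inverse => x Tx0 i.
  have L0 : lp_sum p (mx_app T x) = 0.
    by apply: big1 => j _; rewrite Tx0 normr0 powR0// gt_eqF.
  have := lowT x; rewrite L0 pmulr_rle0// => h.
  have : `|x i| `^ p <= 0.
    apply: le_trans h; rewrite /lp_sum (bigD1 i)//= lerDl.
    by apply: sumr_ge0 => k _; exact: powR_ge0.
  rewrite le_eqVlt ltNge powR_ge0 orbF powR_eq0 => /andP[/eqP/normr0_eq0-> _].
  by [].
(* On the finitely many relevant coordinates, [D] is (x, y) |-> (- L y, y + T x),
   so that it extends (x, 0) |-> (0, T x). *)
pose D := shear_up (fun i j => - L i j) \o shear_dn T.
pose D' := shear_dn (fun j i => - T j i) \o shear_up L.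
have DE x k : D (sinl x) k = match k with
    | inl k => if @pickle_inv I k is Some _ then 0 else x k
    | inr k => finext (mx_app T (fun i => x (pickle i))) k end.
  rewrite /D /=; case: k => k /=; last by rewrite add0r.
  rewrite (eq_finext (mx_appN L _)) finextN.
  rewrite (_ : finext _ k = finext (fun i : I => x (pickle i)) k); last first.
    congr (_ k); apply: eq_finext => i; rewrite -[RHS](LT (fun i => x (pickle i))).
    by apply: eq_bigr => j _; rewrite add0r finext_pickle.
  by rewrite finext_res; case: pickle_inv => [_|]; rewrite ?subrr ?subr0.
have lD x : lps p (D (sinl x)) =
    (lps p (fun k => if @pickle_inv I k is Some _ then 0%R else x k) +
     (lp_sum p (mx_app T (fun i : I => x (pickle i))))%:E)%E.
  rewrite lps_sumType -lps_finext//; congr (_ + _)%E; apply: eq_lps => k; exact: DE.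
exists D, D'; split.
- by move=> a x y t; rewrite /D/= -shear_up_linear; congr (shear_up _ _ t); apply/funext => s; rewrite shear_dn_linear.
- by move=> a x y t; rewrite /D'/= -shear_dn_linear; congr (shear_dn _ _ t); apply/funext => s; rewrite shear_up_linear.
- by apply: lps_bounded_comp; [exact: shear_dn_bounded|exact: shear_up_bounded].
- by apply: lps_bounded_comp; [exact: shear_up_bounded|exact: shear_dn_bounded].
- by move=> x; rewrite /D/D'/= shear_upNK shear_dnK.
- by move=> x; rewrite /D/D'/= shear_dnNK shear_upK.
- move=> x; rewrite lD (@lps_split _ _ p0 I) addeC.
  have m0 : 0 <= Num.min c 1 by rewrite le_min (ltW c0)/=.
  rewrite ge0_muleDr ?lps_ge0 ?lee_fin ?sumr_ge0//.
  apply: leeD.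
    by rewrite -[leRHS]mul1e lee_wpmul2r ?lps_ge0// lee_fin ge_min lexx orbT.
  apply: (@le_trans _ _ (c%:E * (lp_sum p (fun i : I => x (pickle i)))%:E)%E); last by rewrite -EFinM lee_fin; exact: lowT.
  by rewrite lee_wpmul2r ?lee_fin ?sumr_ge0// ge_min lexx.
- move=> x; rewrite lD [in leRHS](@lps_split _ _ p0 I) addeC.
  have m0 : 0 <= Num.max C 1 by rewrite le_max (ltW C0).
  rewrite ge0_muleDr ?lps_ge0 ?lee_fin ?sumr_ge0//.
  apply: leeD.
    apply: (@le_trans _ _ (C%:E * (lp_sum p (fun i : I => x (pickle i)))%:E)%E); first by rewrite -EFinM lee_fin; exact: upT.
    by rewrite lee_wpmul2r ?lee_fin ?sumr_ge0// le_max lexx.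
  by rewrite -[leLHS]mul1e lee_wpmul2r ?lps_ge0// lee_fin le_max lexx orbT.
move=> S K' Slin SD Sb.
pose ext (y : J -> R) (k : nat + nat) := if k is inr k then finext y k else 0.
have fin (z : J -> R) : (lps p (ext z) = (lp_sum p z)%:E)%E.
  by rewrite lps_sumType/= lps0//= add0e lps_finext.
have S'E y i : mx_app (fun i j => S (ext (fun l => (j == l)%:R)) (@pickle I i)) y i = S (ext y) (pickle i).
  by rewrite (sinr_sum _ _ Slin).
apply: (badT (fun i j => S (ext (fun l => (j == l)%:R)) (pickle i))) => [x i|y].
  rewrite S'E; have := SD (finext x); rewrite lps_finext// => /(_ (ltry _) (pickle i)).
  rewrite finext_pickle => <-; congr (S _ _); apply/funext => k; rewrite DE.
  case: k => k; first by rewrite /ext /finext; case: pickle_inv.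
  congr (_ k); apply: eq_finext => j; apply: eq_bigr => l _; by rewrite finext_pickle.
rewrite -lee_fin EFinM -fin; apply: le_trans (Sb (ext y) _); last by rewrite fin ltry.
rewrite /lp_sum (eq_bigr _ (fun i _ => congr1 (fun z => `|z| `^ p) (S'E y i))).
exact: lp_sum_res_le.
Qed.

Theorem bad_blocks : bad_embeddings p ->
  exists (c C : R) (D D' : nat -> (nat + nat -> R) -> (nat + nat -> R)),
    [/\ 0 < c <= 1, 1 <= C & forall n, block_pair c C n%:R (D n) (D' n)].
Proof.
move=> [c [C [c0 C0 bad]]].
have : forall n : nat, exists DD', block_pair (Num.min c 1) (Num.max C 1) n%:R DD'.1 DD'.2.
  move=> n; have [I [J [T [lT uT bT]]]] := bad n%:R.
  by have [D [D' h]] := bad_block_pair c0 C0 lT uT bT; exists (D, D').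
move=> /choice[DD' h]; exists (Num.min c 1), (Num.max C 1), (fun n => (DD' n).1), (fun n => (DD' n).2).
split=> //; first by rewrite lt_min c0 ltr01 ge_min lexx orbT.
by rewrite le_max lexx orbT.
Qed.

End block_family.

(** * Embeddings indexed by bit arrays *)

Lemma infinite_countType_bij (V : countType) (f : nat -> V) : injective f ->
  exists (e : V -> nat) (e' : nat -> V), cancel e e' /\ cancel e' e.
Proof.
move=> fi.
have /card_set_bijP[e] : ([set: V] #= [set: nat])%card.
  apply: eq_card_nat => // /(finite_preimage (f := f)) h; apply: infinite_nat.
  by rewrite -(preimage_setT f); apply: h => a b _ _ /fi.
by rewrite setTT_bijective => -[e' eK e'K]; exists e, e'.
Qed.

Section lp_model.
Context {R : realType} (p : R).
Hypothesis p0 : 0 < p.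

(** Isometric coordinates identifying Y with l_p over V. The abstraction lets a single space be
    indexed by the blocks of the domain and by those of the target, which differ. *)
Record lp_model (Y : normedModType R) (V : choiceType) (crd : Y -> V -> R) (mk : (V -> R) -> Y) : Prop := {
  crd_lin : forall a f g v, crd (a *: f + g) v = a * crd f v + crd g v;
  crd_norm : forall f, lps p (crd f) = (`|f| `^ p)%:E;
  crdK : cancel crd mk;
  mkK : forall x, (lps p x < +oo)%E -> crd (mk x) = x }.

Lemma lp_model_reindex (Y : normedModType R) (V W : choiceType) (crd : Y -> V -> R) mk
    (e : W -> V) (e' : V -> W) : lp_model crd mk -> cancel e e' -> cancel e' e ->
  lp_model (fun f w => crd f (e w)) (fun x => mk (fun v => x (e' v))).
Proof.
move=> m eK e'K; have be : bijective e by exists e'.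
split.
- by move=> a f g w; rewrite (crd_lin m).
- by move=> f; rewrite (lps_reindex p _ be) (crd_norm m).
- move=> f; rewrite -[RHS](crdK m); congr mk; apply/funext => v; by rewrite e'K.
- move=> x xf; apply/funext => w; rewrite (mkK m) ?eK//.
  by rewrite (lps_reindex p x (Bijective e'K eK)).
Qed.

Variables (Y : normedModType R) (V : choiceType) (crd : Y -> V -> R) (mk : (V -> R) -> Y).
Hypothesis m : lp_model crd mk.

Lemma crd_fin f : (lps p (crd f) < +oo)%E.
Proof. by rewrite (crd_norm m) ltry. Qed.

Lemma mk_lin a x y : (lps p x < +oo)%E -> (lps p y < +oo)%E ->
  mk (fun v => a * x v + y v) = a *: mk x + mk y.
Proof.
move=> xf yf; rewrite -[RHS](crdK m); congr mk; apply/funext => v.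
by rewrite (crd_lin m) !(mkK m).
Qed.

Lemma le_norm_powR (a b K : R) : 0 <= a -> 0 <= b -> 0 <= K -> a `^ p <= K * b `^ p -> a <= K `^ p^-1 * b.
Proof.
move=> a0 b0 K0 h; rewrite leNgt; apply/negP => ba.
have := gt0_ltr_powR p0 _ _ ba; rewrite !nnegrE => /(_ (mulr_ge0 (powR_ge0 _ _) b0) a0).
apply/negP; rewrite -leNgt powRM ?powR_ge0// -powRrM mulVf ?gt_eqF// powRr1//.
Qed.

Lemma mk_norm x : (lps p x < +oo)%E -> (`|mk x| `^ p)%:E = lps p x.
Proof. by move=> xf; rewrite -(crd_norm m) (mkK m). Qed.

End lp_model.

Section op_of.
Context {R : realType} (p : R).
Hypothesis p0 : 0 < p.
Variables (Y : normedModType R) (V W : choiceType).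
Variables (crd : Y -> V -> R) (mk : (V -> R) -> Y) (crd' : Y -> W -> R) (mk' : (W -> R) -> Y).
Hypothesis (m : lp_model p crd mk) (m' : lp_model p crd' mk').
Variables (G : (V -> R) -> (W -> R)) (K : R).
Hypotheses (Glin : fun_linear G) (K0 : 0 <= K).
Hypothesis Gb : forall x, (lps p (G x) <= K%:E * lps p x)%E.

Definition op_of (f : Y) : Y := mk' (G (crd f)).

Lemma lps_lt_pinfty x : (lps p x < +oo)%E -> (lps p (G x) < +oo)%E.
Proof.
move=> xf; apply: le_lt_trans (Gb x) _.
have : lps p x \is a fin_num by rewrite ge0_fin_numE// lps_ge0.
by move=> /fineK <-; rewrite -EFinM ltry.
Qed.

Lemma crd_op f : crd' (op_of f) = G (crd f).
Proof. by rewrite (mkK m')//; apply: lps_lt_pinfty; exact: crd_fin m f. Qed.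

Lemma op_of_lin a f g : op_of (a *: f + g) = a *: op_of f + op_of g.
Proof.
rewrite /op_of -(mk_lin m'); try exact/lps_lt_pinfty/(crd_fin m).
congr mk'; apply/funext => w; rewrite -Glin; congr (G _ w); apply/funext => v.
exact: crd_lin m _ _ _ _.
Qed.

Lemma op_of_bound f : `|op_of f| <= K `^ p^-1 * `|f|.
Proof.
apply: (le_norm_powR p0) => //.
rewrite -lee_fin EFinM -(crd_norm m f) -(crd_norm m' (op_of f)) crd_op; exact: Gb.
Qed.

End op_of.

Section operator_facts.
Context {R : realType} {X Y : normedModType R}.

Lemma lin_sum (Z : lmodType R) (F : X -> Z) : (forall a x y, F (a *: x + y) = a *: F x + F y) ->
  forall n (c : 'I_n -> R) (e : 'I_n -> X), F (\sum_i c i *: e i) = \sum_i c i *: F (e i).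
Proof.
move=> Fl n c e; have F0 : F 0 = 0.
  by have := Fl (-1) 0 0; rewrite scaler0 addr0 scaleN1r addNr.
by elim/big_rec2 : _ => // i y1 y2 _ <-; rewrite Fl.
Qed.

Lemma linB (Z : lmodType R) (F : X -> Z) : (forall a x y, F (a *: x + y) = a *: F x + F y) ->
  forall x y, F (x - y) = F x - F y.
Proof.
move=> Fl x y; have := Fl (-1) y x; rewrite !scaleN1r addrC => ->.
by rewrite addrC.
Qed.

Lemma bounded_linear_continuous (F : X -> Y) (K : R) :
  (forall a x y, F (a *: x + y) = a *: F x + F y) -> (forall x, `|F x| <= K * `|x|) ->
  continuous F.
Proof.
move=> Fl FK x; apply/cvgrPdist_lt => e e0.
have K0 : 0 < `|K| + 1 by rewrite ltr_pwDr.
near=> y; rewrite -(linB Fl); apply: le_lt_trans (FK _) _.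
apply: le_lt_trans (_ : (`|K| + 1) * `|x - y| < _).
  by rewrite ler_wpM2r// (le_trans (ler_norm K))// lerDl.
rewrite mulrC -ltr_pdivlMr//; near: y.
by apply: (@cvgr_dist_lt _ _ _ _ (nbhs_filter _) id x); [exact: cvg_id|rewrite divr_gt0].
Unshelve. all: by end_near. Qed.

Lemma closed_kernel (F : X -> Y) (K : R) :
  (forall a x y, F (a *: x + y) = a *: F x + F y) -> (forall x, `|F x| <= K * `|x|) ->
  closed [set x | F x = 0].
Proof.
move=> Fl FK; have cF := bounded_linear_continuous Fl FK.
have -> : [set x | F x = 0] = F @^-1` [set 0] by [].
apply: closed_comp => [x _|]; first exact: cF.
exact/accessible_closed_set1/hausdorff_accessible/norm_hausdorff.
Qed.

Lemma bounded_below_isomorphism (T : Y -> X) (K : R) :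
  (forall a x y, T (a *: x + y) = a *: T x + T y) -> (forall y, `|y| <= K * `|T y|) ->
  isomorphism_onto_range T.
Proof.
move=> Tl TK.
have TB x y : T (x - y) = T x - T y by rewrite addrC -scaleN1r Tl scaleN1r addrC.
have Ti : injective T.
  move=> x y xy; apply/eqP; rewrite -subr_eq0 -normr_le0.
  by apply: le_trans (TK _) _; rewrite TB xy subrr normr0 mulr0.
pose S x := xget 0 [set y | T y = x].
have SK : cancel T S.
  by move=> y; apply: Ti; rewrite /S; case: xgetP => [z _ //|/(_ y)/(_ erefl)].
exists S; split=> //; rewrite continuous_subspace_in => x /set_mem[y _ <-].
apply/cvgrPdist_lt => e e0.
have K0 : 0 < `|K| + 1 by rewrite ltr_pwDr.
rewrite -nbhs_subspace_in; last by exists y.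
have h : \forall z \near T y, `|T y - z| < e / (`|K| + 1).
  by apply: (@cvgr_dist_lt _ _ _ _ (nbhs_filter _) id (T y)); [exact: cvg_id|rewrite divr_gt0].
apply: filterS h => z h [w _ wz]; rewrite -wz.
suff : `|S (T y) - S (T w)| < e by [].
rewrite !SK; apply: le_lt_trans (TK _) _.
apply: le_lt_trans (_ : (`|K| + 1) * `|T (y - w)| < _).
  by rewrite ler_wpM2r// (le_trans (ler_norm K))// lerDl.
by rewrite mulrC -ltr_pdivlMr// TB wz.
Qed.

End operator_facts.

(** * Operators on l_p sums of blocks *)

Section block_operators.
Context {R : realType} (p : R).
Hypothesis p0 : 0 < p.
Variables (c C : R) (D D' : nat -> (nat + nat -> R) -> (nat + nat -> R)).
Hypotheses (c01 : 0 < c <= 1) (C1 : 1 <= C).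
Hypothesis DP : forall n, block_pair p c C n%:R (D n) (D' n).

Local Notation B := (nat * nat)%type.
Local Notation U := (nat * nat * nat)%type.
Local Notation T := (nat * nat * (nat + nat))%type.

Let c0 : 0 < c. Proof. by have /andP[] := c01. Qed.
Let C0 : 0 <= C. Proof. exact: le_trans C1. Qed.

Definition blk (b : bool) n := if b then D n else id.
Definition blk' (b : bool) n := if b then D' n else id.

Lemma blkK b n : cancel (blk b n) (blk' b n).
Proof. by case: b => //; exact: blockK (DP n). Qed.

Lemma blkK' b n : cancel (blk' b n) (blk b n).
Proof. by case: b => //; exact: blockK' (DP n). Qed.

Lemma blk_lin b n : fun_linear (blk b n).
Proof. by case: b => //; exact: block_lin (DP n). Qed.

Lemma blk_lin' b n : fun_linear (blk' b n).
Proof. by case: b => //; exact: block_lin' (DP n). Qed.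

Lemma lps_bounded_id (S : choiceType) : lps_bounded p (@id (S -> R)).
Proof. by exists 1 => // x; rewrite mul1e. Qed.

Lemma blk_bounded b n : lps_bounded p (blk b n).
Proof. by case: b; [exact: block_bnd (DP n)|exact: lps_bounded_id]. Qed.

Lemma blk_bounded' b n : lps_bounded p (blk' b n).
Proof. by case: b; [exact: block_bnd' (DP n)|exact: lps_bounded_id]. Qed.

Lemma lps_sinl (x : nat -> R) : lps p (sinl x) = lps p x.
Proof. by rewrite lps_sumType/= [X in (_ + X)%E]lps0// adde0. Qed.

Lemma blk_lower b n x : (c%:E * lps p x <= lps p (blk b n (sinl x)))%E.
Proof.
case: b; first exact: block_lower (DP n) x.
rewrite lps_sinl -[leRHS]mul1e lee_wpmul2r ?lps_ge0// lee_fin.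
by case/andP: c01.
Qed.

Lemma blk_upper b n x : (lps p (blk b n (sinl x)) <= C%:E * lps p x)%E.
Proof.
case: b; first exact: block_upper (DP n) x.
by rewrite lps_sinl -[leLHS]mul1e lee_wpmul2r ?lps_ge0// lee_fin.
Qed.

Definition block_diag (V W : Type) (G : B -> (V -> R) -> (W -> R)) (x : B * V -> R) (bw : B * W) : R :=
  G bw.1 (fun v => x (bw.1, v)) bw.2.

Lemma block_diag_lin (V W : Type) (G : B -> (V -> R) -> (W -> R)) :
  (forall b, fun_linear (G b)) -> fun_linear (block_diag G).
Proof. by move=> Gl a x y [b w]; rewrite /block_diag/= Gl. Qed.

Lemma block_diag_bound (V W : choiceType) (G : B -> (V -> R) -> (W -> R)) (K : R) :
  0 <= K -> (forall b x, (lps p (G b x) <= K%:E * lps p x)%E) ->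
  forall x, (lps p (block_diag G x) <= K%:E * lps p x)%E.
Proof. by move=> K0 GK x; apply: (le_lps_prod K0) => b; exact: (GK b (fun v => x (b, v))). Qed.

Definition emb_op (s : B -> bool) := block_diag (fun b x => blk (s b) b.1 (sinl x)).

Lemma sinl_lin : fun_linear (@sinl R).
Proof. by move=> a x y [k|k]//=; rewrite mulr0 addr0. Qed.

Lemma blk_sinl_lin b n : fun_linear (fun x => blk b n (sinl x)).
Proof.
move=> a x y t; rewrite -blk_lin; congr (blk _ _ _ t); apply/funext => k.
exact: sinl_lin.
Qed.

Lemma emb_op_lin s : fun_linear (emb_op s).
Proof. by apply: block_diag_lin => b; exact: blk_sinl_lin. Qed.

Lemma emb_op_upper s x : (lps p (emb_op s x) <= C%:E * lps p x)%E.
Proof. by apply: block_diag_bound => // b y; exact: blk_upper. Qed.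

Lemma emb_op_lower s x : (lps p x <= c^-1%:E * lps p (emb_op s x))%E.
Proof.
apply: le_lps_prod; first by rewrite invr_ge0 ltW.
move=> b; rewrite -[leLHS]mul1e -(mulVf (lt0r_neq0 c0)) EFinM -muleA.
by apply: lee_wpmul2l; [rewrite lee_fin invr_ge0 ltW|exact: (blk_lower (s b) b.1 (fun i => x (b, i)))].
Qed.

(** Undoing the automorphism of each block carries the range of [emb_op s] onto sequences vanishing
    on all right halves; these are the coordinates after that. *)
Definition coord_op (s : B -> bool) (z : T -> R) (b : B) (k : nat + nat) : R :=
  blk' (s b) b.1 (fun k => z (b, k)) k.

Lemma coord_op_emb s x b k : coord_op s (emb_op s x) b k = sinl (fun i => x (b, i)) k.
Proof. by rewrite /coord_op /emb_op /block_diag/= blkK. Qed.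

Lemma coord_opK s z : (forall b i, coord_op s z b (inr i) = 0) ->
  z = emb_op s (fun bi => coord_op s z bi.1 (inl bi.2)).
Proof.
move=> z0; apply/funext => -[b k]; rewrite /emb_op /block_diag/=.
rewrite (_ : sinl _ = coord_op s z b); first by rewrite /coord_op blkK'.
by apply/funext => -[i|i]//=; rewrite z0.
Qed.

Lemma coord_op_lin s a x y b k : coord_op s (fun t => a * x t + y t) b k =
  a * coord_op s x b k + coord_op s y b k.
Proof. by rewrite /coord_op blk_lin'. Qed.

Lemma lps_slice_le (V W : choiceType) (z : V * W -> R) v : (lps p (fun w => z (v, w)) <= lps p z)%E.
Proof. by apply: (@lps_inj_le _ p _ _ (pair v) z) => a b []. Qed.

Lemma coord_op_bound s b k : exists2 K : R, 0 <= K &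
  forall z, ((`|coord_op s z b k| `^ p)%:E <= K%:E * lps p z)%E.
Proof.
have [K K0 hK] := blk_bounded' (s b) b.1; exists K => // z.
apply: le_trans (lps_coord _ _ _) _; apply: le_trans (hK _) _.
by apply: lee_wpmul2l; rewrite ?lee_fin// lps_slice_le.
Qed.

Definition at_block (V : Type) (b : B) (y : V -> R) (bv : B * V) : R := if bv.1 == b then y bv.2 else 0.

Lemma lps_at_block (V : choiceType) b (y : V -> R) : lps p (at_block b y) = lps p y.
Proof.
rewrite (lps_inj p (at_block b y) (e := pair b)); last by move=> u v [].
rewrite [X in (_ + X)%E]esum1 ?adde0.
  by apply: eq_lps => v; rewrite /at_block/= eqxx.
move=> [b' v] /= h; rewrite /at_block/=; case: eqP => [E|_]; last by rewrite normr0 powR0// gt_eqF.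
by case: h; exists v; rewrite ?E.
Qed.

Lemma blk0 b n : blk b n (fun=> 0) = fun=> 0.
Proof.
apply/funext => k; have := blk_lin b n (-1) (fun=> 0) (fun=> 0) k.
rewrite (_ : (fun _ => _) = (fun=> 0)); last by apply/funext => ?; rewrite mulr0 addr0.
by rewrite mulN1r addNr.
Qed.

Lemma sinl0 : sinl (fun=> 0 : R) = fun=> 0.
Proof. by apply/funext => -[]. Qed.

Lemma emb_op_at_block s b x : emb_op s (at_block b x) = at_block b (blk (s b) b.1 (sinl x)).
Proof.
apply/funext => -[b' k]; rewrite /emb_op /block_diag /at_block/=.
by case: eqP => [->|_] //; rewrite sinl0 blk0.
Qed.

Lemma esum_tail (V : countType) (a : V -> \bar R) (e : R) : 0 < e ->
  (forall v, 0 <= a v)%E -> (\esum_(v in [set: V]) a v < +oo)%E ->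
  exists N, (\esum_(v in [set: V]) (if (pickle v < N)%N then 0 else a v) <= e%:E)%E.
Proof.
move=> e0 a0 af.
have fn : (\esum_(v in [set: V]) a v)%E \is a fin_num by rewrite ge0_fin_numE// esum_ge0.
have [_ [X [fX _] <-]] := ub_ereal_sup_adherent e0 fn.
rewrite -/(esum _ _) => hX.
have [N hN] : exists N, forall v, X v -> (pickle v < N)%N.
  exists (\max_(v <- finmap.enum_fset (fset_set X)) pickle v).+1 => v Xv.
  rewrite ltnS; apply: (@leq_bigmax_seq _ _ xpredT (fun v => pickle v)) => //.
  by have := in_fset_set fX v; rewrite mem_set.
exists N.
have E : (\esum_(v in [set: V]) a v = \sum_(v \in X) a v + \esum_(v in ~` X) a v)%E.
  by rewrite (esumID X)// !setTI -esum_fset ?set_mem_set.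
have Xf : (\sum_(v \in X) a v)%E \is a fin_num.
  by rewrite ge0_fin_numE ?fsume_ge0//; apply: le_lt_trans af; rewrite E leeDl// esum_ge0.
apply: le_trans (_ : (\esum_(v in ~` X) a v <= _)%E).
  rewrite [leRHS]esum_mkcond; apply: le_esum => v _; case: ifPn => [_|]; first by case: ifP.
  move=> h; rewrite ifT// inE => Xv; by rewrite hN in h.
have : (0 <= \esum_(v in ~` X) a v)%E by exact: esum_ge0.
move: hX af; rewrite E; move: Xf; case: (\sum_(v \in X) a v)%E => // r _.
case: (\esum_(v in ~` X) a v)%E => [t|//|//].
rewrite -/((r + t - e)%:E < r%:E)%E lte_fin => h _ _; rewrite lee_fin; lra.
Qed.

(** Where s and s' agree on a block the two images coincide. On the remaining blocks both are
    bounded by C times the p-sum of x there, a tail of a convergent sum. This is continuity in s for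
    the strong operator topology. *)
Lemma emb_op_cont x (e : R) : 0 < e -> (lps p x < +oo)%E ->
  exists N, forall s s', (forall b, (pickle b < N)%N -> s b = s' b) ->
  (lps p (fun t => emb_op s x t - emb_op s' x t)%R <= e%:E)%E.
Proof.
move=> e0 xf; pose K := 2 `^ p * (C + C).
have K0 : 0 < K by rewrite mulr_gt0 ?powR_gt0// addr_gt0//; exact: lt_le_trans C1.
have eK : 0 < e / K by rewrite divr_gt0.
have [N hN] : exists N, (\esum_(b in [set: B]) (if (pickle b < N)%N then 0 else
    lps p (fun i => x (b, i))) <= (e / K)%:E)%E.
  apply: esum_tail => // [b|]; first exact: lps_ge0.
  by rewrite -lps_prod.
exists N => s s' ss'; rewrite lps_prod.
apply: le_trans (_ : (K%:E * (e / K)%:E <= _)%E); last first.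
  by rewrite -EFinM lee_fin mulrC divfK// gt_eqF.
apply: le_trans (lee_wpmul2l _ hN); last by rewrite lee_fin ltW.
apply: le_esumZ; rewrite ?(ltW K0)// => b; first by case: ifP => // _; exact: lps_ge0.
case: ifPn => [bN|_].
  rewrite mule0 [leLHS](_ : _ = 0%E)// -[RHS](lps0 p0 (nat + nat)%type).
  by apply: eq_lps => k; rewrite /emb_op /block_diag/= ss'// subrr.
apply: le_trans (lps_add p0 _ _) _; rewrite EFinM -muleA.
apply: lee_wpmul2l; first by rewrite lee_fin powR_ge0.
rewrite EFinD ge0_muleDl ?lee_fin//; apply: leeD.
  exact: (blk_upper (s b) b.1 (fun i => x (b, i))).
rewrite [leLHS](_ : _ = lps p (fun k => emb_op s' x (b, k))).
  exact: (blk_upper (s' b) b.1 (fun i => x (b, i))).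
by apply: eq_esum => k _; rewrite normrN.
Qed.

End block_operators.

(** * Embeddings into a space with a complemented copy of l_p *)

Section emb_family.
Context {R : realType} (p : R).
Hypothesis p0 : 0 < p.
Variables (c C : R) (D D' : nat -> (nat + nat -> R) -> (nat + nat -> R)).
Hypotheses (c01 : 0 < c <= 1) (C1 : 1 <= C).
Hypothesis DP : forall n, block_pair p c C n%:R (D n) (D' n).

Local Notation B := (nat * nat)%type.
Local Notation U := (nat * nat * nat)%type.
Local Notation T := (nat * nat * (nat + nat))%type.

Variables (Y X : normedModType R).
Variables (cU : Y -> U -> R) (mU : (U -> R) -> Y) (cT : Y -> T -> R) (mT : (T -> R) -> Y).
Hypotheses (mdU : lp_model p cU mU) (mdT : lp_model p cT mT).
Variables (iota : Y -> X) (pi : X -> Y) (Ki Kp : R).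
Hypotheses (iota_lin : forall a x y, iota (a *: x + y) = a *: iota x + iota y)
  (pi_lin : forall a x y, pi (a *: x + y) = a *: pi x + pi y)
  (iota_bnd : forall x, `|iota x| <= Ki * `|x|)
  (pi_bnd : forall x, `|pi x| <= Kp * `|x|)
  (iotaK : cancel iota pi) (Ki0 : 0 <= Ki) (Kp0 : 0 <= Kp).

Let c0 : 0 < c. Proof. by have /andP[] := c01. Qed.
Let C0 : 0 <= C. Proof. exact: le_trans C1. Qed.
Let cV0 : 0 <= c^-1. Proof. by rewrite invr_ge0 ltW. Qed.

Local Notation eop := (emb_op D).

Definition emb_map (s : B -> bool) (f : Y) : X := iota (op_of cU mT (eop s) f).

Let eopL s : fun_linear (eop s) := emb_op_lin DP s.
Let eopU s := emb_op_upper p0 C1 DP s.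

Lemma emb_map_lin s a f g : emb_map s (a *: f + g) = a *: emb_map s f + emb_map s g.
Proof. by rewrite /emb_map (op_of_lin mdU mdT (eopL s) (eopU s)) iota_lin. Qed.

Lemma emb_map_bound s f : `|emb_map s f| <= Ki * C `^ p^-1 * `|f|.
Proof.
apply: le_trans (iota_bnd _) _; rewrite -mulrA ler_wpM2l//.
exact: (op_of_bound p0 mdU mdT C0 (eopU s)).
Qed.

Lemma crd_pi_emb s f : cT (pi (emb_map s f)) = eop s (cU f).
Proof. by rewrite /emb_map iotaK (crd_op mdU mdT (eopU s)). Qed.

Lemma emb_map_lower s f : `|f| <= (c^-1) `^ p^-1 * Kp * `|emb_map s f|.
Proof.
rewrite -mulrA; apply: le_trans (_ : (c^-1) `^ p^-1 * `|pi (emb_map s f)| <= _).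
  apply: (le_norm_powR p0) => //.
  rewrite -lee_fin EFinM -(crd_norm mdU f) -(crd_norm mdT (pi (emb_map s f))) crd_pi_emb.
  exact: (emb_op_lower p0 c01 DP).
by rewrite ler_wpM2l// powR_ge0.
Qed.

Definition coord s (b : B) (k : nat + nat) (x : X) : R := coord_op D' s (cT (pi x)) b k.

Lemma coord_lin s b k a x y : coord s b k (a *: x + y) = a * coord s b k x + coord s b k y.
Proof.
rewrite /coord -(coord_op_lin DP); congr (coord_op _ _ _ _ _); apply/funext => t.
by rewrite pi_lin (crd_lin mdT).
Qed.

Lemma coord_bound s b k : exists K : R, forall x, `|coord s b k x| <= K * `|x|.
Proof.
have [K K0 hK] := coord_op_bound DP s b k; exists (K `^ p^-1 * Kp) => x.
rewrite -mulrA; apply: le_trans (_ : K `^ p^-1 * `|pi x| <= _); last by rewrite ler_wpM2l ?powR_ge0.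
apply: (le_norm_powR p0) => //; rewrite -lee_fin EFinM -(crd_norm mdT); exact: hK.
Qed.

(** The range is written as an intersection of kernels of bounded linear maps, which shows that it
    is closed and provides functionals that vanish on it. *)
Lemma range_emb_map s : range (emb_map s) =
  [set x | x - iota (pi x) = 0] `&` \bigcap_b \bigcap_i [set x | coord s b (inr i) x = 0 :> R^o].
Proof.
apply/seteqP; split=> [_ [f _ <-]|x [/= /eqP]].
  split; first by rewrite /= /emb_map iotaK subrr.
  move=> b _ i _ /=; rewrite /coord crd_pi_emb (coord_op_emb DP)//.
rewrite subr_eq0 => /eqP xE h; exists (mU (fun bi => coord s bi.1 (inl bi.2) x)) => //.
have zE : cT (pi x) = eop s (fun bi => coord s bi.1 (inl bi.2) x).
  by apply: (coord_opK DP) => b i; exact: (h b I i I).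
have fin : (lps p (fun bi => coord s bi.1 (inl bi.2) x) < +oo)%E.
  apply: le_lt_trans (emb_op_lower p0 c01 DP s _) _; rewrite -zE (crd_norm mdT) -EFinM.
  exact: ltry.
by rewrite /emb_map /op_of (mkK mdU)// -zE (crdK mdT).
Qed.

Lemma closed_range_emb_map s : closed (range (emb_map s)).
Proof.
rewrite range_emb_map; apply: closedI.
  apply: (@closed_kernel _ _ _ (fun x => x - iota (pi x)) (1 + Ki * Kp)) => [a x y|x].
    by rewrite pi_lin iota_lin scalerBr addrACA opprD.
  rewrite mulrDl mul1r; apply: le_trans (ler_normB _ _) _; rewrite lerD2l.
  by apply: le_trans (iota_bnd _) _; rewrite -mulrA ler_wpM2l.
apply: closed_bigI => b _; apply: closed_bigI => i _.
have [K hK] := coord_bound s b (inr i).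
by apply: (@closed_kernel _ _ _ (coord s b (inr i) : X -> R^o) K) => // a x y; exact: coord_lin.
Qed.

Lemma blk_at_fin s b k : (lps p (at_block b (blk D (s b) b.1 (fun j => (j == k)%:R))) < +oo)%E.
Proof.
rewrite lps_at_block//; have [K K0 hK] := blk_bounded DP (s b) b.1.
apply: le_lt_trans (hK _) _.
have -> : lps p (fun j : nat + nat => (j == k)%:R : R) = 1%E.
  rewrite (lps_inj p (fun j => (j == k)%:R) (e := fun _ : unit => k)); last by move=> [] [].
  rewrite [X in (_ + X)%E]esum1 ?adde0.
    by rewrite lps_fin /lp_sum (big_pred1 tt)/= ?eqxx ?normr1 ?powR1//; case.
  move=> j /= h; case: eqP => [E|_]; last by rewrite normr0 powR0// gt_eqF.
  by case: h; exists tt.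
by rewrite mule1 ltry.
Qed.

(** The right-half coordinates of one block vanish on the range and form with the vectors y l a
    biorthogonal system. If n vectors spanned the quotient, the identity matrix of size n + 1 would
    factor through dimension n. *)
Lemma infinite_codim_emb_map s : ~ finite_codimension (range (emb_map s)).
Proof.
move=> [n [e he]]; pose b : B := (0, 0)%N.
pose y (l : nat) : X := iota (mT (at_block b (blk D (s b) b.1 (fun j => (j == inr l)%:R)))).
have cy k l : coord s b (inr k) (y l) = (k == l)%:R.
  rewrite /coord /y iotaK (mkK mdT) ?blk_at_fin//.
  by rewrite /coord_op /at_block/=; rewrite (blkK DP).
have [cf hcf] := choice (fun l : nat => he (y l)).
pose P := \matrix_(k < n.+1, i < n) coord s b (inr (k : nat)) (e i).
pose Q := \matrix_(i < n, l < n.+1) cf l i.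
suff : P *m Q = 1%:M by move=> /mulmx1_min; rewrite ltnn.
apply/matrixP => k l; rewrite !mxE.
have := hcf l; rewrite range_emb_map => -[_ /(_ b I k I)] /= /eqP.
rewrite (@linB _ _ R^o (coord s b (inr (k : nat)))) ?subr_eq0; last exact: coord_lin.
rewrite (@lin_sum _ _ R^o (coord s b (inr (k : nat)))); last exact: coord_lin.
rewrite cy => /eqP ->; apply: eq_bigr => i _; by rewrite !mxE mulrC.
Qed.

Lemma Emb_emb_map s : Emb Y X (emb_map s).
Proof.
split.
- split; first exact: emb_map_lin.
  by exists (Ki * C `^ p^-1); exact: emb_map_bound.
- apply: (bounded_below_isomorphism _ (emb_map_lower s)); exact: emb_map_lin.
- exact: closed_range_emb_map.
- exact: infinite_codim_emb_map.
Qed.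

Definition change_op (s s' : B -> bool) :=
  block_diag (fun b x => blk D (s b) b.1 (blk' D' (s' b) b.1 x)).

Lemma change_op_lin s s' : fun_linear (change_op s s').
Proof.
apply: block_diag_lin => b a x y t; rewrite -(blk_lin DP); congr (blk _ _ _ _ t).
by apply/funext => k; rewrite (blk_lin' DP).
Qed.

(** On blocks (m, j) with m >= n the change is the identity. For m < n it is made of D m and its
    inverse, the same for all j, so finitely many bounds suffice. *)
Lemma change_op_bound n : exists2 K : R, 0 <= K & forall s s',
  (forall b, (n <= b.1)%N -> s b = s' b) ->
  forall x, (lps p (change_op s s' x) <= K%:E * lps p x)%E.
Proof.
have /choice[K hK] : forall m : nat, exists K : R, 0 <= K /\ forall t t' x,
    (lps p (blk D t m (blk' D' t' m x)) <= K%:E * lps p x)%E.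
  move=> m; have [K1 K10 h1] := block_bnd (DP m); have [K2 K20 h2] := block_bnd' (DP m).
  exists ((1 + K1) * (1 + K2)); split; first by rewrite mulr_ge0// addr_ge0.
  have h1' t x : (lps p (blk D t m x) <= (1 + K1)%:E * lps p x)%E.
    rewrite EFinD ge0_muleDl ?lee_fin// mul1e; case: t.
      by apply: le_trans (h1 _) _; rewrite leeDr// lps_ge0.
    by rewrite leeDl// mule_ge0// lps_ge0.
  have h2' t x : (lps p (blk' D' t m x) <= (1 + K2)%:E * lps p x)%E.
    rewrite EFinD ge0_muleDl ?lee_fin// mul1e; case: t.
      by apply: le_trans (h2 _) _; rewrite leeDr// lps_ge0.
    by rewrite leeDl// mule_ge0// lps_ge0.
  move=> t t' x; apply: le_trans (h1' _ _) _; rewrite EFinM -muleA.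
  by apply: lee_wpmul2l; rewrite ?lee_fin ?addr_ge0.
have S0 : 0 <= \sum_(m < n) K m by apply: sumr_ge0 => m _; case: (hK m).
exists (1 + \sum_(m < n) K m); first by rewrite addr_ge0.
move=> s s' ss'; apply: block_diag_bound => [|b x]; first by rewrite addr_ge0.
rewrite EFinD ge0_muleDl ?lee_fin// mul1e.
case: (ltnP b.1 n) => bn.
  apply: le_trans ((hK b.1).2 _ _ _) _; apply: le_trans (_ : (\sum_(m < n) K m)%:E * lps p x <= _)%E.
    rewrite lee_wpmul2r ?lps_ge0// lee_fin (bigD1 (Ordinal bn))//= lerDl.
    by apply: sumr_ge0 => m _; case: (hK m).
  by rewrite leeDr// lps_ge0.
by rewrite ss'// (blkK' DP) leeDl// mule_ge0// lps_ge0.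
Qed.

(** The change of blocks on the copy of Y, extended by the identity on the kernel of [pi]. *)
Definition change_map s s' (x : X) : X :=
  x - iota (pi x) + iota (op_of cT mT (change_op s s') (pi x)).

Lemma change_mapP n s s' : (forall b, (n <= b.1)%N -> s b = s' b) ->
  [/\ bounded_operators X X (change_map s s'),
      forall f, change_map s s' (emb_map s' f) = emb_map s f &
      forall x, change_map s s' (change_map s' s x) = x].
Proof.
move=> ss'; have [K K0 hK] := change_op_bound n.
have h1 := hK _ _ ss'.
have h2 := hK _ _ (fun b bn => esym (ss' b bn)).
have lin1 := op_of_lin mdT mdT (change_op_lin s s') h1.
have bnd1 := op_of_bound p0 mdT mdT K0 h1.
split.
- split.
    move=> a x y; rewrite /change_map !pi_lin lin1 !iota_lin !scalerDr !scalerN.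
    by rewrite opprD (addrACA (a *: x)) (addrACA (a *: x - a *: iota (pi x))).
  exists (1 + Ki * Kp + Ki * (K `^ p^-1 * Kp)) => x.
  rewrite !mulrDl mul1r; apply: le_trans (ler_normD _ _) _; apply: lerD.
    apply: le_trans (ler_normB _ _) _; rewrite lerD2l.
    by apply: le_trans (iota_bnd _) _; rewrite -mulrA ler_wpM2l.
  apply: le_trans (iota_bnd _) _; rewrite -!mulrA ler_wpM2l//.
  by apply: le_trans (bnd1 _) _; rewrite ler_wpM2l// powR_ge0.
- move=> f; rewrite /change_map /emb_map iotaK subrr add0r; congr iota.
  rewrite /op_of (crd_op mdU mdT (eopU s')); congr mT; apply/funext => -[b k].
  by rewrite /change_op /emb_op /block_diag/= (blkK DP).
- move=> x; have pE : pi (change_map s' s x) = op_of cT mT (change_op s' s) (pi x).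
    rewrite /change_map -[X in pi (X + _)]scale1r pi_lin scale1r iotaK.
    have := pi_lin (-1) (iota (pi x)) x; rewrite !scaleN1r iotaK addNr addrC => ->.
    by rewrite add0r.
  rewrite {1}/change_map pE {1}/change_map addrK.
  rewrite (_ : op_of _ _ _ (op_of _ _ _ _) = pi x) ?subrK//.
  rewrite /op_of (crd_op mdT mdT h2) -[RHS](crdK mdT); congr mT; apply/funext => -[b k].
  by rewrite /change_op /block_diag/= (blkK DP) (blkK' DP).
Qed.

Lemma GL_change n s s' : (forall b, (n <= b.1)%N -> s b = s' b) ->
  GL X (change_map s s') /\ (emb_map s = change_map s s' \o emb_map s').
Proof.
move=> ss'; have [b1 e1 i1] := change_mapP ss'.
have [b2 e2 i2] := change_mapP (fun b bn => esym (ss' b bn)).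
split; last by apply/funext => f /=; rewrite e1.
by split=> //; exists (change_map s' s); split.
Qed.

(** On block b the first embedding is the bad one and the second the plain inclusion. Feeding the
    block to A and reading the left half of the same block is therefore a left inverse of the bad
    embedding number b.1, of norm at most Kp M Ki. *)
Lemma bad_block_index s s' b (A : X -> X) (M : R) : bounded_operators X X A ->
  0 <= M -> (forall x, `|A x| <= M * `|x|) ->
  (forall f, A (emb_map s f) = emb_map s' f) -> s b = true -> s' b = false ->
  b.1%:R <= (Kp * M * Ki) `^ p.
Proof.
move=> [Alin _] M0 AM AE sb sb'.
pose S (y : nat + nat -> R) (i : nat) := cT (pi (A (iota (mT (at_block b y))))) (b, inl i).
have KM0 : 0 <= Kp * M * Ki by rewrite !mulr_ge0.
apply: (block_bad (DP b.1) (S := S)).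
- move=> a x y xf yf i; rewrite /S -(crd_lin mdT) -pi_lin -Alin -iota_lin -(mk_lin mdT) ?lps_at_block//.
  congr (cT (pi (A (iota (mT _)))) _); apply/funext => -[b' k]; rewrite /at_block/=.
  by case: eqP; rewrite // mulr0 addr0.
- move=> x xf i; rewrite /S.
  have E : mT (at_block b (D b.1 (sinl x))) = op_of cU mT (eop s) (mU (at_block b x)).
    by rewrite /op_of (mkK mdU) ?lps_at_block// (emb_op_at_block DP) sb.
  rewrite E -/(emb_map s _) AE crd_pi_emb (mkK mdU) ?lps_at_block// (emb_op_at_block DP) sb'.
  by rewrite /at_block/= eqxx.
move=> y yf; pose g := mT (at_block b y).
apply: le_trans (_ : (lps p (cT (pi (A (iota g)))) <= _)%E).
  by apply: (@lps_inj_le _ p _ _ (fun i => (b, inl i)) (cT (pi (A (iota g))))) => i j [].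
rewrite (crd_norm mdT) -(lps_at_block p0 b y) -(mk_norm mdT) ?lps_at_block// -EFinM lee_fin.
rewrite -powRM//; apply: ge0_ler_powR; rewrite ?nnegrE ?(ltW p0) ?mulr_ge0//.
apply: le_trans (pi_bnd _) _; rewrite -!mulrA ler_wpM2l//.
by apply: le_trans (AM _) _; rewrite ler_wpM2l.
Qed.

(** A block where s has the bad embedding and s' has not is excluded by the inverse of A, the
    opposite case by A itself; hence bounds for both enter N. *)
Lemma position_emb_map s s' (A : X -> X) : GL X A -> emb_map s = A \o emb_map s' ->
  exists n, forall b, (n <= b.1)%N -> s b = s' b.
Proof.
move=> [bA [A' [bA' AK A'K]]] sE.
have [M1 M10 h1] : exists2 M : R, 0 <= M & forall x, `|A x| <= M * `|x|.
  case: bA => _ [M hM]; exists `|M| => // x; apply: le_trans (hM x) _.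
  by rewrite ler_wpM2r// ler_norm.
have [M2 M20 h2] : exists2 M : R, 0 <= M & forall x, `|A' x| <= M * `|x|.
  case: bA' => _ [M hM]; exists `|M| => // x; apply: le_trans (hM x) _.
  by rewrite ler_wpM2r// ler_norm.
pose N := Num.truncn ((Kp * M1 * Ki) `^ p + (Kp * M2 * Ki) `^ p).
have hN : (Kp * M1 * Ki) `^ p + (Kp * M2 * Ki) `^ p < N.+1%:R by rewrite truncnS_gt.
have hb (b : B) : (N < b.1)%N -> ((Kp * M1 * Ki) `^ p < b.1%:R) /\ ((Kp * M2 * Ki) `^ p < b.1%:R).
  move=> Nb; have hb : N.+1%:R <= b.1%:R :> R by rewrite ler_nat.
  by split; apply: lt_le_trans hb; apply: le_lt_trans hN; rewrite ?lerDl ?lerDr powR_ge0.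
exists N.+1 => b Nb; have [hb1 hb2] := hb b Nb.
case sb : (s b); case sb' : (s' b) => //.
  have := @bad_block_index s s' b A' M2 bA' M20 h2 _ sb sb'; rewrite leNgt hb2/=.
  by case/(_ _)/negP => // f; rewrite sE /= AK.
have := @bad_block_index s' s b A M1 bA M10 h1 _ sb' sb; rewrite leNgt hb1/=.
by case/(_ _)/negP => // f; rewrite sE.
Qed.

Lemma emb_map_cont s f (e : R) : 0 < e -> exists N, forall s',
  (forall b, (pickle b < N)%N -> s b = s' b) -> `|emb_map s f - emb_map s' f| <= e.
Proof.
move=> e0; have Ki1 : 0 < Ki + 1 by rewrite ltr_wpDl.
have d0 : 0 < e / (Ki + 1) by rewrite divr_gt0.
have dp : 0 < (e / (Ki + 1)) `^ p by rewrite powR_gt0.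
have [N hN] := emb_op_cont p0 C1 DP dp (crd_fin mdU f).
exists N => s' ss'; have h := hN s s' ss'.
have iB x y : iota (x - y) = iota x - iota y.
  by rewrite addrC -scaleN1r iota_lin scaleN1r addrC.
rewrite /emb_map -iB; apply: le_trans (iota_bnd _) _.
have w : `|op_of cU mT (eop s) f - op_of cU mT (eop s') f| <= e / (Ki + 1).
  set g := op_of _ _ _ _ - _.
  have := @le_norm_powR _ _ p0 `|g| _ 1 (normr_ge0 _) (ltW d0) ler01.
  rewrite powR1 !mul1r; apply; rewrite /g.
  rewrite -lee_fin -(crd_norm mdT); apply: le_trans h; rewrite le_eqVlt; apply/orP; left; apply/eqP.
  apply: eq_lps => t; rewrite addrC -scaleN1r (crd_lin mdT) mulN1r addrC.
  by rewrite !(crd_op mdU mdT (eopU _)).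
apply: le_trans (_ : (Ki + 1) * (e / (Ki + 1)) <= _).
  by apply: ler_pM => //; rewrite lerDl.
by rewrite mulrC divfK// gt_eqF.
Qed.

End emb_family.

(** * The reduction of E1 *)

Section E1_reduction.
Context {R : realType}.

Lemma borel0 (T : topologicalType) : borel (@set0 T).
Proof. exact: sigma_algebra0. Qed.

Lemma borelC (T : topologicalType) (A : set T) : borel A -> borel (~` A).
Proof. by move=> BA; rewrite -setTD; exact: sigma_algebraCD BA. Qed.

Lemma borel_bigcup (T : topologicalType) (F : nat -> set T) :
  (forall k, borel (F k)) -> borel (\bigcup_k F k).
Proof. exact: sigma_algebra_bigcup. Qed.

Lemma open_borel (T : topologicalType) (A : set T) : open A -> borel A.
Proof. by move=> oA; exact: sub_sigma_algebra oA. Qed.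

Lemma borel_map_open (E F : topologicalType) (f : E -> F) :
  (forall W, open W -> borel (f @^-1` W)) -> borel_map f.
Proof.
move=> fo B; rewrite /borel.
have sE : sigma_algebra [set: E] (@borel E) by exact: smallest_sigma_algebra.
have [s0 sD sU] := sE.
apply: (@smallest_sub _ (sigma_algebra [set: F]) _ [set B | borel (f @^-1` B)]) => //.
split=> [|A BA|A BA] /=; first by rewrite preimage_set0.
  by rewrite -[X in borel X](_ : [set: E] `\` f @^-1` A = _)//; exact: sD.
by rewrite preimage_bigcup; apply: sU.
Qed.

(** The lower Dedekind cut of each coordinate. As the inequality is strict, each bit is the
    indicator of an open set: the coding is Borel although not continuous. *)
Definition bits (x : nat -> R) (b : nat * nat) : bool :=
  if @unpickle rat b.2 is Some q then ratr q < x b.1 else false.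

Lemma bits_pickle (x : nat -> R) n q : bits x (n, pickle q) = (ratr q < x n).
Proof. by rewrite /bits; have -> : @unpickle rat (n, pickle q).2 = Some q by exact: pickleK. Qed.

Lemma bits_eq (x y : nat -> R) n : (forall j, bits x (n, j) = bits y (n, j)) -> x n = y n.
Proof.
move=> h; apply/eqP; rewrite eq_le !leNgt; apply/andP; split; apply/negP => xy.
  have [q] := rat_in_itvoo xy; rewrite in_itv/= => /andP[q1 q2].
  by have := h (pickle q); rewrite !bits_pickle q2 ltNge (ltW q1).
have [q] := rat_in_itvoo xy; rewrite in_itv/= => /andP[q1 q2].
by have := h (pickle q); rewrite !bits_pickle q2 ltNge (ltW q1).
Qed.

Lemma E1_bits (x y : {ptws nat -> R}) :
  E1 x y <-> exists n, forall b : nat * nat, (n <= b.1)%N -> bits x b = bits y b.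
Proof.
split=> -[n h]; exists n; first by move=> b nb; rewrite /bits h.
by move=> m nm; apply: bits_eq => j; exact: h.
Qed.

Lemma open_bits (b : nat * nat) : open [set x : {ptws nat -> R} | bits x b].
Proof.
rewrite /bits; case: unpickle => [q|]; last first.
  rewrite (_ : [set _ | _] = set0); first exact: open0.
  by apply/seteqP; split.
have -> : [set x : {ptws nat -> R} | ratr q < x b.1] = proj b.1 @^-1` [set y : R | ratr q < y] by [].
apply: open_comp; last exact: open_gt.
by move=> x _; exact: (@proj_continuous nat (fun=> R) b.1 x).
Qed.

Definition cylinder (t : seq bool) : set {ptws nat -> R} :=
  [set x | forall k, (k < size t)%N ->
     (if @unpickle (nat * nat)%type k is Some b then bits x b else false) = nth false t k].

Lemma borel_cylinder t : borel (cylinder t).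
Proof.
have -> : cylinder t = ~` \bigcup_k (if (k < size t)%N then
    ~` [set x | (if @unpickle (nat * nat)%type k is Some b then bits x b else false) = nth false t k]
    else set0).
  apply/seteqP; split=> [x h [k _]|x h k kt].
    by case: ifP => // kt; apply; exact: h.
  by apply: contrapT => nh; apply: h; exists k => //; rewrite kt.
refine (borelC _); refine (borel_bigcup _) => k.
case: ifP => _; last exact: borel0.
refine (borelC _).
have ob b : borel [set x : {ptws nat -> R} | bits x b] := open_borel (open_bits b).
case: unpickle => [b|]; last first.
  case: (nth false t k).
    by rewrite (_ : [set _ | _] = set0); [exact: borel0|apply/seteqP; split].
  by rewrite (_ : [set _ | _] = setT); [exact: (open_borel openT)|apply/seteqP; split].
case: (nth false t k); first exact: ob.
rewrite (_ : [set _ | _] = ~` [set x : {ptws nat -> R} | bits x b]); first exact: (borelC (ob b)).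
by apply/seteqP; split=> x /=; case: bits.
Qed.

(** What remains is Borel measurability: the embedding depends continuously on the bits in the
    strong operator topology, and the bits are Borel in x. *)
Lemma E1_reducible_position (p : R) (Y X : normedModType R)
    (crd : Y -> nat -> R) (mk : (nat -> R) -> Y) (iota : Y -> X) (pi : X -> Y) (Ki Kp : R) :
  0 < p -> bad_embeddings p -> lp_model p crd mk ->
  (forall a x y, iota (a *: x + y) = a *: iota x + iota y) ->
  (forall a x y, pi (a *: x + y) = a *: pi x + pi y) ->
  (forall x, `|iota x| <= Ki * `|x|) -> (forall x, `|pi x| <= Kp * `|x|) ->
  cancel iota pi -> 0 <= Ki -> 0 <= Kp ->
  borel_reducible (@E1 R) (position Y X).
Proof.
move=> p0 bad md iotaL piL iotaB piB iotaK Ki0 Kp0.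
have [c [C [D [D' [c01 C1 DP]]]]] := bad_blocks p0 bad.
have [eU [eU' [eUK eUK']]] : exists (e : nat * nat * nat -> nat) e', cancel e e' /\ cancel e' e.
  by apply: (@infinite_countType_bij _ (fun n => ((n, 0), 0)%N)) => a b [].
have [eT [eT' [eTK eTK']]] : exists (e : nat * nat * (nat + nat) -> nat) e', cancel e e' /\ cancel e' e.
  by apply: (@infinite_countType_bij _ (fun n => ((n, 0), inl 0)%N)) => a b [].
have mdU := lp_model_reindex md eUK eUK'.
have mdT := lp_model_reindex md eTK eTK'.
set cU := (fun f w => crd f (eU w)) in mdU; set mU := (fun x => mk _) in mdU.
set cT := (fun f w => crd f (eT w)) in mdT; set mT := (fun x => mk _) in mdT.
pose em s := emb_map D cU mT iota s.
have emE s : Emb Y X (em s).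
  exact: (Emb_emb_map p0 c01 C1 DP mdU mdT iotaL piL iotaB piB iotaK Ki0).
pose f (x : {ptws nat -> R}) : Emb Y X := exist _ (em (bits x)) (mem_set (emE (bits x))).
exists f; split; last first.
  move=> x y; rewrite E1_bits; split=> [[n h]|[A [GA AE]]].
    have [G1 G2] := GL_change p0 C1 DP mdU mdT iotaL piL iotaB piB iotaK Ki0 h.
    by eexists; split; [exact: G1|exact: G2].
  exact: (position_emb_map p0 C1 DP mdU mdT iotaL piL iotaB piB iotaK Ki0 Kp0 GA AE).
apply: borel_map_open => _ [W oW <-].
(* The preimage of W is the union of the cylinders contained in it. Cylinders are indexed by finite
   bit sequences, so the union is countable. That every point of the preimage lies in a good one
   follows from continuity: otherwise there would be points outside the preimage, agreeing with x on
   ever more bits, whose embeddings converge to that of x. *)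
pose good (t : seq bool) := cylinder t `<=` [set x | W (em (bits x))].
pose F k : set {ptws nat -> R} := if @unpickle (seq bool) k is Some t then
    (if `[< good t >] then cylinder t else set0) else set0.
have FB k : borel (F k).
  rewrite /F; case: unpickle => [t|]; last exact: borel0.
  by case: asboolP => _; [exact: borel_cylinder|exact: borel0].
have -> : f @^-1` (set_val @^-1` W) = \bigcup_k F k; last exact: (borel_bigcup FB).
  apply/seteqP; split=> [x Wx|x [k _]]; last first.
    rewrite /F; case: unpickle => [t|]; last by case.
    by case: asboolP => [gt tx|_ []]; have := gt x tx.
  pose tn n := mkseq (fun k => if @unpickle (nat * nat)%type k is Some b then bits x b else false) n.
  have xt n : cylinder (tn n) x.
    by move=> k; rewrite size_mkseq => kn; rewrite nth_mkseq.
  suff [n gn] : exists n, good (tn n).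
    exists (pickle (tn n)); [by []|rewrite /F pickleK].
    by case: asboolP.
  apply: contrapT => /forallNP ng.
  have /choice[y hy] : forall n, exists y, cylinder (tn n) y /\ ~ W (em (bits y)).
    by move=> n; have /existsNP[y /not_implyP[]] := ng n; exists y.
  have yc : (fun n => em (bits (y n)) : {ptws Y -> X}) @ \oo --> (em (bits x) : {ptws Y -> X}).
    apply/pointwise_cvgP => g; apply/cvgrPdist_le => e e0.
    have [N hN] := emb_map_cont p0 C1 DP mdU mdT iotaL iotaB Ki0 (bits x) g e0.
    exists N => // n Nn; apply: hN => b bN.
    have := (hy n).1 (pickle b); rewrite size_mkseq => /(_ (leq_trans bN Nn)).
    by rewrite nth_mkseq ?pickleK// (leq_trans bN Nn).
  have [N _ hN] := yc _ (open_nbhs_nbhs (conj oW Wx)).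
  by apply: (hy N).2; exact: (hN N (leqnn N)).

Qed.

End E1_reduction.

(** * The spaces l_p and L_p *)

Section Lspace_facts.
Context d (T : measurableType d) {R : realType}.
Variables (mu : {measure set T -> \bar R}) (p : R) (p1 : 1 <= p).
Let p1e : (1 <= p%:E)%E := p1.
Let p0 : 0 < p. Proof. exact: lt_le_trans p1. Qed.
Local Notation Lp := (@LspaceType _ T R mu p%:E p1).

Lemma integral_norm_Lfun (f : LfunType mu p1e) :
  (\int[mu]_x (`|f x| `^ p)%:E)%E = ((fine 'N[mu]_p%:E[EFin \o f]%E) `^ p)%:E.
Proof.
have fn : 'N[mu]_p%:E[EFin \o f]%E \is a fin_num.
  have /andP[_] := LfunP f; rewrite inE/= /finite_norm => h.
  by rewrite ge0_fin_numE// Lnorm_ge0.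
rewrite -[RHS]/((fine 'N[mu]_p%:E[EFin \o f])%:E `^ p)%E fineK// poweR_Lnorm ?gt_eqF//.
Qed.

Lemma norm_Lspace (f : LfunType mu p1e) :
  (\int[mu]_x (`|f x| `^ p)%:E)%E = ((`|(Lspace_of_Lfun f : Lp)|) `^ p)%:E.
Proof. by rewrite integral_norm_Lfun -Lspace_norm_of. Qed.

Lemma norm_Lspace_repr (f : Lp) :
  (\int[mu]_x (`|Lfun_of_Lspace f x| `^ p)%:E)%E = (`|f| `^ p)%:E.
Proof. by rewrite norm_Lspace Lfun_of_LspaceK. Qed.

Lemma mem_Lfun (g : T -> R) : measurable_fun setT g ->
  (\int[mu]_x (`|g x| `^ p)%:E < +oo)%E -> g \in Lfun mu p%:E.
Proof.
move=> mg gf; apply/andP; split; rewrite inE//= /finite_norm unlock.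
exact: poweR_lty.
Qed.

(** Functions outside L_p are sent to the default value 0. *)
Definition Lspace_mk (g : T -> R) : Lp :=
  match pselect (g \in Lfun mu p%:E) with
  | left h => Lspace_of_Lfun (Lfun_Sub p1e h)
  | right _ => 0
  end.

Lemma Lspace_mk_norm (g : T -> R) : g \in Lfun mu p%:E ->
  (`|Lspace_mk g| `^ p)%:E = (\int[mu]_x (`|g x| `^ p)%:E)%E.
Proof. by move=> h; rewrite /Lspace_mk; case: pselect => // h'; rewrite -norm_Lspace. Qed.

Lemma Lspace_mk_ae (g : T -> R) : g \in Lfun mu p%:E ->
  (Lfun_of_Lspace (Lspace_mk g) : T -> R) = g %[ae mu].
Proof. by move=> h; rewrite /Lspace_mk; case: pselect => // h'; exact: (Lspace_of_LfunK (Lfun_Sub p1e h')). Qed.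

Lemma Lspace_repr_lin a (f g : Lp) : (Lfun_of_Lspace (a *: f + g) : T -> R) =
  (fun x => a * Lfun_of_Lspace f x + Lfun_of_Lspace g x) %[ae mu].
Proof.
have := Lspace_of_LfunK (a *: Lfun_of_Lspace f + Lfun_of_Lspace g).
rewrite -[X in Lfun_of_Lspace X](_ : a *: f + g = _) => [h|].
  by apply: filterS h => x /[apply] ->.
rewrite -{1}(Lfun_of_LspaceK f) -{1}(Lfun_of_LspaceK g).
by rewrite -[a *: Lspace_of_Lfun _]Lspace_of_LfunZ -[_ + _ in LHS]Lspace_of_LfunD.
Qed.

Lemma Lspace_eqP (f g : Lp) : (Lfun_of_Lspace f : T -> R) = Lfun_of_Lspace g %[ae mu] -> f = g.
Proof.
by move=> h; rewrite -(Lfun_of_LspaceK f) -(Lfun_of_LspaceK g); apply/Lspace_of_LfunP.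
Qed.

End Lspace_facts.

Section ellp_model.
Context {R : realType} (p : R) (p1 : 1 <= p).
Let p0 : 0 < p. Proof. exact: lt_le_trans p1. Qed.
Local Notation mu := (@counting nat R).

Lemma ae_counting (P : nat -> Prop) : {ae mu, forall x, P x} -> forall x, P x.
Proof.
move=> [A [_ A0 PA]] x; apply: contrapT => nPx.
have Ax : A x by apply: PA.
move: A0; rewrite /counting; case: asboolP => // fA [/eqP].
by rewrite pnatr_eq0 finmap.cardfs_eq0 => /eqP A0; have := in_fset_set fA x; rewrite A0 mem_set.
Qed.

Definition ell_crd (f : ellp p1) (k : nat) : R := @Lfun_of_Lspace _ _ R mu p%:E p1 f k.
Definition ell_mk (x : nat -> R) : ellp p1 := @Lspace_mk _ _ R mu p p1 x.

Lemma integral_counting (x : nat -> R) :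
  (\int[mu]_k (`|x k| `^ p)%:E)%E = lps p x.
Proof.
rewrite ge0_integral_count; last by move=> k; rewrite lee_fin powR_ge0.
by rewrite nneseries_esumT// => k; rewrite lee_fin powR_ge0.
Qed.

Lemma ell_mem (x : nat -> R) : (lps p x < +oo)%E -> x \in Lfun mu p%:E.
Proof. by move=> xf; apply: mem_Lfun => //; rewrite integral_counting. Qed.

Lemma ell_model : lp_model p ell_crd ell_mk.
Proof.
split.
- move=> a f g v.
  exact: (ae_counting (Lspace_repr_lin a f g)) v I.
- by move=> f; rewrite -integral_counting norm_Lspace_repr.
- move=> f; apply: Lspace_eqP; apply: Lspace_mk_ae; apply: ell_mem.
  by rewrite -integral_counting norm_Lspace_repr ltry.
- move=> x xf; apply/funext => k.
  exact: (ae_counting (@Lspace_mk_ae _ _ _ mu p p1 x (ell_mem xf)) k I).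
Qed.

End ellp_model.

Theorem E1_reducible_ellp {R : realType} (p : R) (p1 : 1 <= p) : bad_embeddings p ->
  borel_reducible (@E1 R) (position (ellp p1) (ellp p1)).
Proof.
move=> bad; have p0 : 0 < p by exact: lt_le_trans p1.
apply: (@E1_reducible_position R p _ _ _ _ id id 1 1 p0 bad (ell_model p1)) => //.
- by move=> x; rewrite mul1r.
- by move=> x; rewrite mul1r.
Qed.

(** The graph of y^p lies above its tangent at a. It is Young's inequality for y and a^(p-1) when p
    > 1, with p = 1 treated apart. *)
Lemma powR_tangent {R : realType} (p y a : R) : 1 <= p -> 0 <= y -> 0 <= a ->
  p * a `^ (p - 1) * y <= y `^ p + (p - 1) * a `^ p.
Proof.
move=> p1 y0 a0; have p0 : 0 < p by exact: lt_le_trans p1.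
have [pE|pn1] := eqVneq p 1.
  by rewrite pE subrr mul0r addr0 powRr1// powRr0 !mul1r.
have pp : 0 < p - 1 by rewrite subr_gt0 lt_neqAle eq_sym pn1.
have q0 : 0 < p / (p - 1) by rewrite divr_gt0.
have pq : p^-1 + (p / (p - 1))^-1 = 1 by field; rewrite !gt_eqF.
have := conjugate_powR y0 (powR_ge0 a (p - 1)) p0 q0 pq.
rewrite -powRrM (_ : (p - 1) * (p / (p - 1)) = p); last by field; rewrite gt_eqF.
rewrite -(ler_pM2l p0) => h; rewrite -mulrA [_ `^ (p - 1) * y]mulrC; apply: le_trans h _.
rewrite le_eqVlt; apply/orP; left; apply/eqP; field; by rewrite !gt_eqF.
Qed.

(** * A complemented copy of l_p in L_p of a finite measure *)

Section Lspace_partition.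
Context d (T : measurableType d) {R : realType}.
Variables (mu : {measure set T -> \bar R}) (p : R) (p1 : 1 <= p).
Let p0 : 0 < p. Proof. exact: lt_le_trans p1. Qed.
Hypothesis muT : mu [set: T] \is a fin_num.
Variable kappa : T -> nat.
Local Notation F k := (kappa @^-1` [set k]).
Hypotheses (mF : forall k, measurable (F k)) (F0 : forall k, (0 < mu (F k))%E).
Local Notation Lp := (@LspaceType _ T R mu p%:E p1).

Let muF k : mu (F k) \is a fin_num.
Proof.
rewrite ge0_fin_numE//; apply: le_lt_trans (_ : mu setT < +oo)%E; last by rewrite ltey_eq muT.
by apply: le_measure; rewrite ?inE.
Qed.

Definition cell_mass k : R := fine (mu (F k)).
Local Notation m := cell_mass.

Lemma cell_massE k : (m k)%:E = mu (F k). Proof. exact: fineK. Qed.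

Lemma cell_mass_gt0 k : 0 < m k.
Proof. by rewrite -lte_fin cell_massE. Qed.

Lemma integral_cells (f : T -> \bar R) : measurable_fun setT f -> (forall x, 0 <= f x)%E ->
  (\int[mu]_x f x = \esum_(k in [set: nat]) \int[mu]_(x in F k) f x)%E.
Proof.
move=> mf f0.
have E : [set: T] = \bigcup_k F k.
  by apply/seteqP; split=> // x _; exists (kappa x).
rewrite E ge0_integral_bigcup//; last 2 first.
- by rewrite -E.
- by move=> i j _ _ [x [/= -> ->]].
by rewrite nneseries_esumT// => k; exact: integral_ge0.
Qed.

Lemma measurable_kappa : measurable_fun setT kappa.
Proof.
move=> _ Y _; rewrite setTI (_ : kappa @^-1` Y = \bigcup_(k in Y) F k).
  by apply: bigcup_measurable => k _; exact: mF.
by apply/seteqP; split=> [x Yx|x [k Yk /= ->]] //; exists (kappa x).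
Qed.

(** The exponent normalises the indicator of each cell in L_p, which makes this an isometry from
    l_p. *)
Definition cell_step (x : nat -> R) (t : T) : R := x (kappa t) * m (kappa t) `^ (- p^-1).

Lemma measurable_cell_step x : measurable_fun setT (cell_step x).
Proof.
exact: (measurableT_comp (f := fun k => x k * m k `^ (- p^-1)) _ measurable_kappa).
Qed.

Lemma integral_cell_step x : (\int[mu]_t (`|cell_step x t| `^ p)%:E)%E = lps p x.
Proof.
rewrite integral_cells; last 2 first.
- apply/measurable_EFinP/(measurableT_comp (measurable_powR _)).
  by apply: measurableT_comp => //; exact: measurable_cell_step.
- by move=> t; rewrite lee_fin powR_ge0.
apply: eq_esum => k _.
rewrite (eq_integral (cst (`|x k| `^ p * (m k)^-1)%:E)); last first.
  move=> t /set_mem /= tk; rewrite /cell_step tk normrM powRM// (ger0_norm (powR_ge0 _ _)).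
  by rewrite -powRrM mulNr mulVf ?gt_eqF// powR_inv1// ltW// cell_mass_gt0.
rewrite integral_cst// -cell_massE -EFinM -mulrA mulVf ?mulr1//.
by rewrite gt_eqF// cell_mass_gt0.
Qed.

Lemma cell_step_Lfun x : (lps p x < +oo)%E -> cell_step x \in Lfun mu p%:E.
Proof.
by move=> xf; apply: mem_Lfun; [exact: measurable_cell_step|rewrite integral_cell_step].
Qed.

(** Coefficients biorthogonal to the normalised indicators. Composed with [cell_step] this is the
    conditional expectation on the cells, a projection of norm at most one. *)
Definition cell_avg (f : T -> R) (k : nat) : R :=
  m k `^ (p^-1 - 1) * (\int[mu]_(t in F k) f t)%R.

Lemma Lfun_cell_integrable (f : T -> R) k : f \in Lfun mu p%:E -> mu.-integrable (F k) (EFin \o f).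
Proof.
move=> fp; have /Lfun1_integrable fi : f \in Lfun mu 1.
  by apply: (Lfun_subset (lexx 1%E) _ muT _ fp); rewrite lee_fin.
exact: integrableS fi.
Qed.

(** Jensen's inequality on one cell: the tangent inequality for |f t| at the mean a of |f| over the
    cell is integrated, and the tangent terms add up to a^p times the mass of the cell. *)
Lemma cell_avg_le (f : T -> R) k : f \in Lfun mu p%:E ->
  ((`|cell_avg f k| `^ p)%:E <= \int[mu]_(t in F k) (`|f t| `^ p)%:E)%E.
Proof.
move=> fp; have fi := Lfun_cell_integrable k fp.
have mf : measurable_fun setT f by have /andP[] := fp; rewrite inE.
have mfk : measurable_fun (F k) f by apply: measurable_funTS.
have mabs : measurable_fun (F k) (fun t => (`|f t|)%:E) by apply/measurable_EFinP; exact: measurableT_comp.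
have mpow : measurable_fun (F k) (fun t => (`|f t| `^ p)%:E).
  by apply/measurable_EFinP/(measurableT_comp (measurable_powR _)); exact: measurableT_comp.
have m0 := cell_mass_gt0 k.
have fi' := integrable_abse fi.
have Nfin : (\int[mu]_(t in F k) (`|f t|)%:E)%E \is a fin_num by exact: integrable_fin_num.
pose N := fine (\int[mu]_(t in F k) (`|f t|)%:E)%E.
have NE : (\int[mu]_(t in F k) (`|f t|)%:E)%E = N%:E by rewrite fineK.
have N0 : 0 <= N by rewrite -lee_fin -NE; apply: integral_ge0 => t _; rewrite lee_fin.
pose a := N / m k; have a0 : 0 <= a by rewrite divr_ge0// ltW.
have intp : (0 <= \int[mu]_(t in F k) (`|f t| `^ p)%:E)%E.
  by apply: integral_ge0 => t _; rewrite lee_fin powR_ge0.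
have step1 : (\int[mu]_(t in F k) ((p * a `^ (p - 1))%:E * (`|f t|)%:E) <=
    \int[mu]_(t in F k) ((`|f t| `^ p)%:E + ((p - 1) * a `^ p)%:E))%E.
  apply: ge0_le_integral => //.
  - by move=> t _; rewrite -EFinM lee_fin !mulr_ge0 ?powR_ge0 ?(ltW p0).
  - exact: measurable_funeM.
  - exact: emeasurable_funD.
  - by move=> t _; rewrite -EFinM -EFinD lee_fin; exact: powR_tangent.
have pp : 0 <= p - 1 by rewrite subr_ge0.
have c0 : 0 <= (p - 1) * a `^ p by rewrite mulr_ge0 ?powR_ge0.
have main : ((a `^ p * m k)%:E <= \int[mu]_(t in F k) (`|f t| `^ p)%:E)%E.
  move: step1; rewrite ge0_integralZl//; last by rewrite lee_fin mulr_ge0 ?powR_ge0 ?(ltW p0).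
  rewrite ge0_integralD//.
  rewrite NE (integral_cst _ (mF k)) -cell_massE -!EFinM.
  have -> : p * a `^ (p - 1) * N = a `^ p * m k + (p - 1) * a `^ p * m k.
    have -> : N = a * m k by rewrite /a divfK// gt_eqF.
    have [->|an0] := eqVneq a 0; first by rewrite (powR0 (lt0r_neq0 p0)) !(mul0r, mulr0) addr0.
    have -> : a `^ p = a `^ (p - 1) * a.
      by rewrite -{3}(powRr1 a0) -powRD ?an0 ?implybT// subrK.
    by ring.
  by rewrite EFinD leeD2rE.
apply: le_trans main; rewrite lee_fin /cell_avg normrM (ger0_norm (powR_ge0 _ _)).
rewrite powRM ?powR_ge0// -powRrM.
have -> : a `^ p * m k = m k `^ ((p^-1 - 1) * p) * N `^ p.
  rewrite /a powRM// ?invr_ge0 ?(ltW m0)// -powR_inv1 ?(ltW m0)// -powRrM mulN1r.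
  rewrite -mulrA mulrC; congr (_ * _); rewrite -{2}(powRr1 (ltW m0)) -powRD ?(gt_eqF m0) ?implybT//.
  by congr (_ `^ _); field; rewrite gt_eqF.
rewrite ler_wpM2l ?powR_ge0//; apply: ge0_ler_powR; rewrite ?nnegrE ?(ltW p0)//.
apply: le_trans (le_normr_Rintegral _ fi) _ => //.
Qed.

Lemma lps_cell_avg (f : T -> R) : f \in Lfun mu p%:E ->
  (lps p (cell_avg f) <= \int[mu]_t (`|f t| `^ p)%:E)%E.
Proof.
move=> fp; rewrite integral_cells; last 2 first.
- apply/measurable_EFinP/(measurableT_comp (measurable_powR _)).
  by apply: measurableT_comp => //; have /andP[] := fp; rewrite inE.
- by move=> t; rewrite lee_fin powR_ge0.
by apply: le_esum => k _; exact: cell_avg_le.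
Qed.

Lemma cell_avg_ae (f g : T -> R) : f \in Lfun mu p%:E -> g \in Lfun mu p%:E ->
  f = g %[ae mu] -> cell_avg f = cell_avg g.
Proof.
move=> fp gp fg; apply/funext => k; rewrite /cell_avg; congr (_ * fine _).
have mf : measurable_fun setT f by have /andP[] := fp; rewrite inE.
have mg : measurable_fun setT g by have /andP[] := gp; rewrite inE.
apply: ae_eq_integral => //; try by apply/measurable_EFinP; exact: measurable_funTS.
by apply: filterS fg => x /= + _ => /(_ I) ->.
Qed.

Lemma cell_avg_lin a (f g : T -> R) : f \in Lfun mu p%:E -> g \in Lfun mu p%:E ->
  forall k, cell_avg (fun t => a * f t + g t) k = a * cell_avg f k + cell_avg g k.
Proof.
move=> fp gp k; rewrite /cell_avg.
have fi := Lfun_cell_integrable k fp; have gi := Lfun_cell_integrable k gp.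
rewrite RintegralD//; last first.
  by have := integrableZl (mF k) a fi.
by rewrite RintegralZl// mulrDr mulrCA.
Qed.

Lemma cell_avg_step x k : cell_avg (cell_step x) k = x k.
Proof.
rewrite /cell_avg /Rintegral (eq_integral (cst (x k * m k `^ (- p^-1))%:E)); last first.
  by move=> t /set_mem /= tk; rewrite /cell_step tk.
rewrite integral_cst// -cell_massE -EFinM/= mulrC -!mulrA -[RHS]mulr1; congr (_ * _).
have m0 := cell_mass_gt0 k.
rewrite -{2}(powRr1 (ltW m0)) mulrC -mulrA -!powRD ?(gt_eqF m0) ?implybT//.
by rewrite -[RHS](powRr0 (m k)); congr (_ `^ _); ring.
Qed.

Theorem E1_reducible_partition : bad_embeddings p ->
  borel_reducible (@E1 R) (position (ellp p1) Lp).
Proof.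
move=> bad; have md := ell_model p1.
pose iota (f : ellp p1) : Lp := Lspace_mk mu p1 (cell_step (ell_crd f)).
pose pi (g : Lp) : ellp p1 := ell_mk p1 (cell_avg (Lfun_of_Lspace g)).
have fin (f : ellp p1) := crd_fin md f.
have stepL (f : ellp p1) : cell_step (ell_crd f) \in Lfun mu p%:E by exact: (cell_step_Lfun (fin f)).
have repL (g : Lp) : (Lfun_of_Lspace g : T -> R) \in Lfun mu p%:E by exact: LfunP.
have avgF (g : Lp) : (lps p (cell_avg (Lfun_of_Lspace g)) <= (`|g| `^ p)%:E)%E.
  by rewrite -norm_Lspace_repr; exact: lps_cell_avg.
have avgf (g : Lp) : (lps p (cell_avg (Lfun_of_Lspace g)) < +oo)%E.
  by apply: le_lt_trans (avgF g) _; rewrite ltry.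
apply: (@E1_reducible_position R p _ _ _ _ iota pi 1 1 p0 bad md) => //.
- move=> a f g; apply: Lspace_eqP.
  have HA := Lspace_mk_ae p1 (stepL (a *: f + g)); have HB := Lspace_repr_lin a (iota f) (iota g).
  have HC := Lspace_mk_ae p1 (stepL f); have HD := Lspace_mk_ae p1 (stepL g).
  have HE : (Lfun_of_Lspace (a *: iota f + iota g) : T -> R) = cell_step (ell_crd (a *: f + g)) %[ae mu].
    apply: filterS3 HB HC HD => t h2 h3 h4 tT.
    by rewrite (h2 tT) (h3 tT) (h4 tT) /cell_step (crd_lin md) mulrDl mulrA.
  by apply: filterS2 HA HE => t h1 h2 tT; rewrite (h1 tT) (h2 tT).
- move=> a f g; rewrite /pi -(mk_lin md)//; congr (ell_mk p1 _).
  rewrite (cell_avg_ae (repL _) _ (Lspace_repr_lin a f g)).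
    by apply/funext => k; rewrite cell_avg_lin.
  exact: (rpredD (rpredZ a (repL f)) (repL g)).
- move=> f; have := @le_norm_powR _ _ p0 `|iota f| `|f| 1 (normr_ge0 _) (normr_ge0 _) ler01.
  rewrite powR1 !mul1r; apply; rewrite -lee_fin Lspace_mk_norm// integral_cell_step.
  by rewrite (crd_norm md).
- move=> g; have := @le_norm_powR _ _ p0 `|pi g| `|g| 1 (normr_ge0 _) (normr_ge0 _) ler01.
  by rewrite powR1 !mul1r; apply; rewrite -lee_fin (mk_norm md).
- move=> f; rewrite /pi (cell_avg_ae (repL _) (stepL f) (Lspace_mk_ae p1 (stepL f))).
  rewrite -[RHS](crdK md); congr (ell_mk p1 _); apply/funext => k.
  exact: cell_avg_step.
Qed.

End Lspace_partition.

Section Lp01_partition.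
Context {R : realType} (p : R) (p1 : 1 <= p).
Local Notation mu := (@lebesgue01 R).

(** Cell k is the interval ]1/(k+2), 1/(k+1)]. Cell 0 absorbs in addition all points outside ]0, 1],
    so that the cells cover the whole line. *)
Definition recip_cell (t : R) : nat := (Num.truncn t^-1).-1.
Local Notation F k := (recip_cell @^-1` [set k]).

Lemma recip_cell_itv k (t : R) : t \in `]k.+2%:R^-1, k.+1%:R^-1] -> recip_cell t = k.
Proof.
rewrite in_itv/= => /andP[t1 t2].
have t0 : 0 < t by apply: lt_trans t1; rewrite invr_gt0.
rewrite /recip_cell (@truncn_def _ _ k.+1)//.
by rewrite -invf_pge ?posrE// t2/= -invf_plt ?posrE.
Qed.

Lemma recip_cell_inv k (t : R) : (0 < k)%N -> recip_cell t = k ->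
  t \in `]k.+2%:R^-1, k.+1%:R^-1].
Proof.
move=> k0; rewrite /recip_cell => tk.
have tE : Num.truncn t^-1 = k.+1 by rewrite -tk prednK//; case: Num.truncn tk k0 => // <-.
have t1 : 1 <= t^-1 by rewrite -truncn_gt0 tE.
have ti0 : 0 <= t^-1 by exact: le_trans t1.
have t0 : 0 < t by rewrite -invr_gt0; exact: lt_le_trans t1.
have := truncn_itv ti0; rewrite tE => /andP[h1 h2].
by rewrite in_itv/= invf_pge ?posrE// h1 andbT invf_plt ?posrE.
Qed.

Lemma measurable_recip_cell k : measurable (F k).
Proof.
have mS j : measurable (F j.+1).
  rewrite (_ : F j.+1 = [set` `]j.+3%:R^-1, j.+2%:R^-1]])//.
  by apply/seteqP; split=> t /=; [exact: recip_cell_inv|exact: recip_cell_itv].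
case: k => [|k]; last exact: mS.
rewrite (_ : F 0%N = ~` \bigcup_j F j.+1); last first.
  apply/seteqP; split=> t /=; first by move=> t0 [j _ /=]; rewrite t0.
  by move=> h; case E : (recip_cell t) => [//|j]; case: h; exists j.
by apply: measurableC; apply: bigcup_measurable => j _; exact: mS.
Qed.

Lemma lebesgue01_recip_cell k : (0 < mu (F k))%E.
Proof.
apply: (@lt_le_trans _ _ (mu [set` `]k.+2%:R^-1, k.+1%:R^-1]])); last first.
  apply: le_measure; rewrite ?inE//; first exact: measurable_recip_cell.
  by move=> t /=; exact: recip_cell_itv.
rewrite /lebesgue01 /mrestr (_ : _ `&` _ = [set` `]k.+2%:R^-1, k.+1%:R^-1]]); last first.
  apply/seteqP; split=> t /=; first by case.
  rewrite !in_itv/= => /andP[t1 t2]; split; first by rewrite t1.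
  apply/andP; split; first by apply/ltW/(lt_trans _ t1); rewrite invr_gt0.
  by apply: le_trans t2 _; rewrite invf_le1// ler1n.
have h : k.+2%:R^-1 < k.+1%:R^-1 :> R by rewrite ltf_pV2 ?posrE// ltr_nat.
by rewrite lebesgue_measure_itv/= lte_fin h -EFinB lte_fin subr_gt0.
Qed.

Lemma lebesgue01_setT_fin : mu [set: R] \is a fin_num.
Proof.
rewrite ge0_fin_numE// /lebesgue01 /mrestr setTI lebesgue_measure_itv/= lte_fin ltr01.
by rewrite -EFinB ltry.
Qed.

Theorem E1_reducible_Lp01 : bad_embeddings p ->
  borel_reducible (@E1 R) (position (ellp p1) (Lp01 p1)).
Proof.
move=> bad.
exact: (E1_reducible_partition p1 lebesgue01_setT_fin measurable_recip_cell lebesgue01_recip_cell bad).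
Qed.

End Lp01_partition.

(** * Baire category *)

Section category.
Context {T : topologicalType}.
Implicit Types A D Q U : set T.

Definition comeager D : Prop :=
  exists Q : nat -> set T, (forall k, open (Q k) /\ dense (Q k)) /\ \bigcap_k Q k `<=` D.

Lemma comeagerS D D' : D `<=` D' -> comeager D -> comeager D'.
Proof. by move=> DD' [Q [hO OD]]; exists Q; split=> //; exact: subset_trans OD DD'. Qed.

Lemma comeager_open_dense Q : open Q -> dense Q -> comeager Q.
Proof. by move=> oQ dO; exists (fun=> Q); split=> // x h; exact: (h 0%N I). Qed.

Lemma comeagerT : comeager setT.
Proof. by apply: comeager_open_dense => [|Q Q0 _]; [exact: openT|rewrite setIT]. Qed.

Lemma comeager_bigcap (J : countType) (D : J -> set T) :
  (forall i, comeager (D i)) -> comeager (\bigcap_i D i).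
Proof.
move=> /choice[Q hO].
pose P k := if @unpickle (J * nat)%type k is Some (i, j) then Q i j else setT.
exists P; split=> [k|x hx i _].
  rewrite /P; case: unpickle => [[i j]|]; first exact: (hO i).1.
  by split; [exact: openT|move=> Q' Q0 _; rewrite setIT].
apply: (hO i).2 => j _; have := hx (pickle (i, j)) I.
by rewrite /P pickleK.
Qed.

Lemma comeagerI D D' : comeager D -> comeager D' -> comeager (D `&` D').
Proof.
move=> cD cD'; apply: comeagerS (@comeager_bigcap bool (fun b => if b then D else D') _) => [x h|[]//].
by split; [exact: (h true I)|exact: (h false I)].
Qed.

(** An open set together with its exterior misses only the boundary, which is nowhere dense; this
    gives complements in the class of sets with the Baire property. *)
Lemma dense_openU_ext Q : open Q -> dense (Q `|` interior (~` Q)).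
Proof.
move=> oQ W [w Ww] oW.
have [[v [Wv Ov]]|h] := pselect (W `&` Q !=set0); first by exists v; split=> //; left.
exists w; split=> //; right; rewrite /interior/= nbhsE; exists W; first by split.
by move=> z Wz Oz; apply: h; exists z.
Qed.

Definition baire_property A : Prop := exists2 Q, open Q & comeager [set x | A x <-> Q x].

Lemma borel_baire_property A : borel A -> baire_property A.
Proof.
apply: (@smallest_sub _ (sigma_algebra [set: T]) _ baire_property); last first.
  by move=> Q oQ; exists Q => //; apply: comeagerS comeagerT.
split=> [|B [Q oQ cQ]|F hF].
- by exists set0; [exact: open0|apply: comeagerS comeagerT].
- exists (interior (~` Q)); first exact: open_interior.
  have := comeager_open_dense (openU oQ (@open_interior _ (~` Q))) (dense_openU_ext oQ).
  move=> /(comeagerI cQ); apply: comeagerS => x [/= BQ h]; split=> [[_ nB]|].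
    by case: h => // Qx; case: nB; apply/BQ.
  by move=> /interior_subset nQ; split=> // Bx; apply: nQ; apply/BQ.
- have /choice[Q hQ] : forall i, exists Q, open Q /\ comeager [set x | F i x <-> Q x].
    by move=> i; have [Q] := hF i; exists Q.
  exists (\bigcup_i Q i); first by apply: bigcup_open => i _; case: (hQ i).
  have : comeager (\bigcap_i [set x | F i x <-> Q i x]) by apply: comeager_bigcap => i; case: (hQ i).
  apply: comeagerS => x h; split=> -[i _ Fx]; exists i => //; exact/(h i I).
Qed.

(** The preimage of each basic open set coincides with an open set on a comeager set; intersecting
    over the countable base gives a comeager set on which f is continuous. *)
Lemma borel_continuous_comeager (Z : topologicalType) (f : T -> Z) (B : nat -> set Z) :
  borel_map f -> (forall n, open (B n)) ->
  (forall W z, open W -> W z -> exists n, B n z /\ B n `<=` W) ->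
  exists2 C : set T, comeager C &
    forall x W, C x -> open W -> W (f x) -> exists U, [/\ open U, U x & forall y, U y -> C y -> W (f y)].
Proof.
move=> bf oB hB.
have /choice[Q hQ] : forall n, exists Q, open Q /\ comeager [set x | B n (f x) <-> Q x].
  move=> n; have [Q oQ cQ] : baire_property (f @^-1` B n).
    by apply: borel_baire_property; apply: bf; exact: (open_borel (oB n)).
  by exists Q.
exists (\bigcap_n [set x | B n (f x) <-> Q n x]).
  by apply: comeager_bigcap => n; case: (hQ n).
move=> x W Cx oW Wx; have [n [Bx BW]] := hB W (f x) oW Wx.
exists (Q n); split; [by case: (hQ n)|exact/(Cx n I)|].
by move=> y Qy Cy; apply: BW; apply/(Cy n I).
Qed.

Definition nonmeager_at A : set T :=
  [set x | forall U, open U -> U x -> ~ comeager (~` (A `&` U))].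

(** A is meager in the union G of the basic open sets in which it is meager. If [nonmeager_at A]
    contained no nonempty open part of V, then G would be dense in V and A would be meager in V. *)
Lemma nonmeager_at_localize (B : nat -> set T) A V : (forall n, open (B n)) ->
  (forall W x, open W -> W x -> exists n, B n x /\ B n `<=` W) ->
  open V -> ~ comeager (~` (A `&` V)) ->
  exists W, [/\ open W, W !=set0, W `<=` V & W `<=` nonmeager_at A].
Proof.
move=> oB hB oV nA; apply: contrapT => nW; apply: nA.
pose G := \bigcup_n (if `[< comeager (~` (A `&` B n)) >] then B n else set0).
have oG : open G by apply: bigcup_open => n _; case: asboolP => // _; exact: open0.
have cG : comeager (G `|` interior (~` V)).
  apply: comeager_open_dense; first by apply: openU => //; exact: open_interior.
  move=> W W0 oW.
  have [h|h] := pselect (V `&` W !=set0); last first.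
    have [w Ww] := W0; exists w; split=> //; right; rewrite /interior/= nbhsE.
    by exists W; [split|move=> z Wz Vz; apply: h; exists z].
  have : ~ (V `&` W `<=` nonmeager_at A).
    move=> VW; apply: nW; exists (V `&` W); split=> //; exact: openI.
  move=> /existsNP[x /not_implyP[[Vx Wx]]] /existsNP[U] /not_implyP[oU] /not_implyP[Ux] /contrapT cU.
  have [n [Bx BU]] := hB U x oU Ux; exists x; split=> //; left; exists n => //.
  case: asboolP => // -[]; apply: comeagerS cU => z nz [Az Bz]; apply: nz; split=> //.
  exact: BU.
have : comeager (\bigcap_n (if `[< comeager (~` (A `&` B n)) >] then ~` (A `&` B n) else setT)).
  by apply: comeager_bigcap => n; case: asboolP => // _; exact: comeagerT.
move=> /(comeagerI cG); apply: comeagerS => x [h1 h2] [Ax Vx].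
case: h1 => [[n _]|/interior_subset//].
by have := h2 n I; case: asboolP => // _ h Bx; apply: h.
Qed.

End category.

(** * Approximately continuous choice of solutions on a comeager set *)

Section selection.
Context {T : topologicalType} {R : realType} {H : Type}.
Variables (B : nat -> set T) (d : H -> H -> R) (h : nat -> H) (F : T -> H -> Prop) (C : set T).
Hypothesis oB : forall n, open (B n).
Hypothesis hB : forall W x, open W -> W x -> exists n, B n x /\ B n `<=` W.
Hypothesis baire : forall D U : set T, comeager D -> open U -> U !=set0 -> U `&` D !=set0.
Hypothesis dsym : forall x y, d x y = d y x.
Hypothesis dtri : forall x y z, d x z <= d x y + d y z.
Hypothesis hdense : forall g e, 0 < e -> exists i, d g (h i) < e.
Hypothesis dcomplete : forall u : nat -> H,
  (forall e : R, 0 < e -> exists N, forall m n, (N <= m)%N -> (N <= n)%N -> d (u m) (u n) < e) ->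
  exists l, forall e : R, 0 < e -> exists N, forall n, (N <= n)%N -> d l (u n) < e.
Hypothesis cC : comeager C.
Hypothesis Fex : forall x, C x -> exists g, F x g.
Hypothesis Fclosed : forall x g, C x -> ~ F x g -> exists U (e : R),
  [/\ open U, U x, 0 < e & forall y g', U y -> C y -> d g g' < e -> ~ F y g'].

Let r (k : nat) : R := 2^-1 ^+ k.

Let r_gt0 k : 0 < r k. Proof. by rewrite exprn_gt0// invr_gt0. Qed.

Let r_le j k : (j <= k)%N -> r k <= r j.
Proof.
move=> jk; rewrite /r -(subnK jk) exprD; apply: ler_piMl; first exact: ltW (r_gt0 j).
by apply: exprn_ile1; rewrite ?invr_ge0// invf_le1// ler1n.
Qed.

Let r_small (e : R) : 0 < e -> exists N, r N < e.
Proof.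
move=> e0; have h01 : 0 <= (2^-1 : R) < 1 by rewrite invr_ge0 ler0n/= invf_lt1 ?ltr1n.
have e20 : 0 < e / 2 by rewrite divr_gt0.
have [N [_ hN]] := exprn_lt_eps h01 e20; exists N; apply: le_lt_trans hN _.
by rewrite ltr_pdivrMr// mulr_natr mulr2n ltrDl.
Qed.

(** A list is a node of the tree, its latest centre at the head; the head of [i :: s'] stands for a
    ball of radius 2^-(size s'). The balls need not be nested: only a common point g is asked
    for. *)
Fixpoint ball_chain (s : seq nat) (g : H) : Prop :=
  if s is i :: s' then d g (h i) < r (size s') /\ ball_chain s' g else True.

Let A s : set T := [set x | C x /\ exists g, F x g /\ ball_chain s g].
Let G s : set T := interior (nonmeager_at (A s)).

(* The sets [A s] are analytic, but their Baire property is not needed: it is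
   enough to know where they are nonmeager. *)
Definition selection_domain : set T :=
  C `&` \bigcap_s [set x | G s x -> exists i, G (i :: s) x].
Local Notation D := selection_domain.

(** Since the [h i] are dense, [A s] is the union of the [A (i :: s)]. Where [A s] is nonmeager in
    an open set, some child is nonmeager there and hence locally so in a smaller open set. Thus the
    open sets [G (i :: s)] are dense in [G s]. *)
Lemma comeager_selection_domain : comeager D.
Proof.
apply: comeagerI => //; apply: comeager_bigcap => s.
have oG s' : open (G s') by exact: open_interior.
apply: (@comeagerS _ (\bigcup_i G (i :: s) `|` interior (~` G s))).
  by move=> x [[i _ Gx] _|/interior_subset nG /nG//]; exists i.
apply: comeager_open_dense; first by apply: openU; [exact: bigcup_open|exact: open_interior].
move=> W [w0 Ww0] oW.
have [[v [Gv Wv]]|hn] := pselect (G s `&` W !=set0); last first.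
  exists w0; split=> //; right; rewrite /interior/= nbhsE.
  by exists W; [split|move=> z Wz Gz; apply: hn; exists z].
have oV : open (G s `&` W) by exact: openI.
have : exists i, ~ comeager (~` (A (i :: s) `&` (G s `&` W))).
  apply: contrapT => /forallNP hA.
  apply: (interior_subset Gv _ oV) => //.
  have := comeager_bigcap (fun i => contrapT (hA i)).
  apply: comeagerS => x hx [[Cx [g [Fg Wg]]] Vx].
  have [i hi] := hdense g (r_gt0 (size s)).
  by apply: (hx i I); split=> //; split=> //; exists g.
move=> [i hi].
have [V [oV' [v' Vv'] VS VH]] := nonmeager_at_localize oB hB oV hi.
exists v'; split; first by case: (VS v' Vv').
left; exists i => //; rewrite /G /interior/= nbhsE; by exists V.
Qed.

Let G_nil x : G [::] x.
Proof.
rewrite /G /interior/= nbhsE; exists setT; first by split => //; exact: openT.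
move=> y _ U oU Uy /(comeagerI cC) hc.
have U0 : U !=set0 by exists y.
have [z [Uz [Cz nz]]] := baire hc oU U0.
by apply: nz; split=> //; split=> //; have [g Fg] := Fex Cz; exists g.
Qed.

Let G_point x s U : G s x -> open U -> U x ->
  exists y g, [/\ U y, C y, F y g & ball_chain s g].
Proof.
move=> Gx oU Ux; apply: contrapT => hn.
have nm : ~ comeager (~` (A s `&` U)) by exact: (interior_subset Gx U oU Ux).
case: nm; apply: comeagerS comeagerT => y _ [[Cy [g [Fg Wg]]] Uy]; apply: hn.
by exists y, g.
Qed.

(** From s one descends through nodes whose [G] contains x; the centres form a Cauchy sequence with
    limit g. If g were not a solution at x, there would be none near g at points near x. But each
    node is nonmeager near x, so there is a point y near x with a solution in its balls. *)
Lemma selection_branch x s : D x -> G s x -> exists g (br : nat -> seq nat),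
  [/\ F x g, br 0%N = s, forall k, exists i, br k.+1 = i :: br k, forall k, G (br k) x &
      forall k i s', br k = i :: s' -> d g (h i) <= 2 * r (size s')].
Proof.
move=> [Cx Dx] Gs.
have /choice[nxt hnxt] : forall s, exists i, G s x -> G (i :: s) x.
  by move=> s'; have [/(Dx s' I)[i Gi]|nG] := pselect (G s' x); [exists i|exists 0%N].
pose br k := iter k (fun s => nxt s :: s) s.
have sbr k : size (br k) = (size s + k)%N by elim: k => [|k IH]; rewrite ?addn0//= IH addnS.
have Gbr k : G (br k) x by elim: k => [//|k IH]; exact: hnxt.
have Wbr j k g : (j <= k)%N -> ball_chain (br k) g -> ball_chain (br j) g.
  elim: k => [|k IH]; first by rewrite leqn0 => /eqP->.
  by rewrite leq_eqVlt => /orP[/eqP->//|jk] [_]; exact: IH.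
pose c k := h (nxt (br k)).
have Wc k g : ball_chain (br k.+1) g -> d g (c k) < r (size s + k).
  by move=> [+ _]; rewrite sbr.
have claim k i s' l : br k = i :: s' -> (k <= l)%N -> d (h i) (c l) < r (size s') + r (size s + l).
  move=> E kl; have [y [g' [_ _ _ Wg]]] := G_point (Gbr l.+1) openT (I : setT x).
  have := Wbr k l.+1 g' (leqW kl) Wg; rewrite E => -[h1 _].
  apply: le_lt_trans (dtri _ g' _) _; rewrite (dsym (h i)); apply: ltrD => //; exact: Wc.
have claimc j l : (j < l)%N -> d (c j) (c l) < r (size s + j) + r (size s + l).
  by move=> jl; rewrite -(sbr j); exact: (claim j.+1 _ (br j)).
have [g hg] : exists l, forall e : R, 0 < e -> exists N, forall n, (N <= n)%N -> d l (c n) < e.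
  apply: dcomplete => e e0; have e40 : 0 < e / 4 by rewrite divr_gt0.
  have [N hN] := r_small e40; exists N => m n Nm Nn.
  pose L := (maxn m n).+1.
  apply: le_lt_trans (dtri _ (c L) _) _; rewrite (dsym (c L)).
  have mL : (m < L)%N by rewrite ltnS leq_maxl.
  have nL : (n < L)%N by rewrite ltnS leq_maxr.
  have h1 := claimc m L mL; have h2 := claimc n L nL.
  have rr j : (N <= j)%N -> r (size s + j) < e / 4.
    by move=> Nj; apply: le_lt_trans hN; apply: r_le; exact: leq_trans (leq_addl _ _).
  have := rr _ Nm; have := rr _ Nn; have := rr L (leq_trans Nm (ltnW mL)).
  by move: h1 h2; move: (r _) (r _) (r _) (d _ _) (d _ _) => *; lra.
have lim k i s' : br k = i :: s' -> d g (h i) <= 2 * r (size s').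
  move=> E; apply/ler_addgt0Pr => e e0; have [N hN] := hg e e0.
  pose l := maxn N k.
  apply: le_trans (dtri _ (c l) _) _; rewrite addrC [d (c l) _]dsym; apply: lerD.
    apply: le_trans (ltW (claim k i s' l E (leq_maxr _ _))) _.
    rewrite mulr_natl mulr2n lerD2l; apply: r_le.
    have := congr1 size E; rewrite sbr/= => h1.
    have := leq_maxr N k; rewrite -/l; lia.
  by apply/ltW/hN; exact: leq_maxl.
exists g, br; split=> // [|k]; last by exists (nxt (br k)).
apply: contrapT => nF; have [U [e [oU Ux e0 hU]]] := Fclosed Cx nF.
have e20 : 0 < e / 2 by rewrite divr_gt0.
have [N1 hN1] := hg _ e20; have [N2 hN2] := r_small e20.
pose l := maxn N1 N2.
have [y [g' [Uy Cy Fy Wg]]] := G_point (Gbr l.+1) oU Ux.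
apply: (hU y g' Uy Cy _ Fy); apply: le_lt_trans (dtri _ (c l) _) _.
rewrite (dsym (c l)) (splitr e); apply: ltrD; first by apply: hN1; exact: leq_maxl.
apply: lt_trans (Wc _ _ Wg) _; apply: le_lt_trans hN2; apply: r_le.
exact: leq_trans (leq_maxr _ _) (leq_addl _ _).
Qed.

(** Every y in the open set of a node on the branch of x can start its own branch at that node. Both
    limits are then close to the centre at the head of the node. *)
Lemma selection x : D x -> exists g, F x g /\ forall e : R, 0 < e ->
  exists U, [/\ open U, U x & forall y, U y -> D y -> exists g', F y g' /\ d g g' < e].
Proof.
move=> Dx; have [g [br [Fg br0 brS Gbr hg]]] := selection_branch Dx (G_nil x).
exists g; split=> // e e0; have e40 : 0 < e / 4 by rewrite divr_gt0.
have [N hN] := r_small e40.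
have sbr k : size (br k) = k.
  by elim: k => [|k IH]; [rewrite br0|have [i ->] := brS k; rewrite /= IH].
exists (G (br N.+1)); split; [exact: open_interior|exact: Gbr|move=> y Gy Dy].
have [g' [br' [Fg' br0' _ _ hg']]] := selection_branch Dy Gy.
have [i E] := brS N.
exists g'; split=> //; apply: le_lt_trans (dtri _ (h i) _) _.
have := hg _ _ _ E; have := hg' 0%N i (br N); rewrite br0' E => /(_ erefl).
by rewrite sbr (dsym (h i)); move: hN; move: (r N) (d _ _) (d _ _) => *; lra.
Qed.

End selection.

(** * Category in the space of real sequences *)

Section sequence_category.
Context {R : realType}.
Local Notation T := ({ptws nat -> R} : Type).
Local Notation TT := {ptws nat -> R}.

Lemma ptws_cvg_seq (u : nat -> TT) (l : TT) :
  (forall i e, 0 < e -> exists N, forall n, (N <= n)%N -> `|l i - u n i| < e) ->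
  u @ \oo --> l.
Proof.
move=> h; apply/pointwise_cvgP => i; apply/cvgrPdist_lt => e e0.
by have [N hN] := h i e e0; exists N => // n /= /hN.
Qed.

(** One parameter governs both the number of restricted coordinates and the radius, so that the
    boxes around x form a decreasing sequence of neighbourhoods. *)
Definition box (x : TT) (k : nat) : set TT :=
  [set y | forall i, (i < k)%N -> `|x i - y i| < k.+1%:R^-1].

Lemma open_slab (x : nat -> R) (e : R) n : open [set y : TT | forall i, (i < n)%N -> `|x i - y i| < e].
Proof.
elim: n => [|n IH].
  by rewrite (_ : [set _ | _] = setT); [exact: openT|apply/seteqP; split].
have -> : [set y : TT | forall i, (i < n.+1)%N -> `|x i - y i| < e] =
    [set y : TT | forall i, (i < n)%N -> `|x i - y i| < e] `&` (proj n @^-1` [set z | `|x n - z| < e]).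
  apply/seteqP; split=> [y h|y [h1 h2] i].
    by split=> [i ni|]; [exact: h (ltnW _)|exact: h].
  by rewrite ltnS leq_eqVlt => /orP[/eqP->//|]; exact: h1.
apply: openI => //; apply: open_comp; first by move=> y _; exact: (@proj_continuous nat (fun=> R) n y).
rewrite (_ : [set z | _] = ball (x n) e) ?ball_normE//.
have [e0|e0] := ltP 0 e; first exact: ball_open.
by rewrite (ball0 _ _).2//; exact: open0.
Qed.

Lemma open_box x k : open (box x k). Proof. exact: open_slab. Qed.

Lemma box_refl x k : box x k x. Proof. by move=> i _; rewrite subrr normr0 invr_gt0. Qed.

Lemma inv_succ_le k l : (k <= l)%N -> l.+1%:R^-1 <= k.+1%:R^-1 :> R.
Proof. by move=> kl; rewrite lef_pV2 ?posrE// ler_nat. Qed.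

Lemma box_mono x k l : (k <= l)%N -> box x l `<=` box x k.
Proof.
move=> kl y h i ik; apply: lt_le_trans (h i (leq_trans ik kl)) _; exact: inv_succ_le.
Qed.

Lemma inv_succ_small (e : R) : 0 < e -> exists N, forall n, (N <= n)%N -> n.+1%:R^-1 < e.
Proof.
move=> e0; exists (Num.truncn e^-1) => n Nn.
rewrite invf_plt ?posrE//; apply: lt_le_trans (truncnS_gt _) _.
by rewrite ler_nat.
Qed.

Lemma nbhs_box (W : set TT) x : open W -> W x -> exists k, box x k `<=` W.
Proof.
move=> oW Wx; apply: contrapT => /forallNP nW.
have /choice[y hy] : forall k, exists y, box x k y /\ ~ W y.
  by move=> k; have /existsNP[y /not_implyP] := nW k; exists y.
have yc : y @ \oo --> x.
  apply: ptws_cvg_seq => i e e0; have [N hN] := inv_succ_small e0.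
  exists (maxn N i.+1) => n; rewrite geq_max => /andP[Nn ni].
  by apply: lt_trans ((hy n).1 i ni) (hN n Nn).
have [N _ hN] := yc _ (open_nbhs_nbhs (conj oW Wx)).
by apply: (hy N).2; exact: (hN N (leqnn N)).
Qed.

Definition rat_box (n : nat) : set TT :=
  if @unpickle (seq rat) n is Some q
  then [set y | forall i, (i < size q)%N -> `|ratr (nth 0 q i) - y i| < (size q).+1%:R^-1]
  else set0.

Lemma open_rat_box n : open (rat_box n).
Proof. by rewrite /rat_box; case: unpickle => [q|]; [exact: open_slab|exact: open0]. Qed.

Lemma rat_box_base (W : set TT) x : open W -> W x -> exists n, rat_box n x /\ rat_box n `<=` W.
Proof.
move=> oW Wx; have [k kW] := nbhs_box oW Wx.
(* Then 2 / (l + 1) = 1 / (k + 1): the rational approximation and the radius of the rational box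
   together fit into the given box. *)
pose l := (k.*2.+1)%N; have l0 : 0 < l.+1%:R^-1 :> R by rewrite invr_gt0.
have /choice[q hq] : forall i, exists q : rat, `|ratr q - x i| < l.+1%:R^-1.
  move=> i; have h : x i - l.+1%:R^-1 < x i + l.+1%:R^-1.
    by apply: lt_trans (_ : x i < _); rewrite ?ltrDl// ltrBlDr ltrDl.
  have [q] := rat_in_itvoo h; rewrite in_itv/= => qx; exists q.
  by rewrite distrC ltr_distlC.
exists (pickle (mkseq q l)); rewrite /rat_box pickleK size_mkseq; split=> [i il|y hy].
  by rewrite nth_mkseq.
apply: kW => i ik; have il : (i < l)%N by rewrite /l ltnS (leq_trans (ltnW ik))// -addnn leq_addr.
have := hy i il; rewrite nth_mkseq// => h1; have h2 := hq i.
have -> : k.+1%:R^-1 = l.+1%:R^-1 + l.+1%:R^-1 :> R.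
  have E : l.+1%:R = k.+1%:R * 2 :> R by rewrite /l -natrM muln2.
  have kn0 : k.+1%:R != 0 :> R by rewrite pnatr_eq0.
  by rewrite E; move: kn0; move: (k.+1%:R : R) => a an0; field.
rewrite (_ : x i - y i = (x i - ratr (q i)) + (ratr (q i) - y i)); last by ring.
by apply: le_lt_trans (ler_normD _ _) _; apply: ltrD => //; rewrite distrC.
Qed.

(** Nested closed boxes. The box of stage n + 1 restricts more than n coordinates with radius below
    1 / (n + 1), so the centres converge coordinatewise and the limit lies in all closed boxes. *)
Lemma baire_sequences (D U : set TT) : comeager D -> open U -> U !=set0 -> U `&` D !=set0.
Proof.
move=> [Q [hQ QD]] oU [x0 Ux0]; have [k0 kU] := nbhs_box oU Ux0.
pose cbox (s : TT * nat) : set TT := [set y | forall i, (i < s.2)%N -> `|s.1 i - y i| <= s.2.+1%:R^-1].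
have step (ns : nat * (TT * nat)) : exists s' : TT * nat,
    cbox s' `<=` box ns.2.1 ns.2.2 `&` Q ns.1 /\ (ns.1 < s'.2)%N.
  case: ns => n [x k] /=; have [oQ dQ] := hQ n.
  have [z [bz Qz]] := dQ _ (ex_intro _ x (@box_refl x k)) (open_box x k).
  have [l lW] := nbhs_box (openI (open_box x k) oQ) (conj bz Qz).
  exists (z, (maxn l n).+1) => /=; split; last by rewrite ltnS leq_maxr.
  apply: subset_trans lW => y hy i il; apply: le_lt_trans (hy i _) _ => /=.
    by rewrite ltnS; apply: leq_trans (ltnW il) _; exact: leq_maxl.
  by rewrite ltf_pV2 ?posrE// ltr_nat !ltnS leq_maxl.
have [nxt hn] := choice step.
pose s := fix s n := if n is m.+1 then nxt (m, s m) else (x0, k0).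
have sS n : cbox (s n.+1) `<=` box (s n).1 (s n).2 `&` Q n by case: (hn (n, s n)).
have sk n : (n < (s n.+1).2)%N by case: (hn (n, s n)).
have boxc n : box (s n).1 (s n).2 `<=` cbox (s n) by move=> y h i ik; exact/ltW/h.
have boxS n m : box (s (n + m)%N).1 (s (n + m)%N).2 `<=` box (s n).1 (s n).2.
  elim: m => [|m IH]; first by rewrite addn0.
  rewrite addnS; apply: subset_trans IH; apply: subset_trans (boxc _) _.
  by move=> y /sS[].
have xin n m : (n <= m)%N -> box (s n).1 (s n).2 (s m).1.
  by move=> nm; apply: (boxS n (m - n)%N); rewrite subnKC//; exact: box_refl.
have cv i : cvg ((s m).1 i @[m --> \oo]).
  apply/cauchy_cvgP/cauchy_exP => e e0; have [N hN] := inv_succ_small e0.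
  pose n := (maxn N i).+1.
  exists ((s n).1 i); exists n => // m /= nm.
  rewrite -ball_normE /=; apply: lt_trans (xin n m nm i _) _.
    by apply: leq_trans (sk _); rewrite ltnS leq_maxr.
  by apply: hN; apply: leq_trans (ltnW (sk _)); exact: leq_maxl.
pose l : TT := fun i => lim ((s m).1 i @[m --> \oo]).
have lc n : cbox (s n) l.
  move=> i ik; apply/ler_addgt0Pr => e e0.
  have /cvgrPdist_lt/(_ e e0)[N _ hN] := cv i.
  pose m := maxn N n.
  have h1 := hN m (leq_maxl _ _); have h2 := xin n m (leq_maxr _ _) i ik.
  rewrite (_ : _ - l i = ((s n).1 i - (s m).1 i) - (l i - (s m).1 i)); last by ring.
  by apply: le_trans (ler_normB _ _) _; apply: lerD; exact: ltW.
exists l; split; first by apply: kU; case: (sS 0%N l (lc 1%N)).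
by apply: QD => n _; case: (sS n l (lc n.+1)).
Qed.

(* The new value of the coordinate [n] is read off a second sequence, so that
   Kuratowski-Ulam only involves category in the space of sequences. *)
Definition upd (n : nat) (x y : TT) : TT := fun m => if m == n then y m else x m.

Lemma open_boxP (A : set TT) : (forall x, A x -> exists k, box x k `<=` A) -> open A.
Proof.
move=> h; rewrite openE => x /h[k kA]; rewrite /interior/= nbhsE.
by exists (box x k) => //; split; [exact: open_box|exact: box_refl].
Qed.

Lemma open_updl n (y : TT) (W : set TT) : open W -> open [set x | W (upd n x y)].
Proof.
move=> oW; apply: open_boxP => x Wx; have [k kW] := nbhs_box oW Wx; exists k => z hz.
apply: kW => i ik; rewrite /upd; case: eqP => _; last exact: hz.
by rewrite subrr normr0 invr_gt0.
Qed.

Lemma open_updr n (x : TT) (W : set TT) : open W -> open [set y | W (upd n x y)].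
Proof.
move=> oW; apply: open_boxP => y Wy; have [k kW] := nbhs_box oW Wy; exists k => z hz.
apply: kW => i ik; rewrite /upd; case: eqP => _; first exact: hz.
by rewrite subrr normr0 invr_gt0.
Qed.

(** For each dense open [Q k] and each basic box, the x having some y in the box with [upd n x y] in
    [Q k] form a comeager set. For x in all of them, every section of every [Q k] is dense. *)
Lemma kuratowski_ulam n (D : set TT) : comeager D -> comeager [set x | comeager [set y | D (upd n x y)]].
Proof.
move=> [Q [hQ QD]].
have oV y k : open [set x | Q k (upd n x y)] by apply: open_updl; case: (hQ k).
have oH x k : open [set y | Q k (upd n x y)] by apply: open_updr; case: (hQ k).
pose E (km : nat * nat) : set TT := [set x | rat_box km.2 !=set0 -> exists2 y, rat_box km.2 y & Q km.1 (upd n x y)].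
have cE km : comeager (E km).
  case: km => k m; have [[y0 By0]|nB] := pselect (rat_box m !=set0); last first.
    by apply: comeagerS comeagerT => x _ /nB.
  apply: (@comeagerS _ (\bigcup_(y in rat_box m) [set x | Q k (upd n x y)])).
    by move=> x [y By Qy] _; exists y.
  apply: comeager_open_dense; first by apply: bigcup_open => y _; exact: oV.
  move=> W [x0 Wx0] oW.
  have [j jW] := nbhs_box oW Wx0; have [l lB] := nbhs_box (@open_rat_box m) By0.
  have [_ dQ] := hQ k.
  have [z [bz Qz]] := dQ _ (ex_intro _ _ (@box_refl (upd n x0 y0) (maxn j l))) (open_box _ _).
  have /= hj := box_mono (leq_maxl j l) bz; have /= hl := box_mono (leq_maxr j l) bz.
  (* A point z of [Q k] near [upd n x0 y0] is split: its coordinates other than n go to the x side,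
     its coordinate n to the y side, and recombining them gives z back. *)
  exists (upd n z x0); split.
    apply: jW => i ij; rewrite /upd; case: eqP => [_|ne]; first by rewrite subrr normr0 invr_gt0.
    by have := hj i ij; rewrite /upd; case: eqP ne.
  exists (upd n y0 z).
    apply: lB => i il; rewrite /upd; case: eqP => [E1|ne]; last by rewrite subrr normr0 invr_gt0.
    by have := hl i il; rewrite /upd E1 eqxx.
  rewrite /= (_ : upd n _ _ = z)//; apply/funext => i; rewrite /upd; case: eqP => //.
apply: comeagerS (comeager_bigcap cE) => x hx.
exists (fun k => [set y | Q k (upd n x y)]); split=> [k|y hy]; last by apply: QD => k _; exact: hy.
split=> // W [w Ww] oW.
have [m [Bw BW]] := rat_box_base oW Ww.
have [y By Qy] := hx (k, m) I (ex_intro _ w Bw).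
by exists y; split=> //; exact: BW.
Qed.

(** Each Kuratowski-Ulam step asks for sections in the previous set. Iterating countably often and
    intersecting gives a set whose sections are comeager for that set itself. *)
Lemma comeager_stable (D : set TT) : comeager D -> exists D' : set TT,
  [/\ comeager D', D' `<=` D & forall x n, D' x -> comeager [set y | D' (upd n x y)]].
Proof.
move=> cD; pose st (D : set TT) : set TT := D `&` \bigcap_n [set x | comeager [set y | D (upd n x y)]].
pose Dk k := iter k st D.
have cDk k : comeager (Dk k).
  elim: k => [//|k IH]; rewrite /Dk iterS; apply: comeagerI => //.
  by apply: comeager_bigcap => n; exact: kuratowski_ulam.
exists (\bigcap_k Dk k); split; first exact: comeager_bigcap.
  by move=> x /(_ 0%N I).
move=> x n hx; have h k : comeager [set y | Dk k (upd n x y)].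
  by have := hx k.+1 I; rewrite /Dk iterS => -[_ /(_ n I)].
by apply: comeagerS (comeager_bigcap h) => y hy k _; exact: hy.
Qed.

End sequence_category.

(** * The Kechris-Louveau theorem *)

Section metric_facts.
Context {R : realType} {T : topologicalType}.
Variable d : T -> T -> R.
Hypothesis dd : is_distance d.
Hypothesis di : distance_induces d.

Lemma dist_sym x y : d x y = d y x. Proof. by case: dd. Qed.
Lemma dist_tri x y z : d x z <= d x y + d y z. Proof. by case: dd. Qed.
Lemma dist_refl x : d x x = 0. Proof. by have [_ /(_ x x)[_ ->]] := dd. Qed.

Lemma open_dist_ball x e : open [set y | d x y < e].
Proof.
rewrite openE => y /= xy; rewrite /interior/=; apply/(di y).
exists (e - d x y); first by rewrite subr_gt0.
by move=> z /= yz; apply: le_lt_trans (dist_tri _ y _) _; rewrite -ltrBrDl.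
Qed.

Lemma open_dist (W : set T) x : open W -> W x -> exists2 e, 0 < e & [set y | d x y < e] `<=` W.
Proof. by move=> oW Wx; apply/(di x); apply: open_nbhs_nbhs; split. Qed.

Lemma dense_sequence : separable_space T -> T -> exists h : nat -> T,
  forall x e, 0 < e -> exists i, d x (h i) < e.
Proof.
move=> [D [cD dD]] x0.
have /countable_injP[f finj] := cD.
exists (fun n => xget x0 [set y | D y /\ f y = n]) => x e e0.
have [y [xy Dy]] : [set y | d x y < e] `&` D !=set0.
  by apply: dD; [exists x; rewrite /= dist_refl|exact: open_dist_ball].
exists (f y); case: xgetP => [z _ [Dz fz]|/(_ y)[]//].
by rewrite (finj z y)// inE.
Qed.

Lemma dist_base (h : nat -> T) : (forall x e, 0 < e -> exists i, d x (h i) < e) ->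
  exists B : nat -> set T, (forall n, open (B n)) /\
    forall W x, open W -> W x -> exists n, B n x /\ B n `<=` W.
Proof.
move=> hd; exists (fun n => if @unpickle (nat * nat)%type n is Some (i, k)
  then [set z | d (h i) z < k.+1%:R^-1] else set0); split=> [n|W x oW Wx].
  by case: unpickle => [[i k]|]; [exact: open_dist_ball|exact: open0].
have [e e0 eW] := open_dist oW Wx.
have e20 : 0 < e / 2 by rewrite divr_gt0.
have [k hk] := inv_succ_small e20; have {}hk := hk k (leqnn k).
have k0 : 0 < k.+1%:R^-1 :> R by rewrite invr_gt0.
have [i hi] := hd x _ k0.
exists (pickle (i, k)); rewrite pickleK; split=> [|z /= hz]; first by rewrite /= dist_sym.
apply: eW => /=; apply: le_lt_trans (dist_tri _ (h i) _) _.
by rewrite (splitr e); apply: ltrD; [exact: lt_trans hi hk|exact: lt_trans hz hk].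
Qed.

Lemma dist_cauchy_limit : complete_distance d -> forall u : nat -> T,
  (forall e : R, 0 < e -> exists N, forall m n, (N <= m)%N -> (N <= n)%N -> d (u m) (u n) < e) ->
  exists l, forall e : R, 0 < e -> exists N, forall n, (N <= n)%N -> d l (u n) < e.
Proof.
move=> dc u /dc[l ul]; exists l => e e0.
have nl : nbhs l [set y | d l y < e] by apply/(di l); exists e.
by have [N _ hN] := ul _ nl; exists N => n Nn; exact: hN.
Qed.

End metric_facts.

Section kechris_louveau.
Context {R : realType} {H : topologicalGroupType} {Z : topologicalType}.
Variables (act : H -> Z -> Z) (dH : H -> H -> R) (dZ : Z -> Z -> R).
Hypotheses (ddH : is_distance dH) (diH : distance_induces dH) (dcH : complete_distance dH).
Hypotheses (ddZ : is_distance dZ) (diZ : distance_induces dZ).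
Hypotheses (sH : separable_space H) (sZ : separable_space Z).
Hypothesis actP : continuous_action act.
Local Notation TT := {ptws nat -> R}.

Lemma act_continuous g b (e : R) : 0 < e -> exists d1 d2 : R, [/\ 0 < d1, 0 < d2 &
  forall g' b', dH g g' < d1 -> dZ b b' < d2 -> dZ (act g b) (act g' b') < e].
Proof.
move=> e0; have [_ _ ac] := actP.
have nW : nbhs (act g b) [set z | dZ (act g b) z < e] by apply/(diZ (act g b)); exists e.
have [[P Q] /= [nP nQ] PQ] := ac (g, b) _ nW.
have [d1 d10 h1] := (diH g P).1 nP; have [d2 d20 h2] := (diZ b Q).1 nQ.
exists d1, d2; split=> // g' b' hg hb.
by apply: (PQ (g', b')); split; [exact: h1|exact: h2].
Qed.

Lemma mulg_continuousl (x a : H) (e : R) : 0 < e -> exists2 d1 : R, 0 < d1 &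
  forall x', dH x x' < d1 -> dH (x * a)%g (x' * a)%g < e.
Proof.
move=> e0.
have nW : nbhs (x * a)%g [set z | dH (x * a)%g z < e] by apply/(diH (x * a)%g); exists e.
have [[P Q] /= [nP nQ] PQ] := @mulg_continuous H (x, a) _ nW.
have [d1 d10 h1] := (diH x P).1 nP; exists d1 => // x' hx.
by apply: (PQ (x', a)); split; [exact: h1|exact: nbhs_singleton nQ].
Qed.

Variable f : TT -> Z.
Hypothesis bf : borel_map f.
Hypothesis fE : forall x y, E1 x y <-> orbit_equivalence act (f x) (f y).

Let zero : TT := fun=> 0.

(** The value 0 is a common reference: two points that differ at n only are both compared with the
    same [upd n x zero]. *)
Definition coord_rel n (x : TT) (g : H) : Prop := f x = act g (f (upd n x zero)).

Lemma coord_rel_ex n x : exists g, coord_rel n x g.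
Proof.
apply/(fE (upd n x zero) x); exists n.+1 => m nm; rewrite /upd.
by case: eqP nm => // ->; rewrite ltnn.
Qed.

Lemma borel_upd n : borel_map (fun x => f (upd n x zero)).
Proof.
apply: borel_map_open => W oW.
have : borel (f @^-1` W) by apply: bf; exact: open_borel.
have bu : borel_map (fun x : TT => upd n x zero : TT).
  by apply: borel_map_open => V oV; apply: open_borel; exact: open_updl.
by move=> /bu.
Qed.

Lemma continuity_domain : exists2 C : set TT, comeager C &
  forall x (e : R), C x -> 0 < e -> (exists U, [/\ open U, U x & forall y, U y -> C y -> dZ (f x) (f y) < e]) /\
   forall n, exists U, [/\ open U, U x & forall y, U y -> C y ->
     dZ (f (upd n x zero)) (f (upd n y zero)) < e].
Proof.
have [h hh] := dense_sequence ddZ diZ sZ (f zero).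
have [B [oB hB]] := dist_base ddZ diZ hh.
have [C0 cC0 hC0] := borel_continuous_comeager bf oB hB.
have /choice[Cn hCn] : forall n, exists C : set TT, comeager C /\ forall x W, C x -> open W ->
    W (f (upd n x zero)) -> exists U, [/\ open U, U x & forall y, U y -> C y -> W (f (upd n y zero))].
  by move=> n; have [C cC hC] := borel_continuous_comeager (borel_upd n) oB hB; exists C.
exists (C0 `&` \bigcap_n Cn n).
  by apply: comeagerI => //; apply: comeager_bigcap => n; case: (hCn n).
move=> x e [Cx0 Cxn] e0; split=> [|n].
  have [U [oU Ux hU]] := hC0 x [set z | dZ (f x) z < e] Cx0 (open_dist_ball ddZ diZ _ _)
    (eq_ind_r (fun r => is_true (r < e)) e0 (dist_refl ddZ (f x))).
  by exists U; split=> // y Uy [Cy _]; exact: hU.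
have [_ hn] := hCn n.
have [U [oU Ux hU]] := hn x [set z | dZ (f (upd n x zero)) z < e] (Cxn n I) (open_dist_ball ddZ diZ _ _)
    (eq_ind_r (fun r => is_true (r < e)) e0 (dist_refl ddZ (f (upd n x zero)))).
by exists U; split=> // y Uy [_ Cy]; apply: hU => //; exact: Cy.
Qed.

Lemma dist_gt0 (x y : Z) : x <> y -> 0 < dZ x y.
Proof.
move=> xy; have [d0 dE _ _] := ddZ; rewrite lt_neqAle d0 andbT eq_sym.
by apply/eqP => /dE.
Qed.

(** On C both f and its composition with the replacement of coordinate n are continuous, so by
    continuity of the action an inequality between the two sides persists nearby. *)
Lemma coord_rel_closed (C : set TT) n x g :
  (forall x (e : R), C x -> 0 < e -> (exists U, [/\ open U, U x & forall y, U y -> C y -> dZ (f x) (f y) < e]) /\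
   forall n, exists U, [/\ open U, U x & forall y, U y -> C y ->
     dZ (f (upd n x zero)) (f (upd n y zero)) < e]) ->
  C x -> ~ coord_rel n x g -> exists U (e : R),
  [/\ open U, U x, 0 < e & forall y g', U y -> C y -> dH g g' < e -> ~ coord_rel n y g'].
Proof.
move=> hC Cx /dist_gt0; set r := dZ _ _ => r0.
have r20 : 0 < r / 2 by rewrite divr_gt0.
have [d1 [d2 [d10 d20 hd]]] := act_continuous g (f (upd n x zero)) r20.
have [[U [oU Ux hU]] _] := hC x _ Cx r20.
have [_ /(_ n)[V [oV Vx hV]]] := hC x _ Cx d20.
exists (U `&` V), d1; split=> //; first exact: openI.
move=> y g' [Uy Vy] Cy gg' E.
have h1 := hU y Uy Cy; have h2 := hd g' _ gg' (hV y Vy Cy).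
have := dist_tri ddZ (f x) (f y) (act g (f (upd n x zero))).
rewrite -/r {2}E (dist_sym ddZ (act g' _)) leNgt => /negP; apply.
by rewrite [ltRHS]splitr; apply: ltrD.
Qed.

Record good_state (D : set TT) (x0 : TT) (s : TT * H * nat) : Prop := {
  state_dom : D s.1.1;
  state_eq : f s.1.1 = act s.1.2 (f x0) }.

(** A state is a point, a group element carrying f x0 to its value under f, and the size of a box.
    The new point x' differs from x at n, lies in D and is so close to x that a solution g' at x' is
    near the solution gn at x. *)
Lemma state_step (D : set TT) (Q : nat -> set TT) x0 :
  (forall n, open (Q n)) -> D `<=` \bigcap_n Q n ->
  (forall x n, D x -> comeager [set y | D (upd n x y)]) ->
  (forall n x, D x -> exists g, coord_rel n x g /\ forall e : R, 0 < e ->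
    exists U, [/\ open U, U x & forall y, U y -> D y -> exists g', coord_rel n y g' /\ dH g g' < e]) ->
  forall n s, good_state D x0 s -> exists s', [/\ good_state D x0 s',
    exists y, s'.1.1 = upd n s.1.1 y, s'.1.1 n <> s.1.1 n, dH s.1.2 s'.1.2 < 2^-1 ^+ n &
    box s'.1.1 s'.2 `<=` box s.1.1 s.2 `&` Q n].
Proof.
move=> oQ DQ Dst Dsel n [[x g] k] [/= Dx fx].
have [gn [Fg hg]] := Dsel n x Dx.
have en : 0 < 2^-1 ^+ n :> R by rewrite exprn_gt0// invr_gt0.
have [d1 d10 hd1] := mulg_continuousl gn (gn^-1 * g)%g en.
have [U [oU Ux hU]] := hg _ d10.
have xE : upd n x x = x by apply/funext => i; rewrite /upd; case: eqP.
have oV : open [set y | (U `&` box x k) (upd n x y)].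
  by apply: open_updr; apply: openI => //; exact: open_box.
have cN : comeager [set y : TT | y n <> x n].
  apply: comeager_open_dense.
    rewrite (_ : [set y | _] = proj n @^-1` ~` [set x n])//.
    apply: open_comp; first by move=> y _; exact: (@proj_continuous nat (fun=> R) n y).
    exact/closed_openC/accessible_closed_set1/hausdorff_accessible/norm_hausdorff.
  move=> W [w Ww] oW; have [j jW] := nbhs_box oW Ww.
  have [wx|wx] := eqVneq (w n) (x n); last by exists w; split=> //; exact/eqP.
  exists (fun i => w i + j.+2%:R^-1); split.
    apply: jW => i ij; rewrite opprD addrA subrr add0r normrN ger0_norm ?invr_ge0//.
    by rewrite ltf_pV2 ?posrE// ltr_nat.
  move=> /= /eqP; rewrite wx addrC -subr_eq0 addrK => /eqP.
  by apply/eqP; rewrite invr_eq0 pnatr_eq0.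
have [|y [[Uy by_] [Dy yn]]] := baire_sequences (comeagerI (Dst x n Dx) cN) oV.
  by exists x; rewrite /= xE; split=> //; exact: box_refl.
set x' := upd n x y in Uy by_ Dy.
have [g' [Fg' gg']] := hU x' Uy Dy.
have x'E : upd n x' zero = upd n x zero.
  by apply/funext => i; rewrite /x' /upd; case: eqP.
have [l lQ] := nbhs_box (openI (open_box x k) (oQ n)) (conj by_ (DQ x' Dy n I)).
(* f x' is g' applied to the common reference value, which is gn^-1 applied to f x. Continuity at gn
   of right multiplication by gn^-1 g, whose value at gn is g, makes the new element close to g. *)
exists (x', (g' * (gn^-1 * g))%g, l); split=> //=.
- split=> //=; have [a1 aM _] := actP.
  have E : act gn^-1%g (f x) = f (upd n x zero) by rewrite Fg -aM mulVg a1.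
  by rewrite !aM -fx E Fg' x'E.
- by exists y.
- by rewrite /x' /upd eqxx.
- by have := hd1 g' gg'; rewrite {1}mulgA mulgV mul1g.
Qed.

Lemma kechris_louveau_aux : False.
Proof.
have [C cC hC] := continuity_domain.
have [h hh] := dense_sequence ddH diH sH 1%g.
have limH := dist_cauchy_limit diH dcH.
have symH := dist_sym ddH; have triH := dist_tri ddH.
have Fex n x : C x -> exists g, coord_rel n x g by move=> _; exact: coord_rel_ex.
have Fcl n x g := @coord_rel_closed C n x g hC.
pose Dn n := selection_domain dH h (coord_rel n) C.
have cDn n : comeager (Dn n).
  exact: (comeager_selection_domain (coord_rel n) (@open_rat_box R) (@rat_box_base R) hh cC).
have hDn n x : Dn n x -> exists g, coord_rel n x g /\ forall e : R, 0 < e ->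
    exists U, [/\ open U, U x & forall y, U y -> Dn n y -> exists g', coord_rel n y g' /\ dH g g' < e].
  exact: (selection (@baire_sequences R) symH triH limH cC (Fex n) (Fcl n)).
have [Q [hQ QC]] := cC.
have cQ : comeager (\bigcap_n Q n) by exists Q; split.
have [D [cD DS Dst]] := comeager_stable (comeagerI cQ (comeager_bigcap cDn)).
have DQ : D `<=` \bigcap_n Q n by move=> x /DS[].
have Dsel n x : D x -> exists g, coord_rel n x g /\ forall e : R, 0 < e ->
    exists U, [/\ open U, U x & forall y, U y -> D y -> exists g', coord_rel n y g' /\ dH g g' < e].
  move=> Dx; have [_ /(_ n I) Dnx] := DS x Dx.
  have [g [Fg hg]] := hDn n x Dnx; exists g; split=> // e e0.
  have [U [oU Ux hU]] := hg e e0; exists U; split=> // y Uy Dy.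
  by apply: hU => //; case: (DS y Dy) => _; apply.
have [x0 [_ Dx0]] := baire_sequences cD openT (ex_intro _ zero I).
have step ns : exists s', good_state D x0 ns.2 -> [/\ good_state D x0 s',
    exists y, s'.1.1 = upd ns.1 ns.2.1.1 y, s'.1.1 ns.1 <> ns.2.1.1 ns.1,
    dH ns.2.1.2 s'.1.2 < 2^-1 ^+ ns.1 &
    box s'.1.1 s'.2 `<=` box ns.2.1.1 ns.2.2 `&` Q ns.1].
  have [gs|ngs] := pselect (good_state D x0 ns.2); last by exists ns.2.
  have [s' hs'] := state_step (fun n => (hQ n).1) DQ Dst Dsel ns.1 gs.
  by exists s'.
have [nxt hn] := choice step.
pose s := fix s n := if n is m.+1 then nxt (m, s m) else (x0, 1%g, 0%N).
have gs n : good_state D x0 (s n).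
  elim: n => [|n IH]; first by split=> //=; have [a1 _ _] := actP; rewrite a1.
  by have [] := hn (n, s n) IH.
have hs n := hn (n, s n) (gs n).
pose x n := (s n).1.1; pose g n := (s n).1.2; pose bx n := box (x n) (s n).2.
have xS n i : i != n -> x n.+1 i = x n i.
  by move=> ne; have [_ [y E] _ _ _] := hs n; rewrite /x /= E /upd (negbTE ne).
have xn n : x n.+1 n <> x n n by have [] := hs n.
have bS n : bx n.+1 `<=` bx n `&` Q n by have [] := hs n.
have xlt i m : (m <= i)%N -> x m i = x0 i.
  elim: m => [//|m IH] mi; rewrite xS; first exact: IH (ltnW mi).
  by rewrite gt_eqF.
have xgt i m : (i < m)%N -> x m i = x i.+1 i.
  elim: m => [//|m IH]; rewrite ltnS leq_eqVlt => /orP[/eqP->//|im].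
  by rewrite xS ?IH// lt_eqF.
pose xinf : TT := fun i => x i.+1 i.
have bxS n m : bx (n + m)%N `<=` bx n.
  elim: m => [|m IH]; first by rewrite addn0.
  by rewrite addnS; apply: subset_trans IH => y /bS[].
have binf n : bx n xinf.
  move=> i ik; pose m := maxn n i.+1.
  have hm : bx n (x m).
    by apply: (bxS n (m - n)%N); rewrite subnKC ?leq_maxl//; exact: box_refl.
  by have := hm i ik; rewrite (xgt i m (leq_maxr _ _)).
(* The nested boxes keep the limit in every [Q n], hence in C, where f is continuous along the
   sequence. *)
have Cinf : C xinf.
  by apply: QC => n _; case: (bS n xinf (binf n.+1)).
have CD y : D y -> C y by move=> /DQ; exact: QC.
pose r k : R := 2^-1 ^+ k.
have gS n : dH (g n) (g n.+1) < r n by have [] := hs n.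
have gdist n m : dH (g n) (g (n + m)%N) <= 2 * (r n - r (n + m)%N).
  elim: m => [|m IH]; first by rewrite addn0 dist_refl// subrr mulr0.
  apply: le_trans (triH _ (g (n + m)%N) _) _; rewrite addnS.
  have := gS (n + m)%N; have -> : r (n + m)%N = 2 * r (n + m).+1.
    by rewrite /r exprS mulrA mulfV ?mul1r// pnatr_eq0.
  move: IH; have -> : r (n + m)%N = 2 * r (n + m).+1.
    by rewrite /r exprS mulrA mulfV ?mul1r// pnatr_eq0.
  by move: (r _) (r _) (dH _ _) (dH _ _) => *; lra.
have r0 k : 0 < r k by rewrite exprn_gt0// invr_gt0.
have [gl hgl] : exists l, forall e : R, 0 < e -> exists N, forall n, (N <= n)%N -> dH l (g n) < e.
  apply: limH => e e0.
  have h01 : 0 <= (2^-1 : R) < 1 by rewrite invr_ge0 ler0n/= invf_lt1 ?ltr1n.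
  have e80 : 0 < e / 8 by rewrite divr_gt0.
  have [N [_ hN]] := exprn_lt_eps h01 e80; exists N => m n Nm Nn.
  apply: le_lt_trans (triH _ (g N) _) _; rewrite (symH (g m)).
  have := gdist N (m - N)%N; have := gdist N (n - N)%N; rewrite !subnKC//.
  have := r0 m; have := r0 n; move: hN; rewrite -/(r N).
  by move: (r _) (r _) (r _) (dH _ _) (dH _ _) => *; lra.
(* f (x m) is g m applied to f x0: the left side tends to f xinf and the right side to gl applied to
   f x0. *)
have : orbit_equivalence act (f x0) (f xinf).
  exists gl; apply: contrapT => /dist_gt0; set e := dZ _ _ => e0.
  have e20 : 0 < e / 2 by rewrite divr_gt0.
  have [d1 [d2 [d10 d20 hd]]] := act_continuous gl (f x0) e20.
  have [[U [oU Ux hU]] _] := hC xinf _ Cinf e20.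
  have [k kU] := nbhs_box oU Ux; have [N hN] := hgl _ d10.
  pose m := maxn k N.
  have Um : U (x m).
    apply: kU => i ik; rewrite xgt ?subrr ?normr0 ?invr_gt0//.
    exact: leq_trans ik (leq_maxl _ _).
  have h1 := hU _ Um (CD _ (state_dom (gs m))).
  have dx0 : dZ (f x0) (f x0) < d2 by rewrite dist_refl.
  have h2 := hd (g m) (f x0) (hN m (leq_maxr _ _)) dx0.
  have := dist_tri ddZ (f xinf) (f (x m)) (act gl (f x0)).
  rewrite -/e leNgt => /negP; apply; rewrite [ltRHS]splitr; apply: ltrD => //.
  by rewrite (state_eq (gs m)) (dist_sym ddZ).
(* The reduction now claims that x0 and xinf agree from n on. But coordinate n is unchanged up to
   stage n, is altered at the step from n to n + 1, and stays fixed afterwards. *)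
move=> /fE[n /(_ n (leqnn n))]; rewrite /xinf => E.
by apply: (xn n); rewrite -E xlt.
Qed.

End kechris_louveau.

Theorem E1_not_reducible_to_polish_action {R : realType} :
  ~ reducible_to_polish_action R (@E1 R).
Proof.
move=> [H [Z [act [[sH [dH [ddH diH dcH]]] [sZ [dZ [ddZ diZ _]]] actP [f [bf fE]]]]]].
exact: (kechris_louveau_aux ddH diH dcH ddZ diZ sH sZ actP bf fE).
Qed.

Lemma bad_embeddings_neq2 {R : realType} (p : R) : 1 <= p -> p <> 2 -> bad_embeddings p.
Proof.
move=> p1 /eqP; rewrite neq_lt => /orP[p2|]; last exact: bad_embeddings_gt2.
by apply: bad_embeddings_lt2; rewrite p1.
Qed.

Lemma not_reducible_of_E1 {R : realType} (E : topologicalType) (r : E -> E -> Prop) :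
  borel_reducible (@E1 R) r -> ~ reducible_to_polish_action R r.
Proof.
move=> [f [bf fE]] [H [Z [act [pH pZ cact [g [bg gE]]]]]].
apply: (@E1_not_reducible_to_polish_action R); exists H, Z, act; split=> //.
exists (g \o f); split; first by move=> B BB; exact: bf (bg B BB).
by move=> x y; rewrite fE gE.
Qed.

Theorem theorem2p12 (R : realType) (p : R) (p1 : 1 <= p) (p2 : p <> 2) :
  (borel_reducible (@E1 R) (position (ellp p1) (ellp p1)) /\
   borel_reducible (@E1 R) (position (ellp p1) (Lp01 p1))) /\
  (~ reducible_to_polish_action R (position (ellp p1) (ellp p1)) /\
   ~ reducible_to_polish_action R (position (ellp p1) (Lp01 p1))).
Proof.
have bad := bad_embeddings_neq2 p1 p2.
have e1 := E1_reducible_ellp p1 bad; have e2 := E1_reducible_Lp01 p1 bad.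
by split; split=> //; exact: not_reducible_of_E1.
Qed.
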